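(* Let $A$ be either $\mathbb{H}$ or $\mathbb{O}$, let $\Omega\subset A$ be a non-empty open circular set and let $f:\Omega\to A$ be a slice function. The following statements are equivalent: (i) $f$ is a slice-Nash function on $\Omega$. (ii) There exist $I\in\mathbb{S}_A$ and a splitting base $\mathcal{B}_I=\{I_0:=1,I,I_1,II_1,\ldots,I_{u_A},II_{u_A}\}$ of $A$ associated to $I$ such that the components $f_k^{I,I_k}:\Omega_I\to\mathbb{C}_I$ of $f|_{\Omega_I}$ are $\mathbb{C}_I$-Nash functions on $\Omega_I$ for each $k=0,\ldots,u_A$. (iii) For each $I\in\mathbb{S}_A$ and each splitting base $\mathcal{B}_I=\{I_0:=1,I,I_1,II_1,\ldots,I_{u_A},II_{u_A}\}$ of $A$ associated to $I$, the components $f_k^{I,I_k}:\Omega_I\to\mathbb{C}_I$ of $f|_{\Omega_I}$ are $\mathbb{C}_I$-Nash functions on $\Omega_I$ for each $k=0,\ldots,u_A$. (iv) $f$ is slice regular and there exists a base $\mathcal{B}$ of $A$ as an $\mathbb{R}$-vector space such that the real components $f_\ell^{\mathcal{B}}:\Omega_{\mathcal{B}}\to\mathbb{R}$ of $f$ with respect to $\mathcal{B}$ are real Nash functions for each $\ell=0,\ldots,d_A$. (v) $f$ is slice regular and for each base $\mathcal{B}$ of $A$ as an $\mathbb{R}$-vector space the real components $f_\ell^{\mathcal{B}}:\Omega_{\mathcal{B}}\to\mathbb{R}$ of $f$ with respect to $\mathcal{B}$ are real Nash functions for each $\ell=0,\ldots,d_A$.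
   Context: $\mathbb{H}$ (quaternions) and $\mathbb{O}$ (octonions) carry the standard conjugation $x\mapsto x^c$; $\mathbb{S}_A=\{I\in A: I^2=-1\}$. Put $d_A=3,u_A=1$ if $A=\mathbb{H}$ and $d_A=7,u_A=3$ if $A=\mathbb{O}$. The complex field is $\mathbb{C}=\{\alpha+\iota\beta:\alpha,\beta\in\mathbb{R}\}$ with $\iota\notin\mathbb{S}_A$. For $I\in\mathbb{S}_A$, $\mathbb{C}_I=\mathbb{R}+\mathbb{R}I$, identified with $\mathbb{C}$ via $\phi_I(\alpha+\iota\beta)=\alpha+\beta I$. Circular sets: for $D\subset\mathbb{C}$, $\Omega_D=\{\alpha+\beta I:\alpha+\iota\beta\in D,\ I\in\mathbb{S}_A\}$; $\Omega\subset A$ is circular if $\Omega=\Omega_D$ for some $D$. One always takes $D$ invariant under complex conjugation (then $D$ is determined by $\Omega$). $\Omega_I:=\Omega\cap\mathbb{C}_I$. Stem and slice functions: elements of $A\otimes_{\mathbb{R}}\mathbb{C}$ are written $x+\iota y$ ($x,y\in A$), with $\overline{x+\iota y}=x-\iota y$. A stem function on an open conjugation-invariant $D\subset\mathbb{C}$ is $F=F_1+\iota F_2:D\to A\otimes_{\mathbb{R}}\mathbb{C}$ with $F(\overline z)=\overline{F(z)}$. It induces the slice function $f=\mathcal{I}(F):\Omega_D\to A$, $f(\alpha+\beta I)=F_1(\alpha+\iota\beta)+I\,F_2(\alpha+\iota\beta)$; every slice function comes from a unique stem function. $f$ is slice regular if $F$ is holomorphic, i.e. $C^1$ with $\frac{\partial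 F}{\partial\alpha}+\iota\frac{\partial F}{\partial\beta}=0$. Nash functions: for $k=\mathbb{R}$ or $\mathbb{C}$ and $U\subset k^n$ open, $g:U\to k$ is a $k$-Nash function (real/complex Nash function) on $U$ if every $x_0\in U$ has an open neighbourhood $U'\subset U$ on which $g$ is $k$-analytic and for which there is a non-zero polynomial $P\in k[x_1,\ldots,x_n,t]$ with $P(x,g(x))=0$ for all $x\in U'$. $\mathbb{C}_I$-Nash functions are defined likewise via $\mathbb{C}_I\cong\mathbb{C}$. Splitting bases: left multiplication by $\mathbb{C}_I$ makes $A$ a $\mathbb{C}_I$-vector space. If $\{1,I_1,\ldots,I_{u_A}\}$ is a base of $A$ over $\mathbb{C}_I$, the real base $\{I_0:=1,I,I_1,II_1,\ldots,I_{u_A},II_{u_A}\}$ is called a splitting base of $A$ associated to $I$. Given it, there are unique functions $f_k^{I,I_k}:\Omega_I\to\mathbb{C}_I$ with $f(z)=\sum_{k=0}^{u_A}f_k^{I,I_k}(z)I_k$ for $z\in\Omega_I$. Slice-Nash functions: given $I\in\mathbb{S}_A$, a splitting base $\{I_0:=1,I,I_1,II_1,\ldots,I_{u_A},II_{u_A}\}$ of $A$ associated to $I$ and a stem function $F=F_1+\iota F_2:D\to A\otimes_{\mathbb{R}}\mathbb{C}$, write uniquely $F_s=\sum_{k=0}^{u_A}(F_{s,1}^{I,I_k}+F_{s,2}^{I,I_k}I)I_k$ ($s=1,2$) with real-valued $F_{s,\ell}^{I,I_k}$, and set $F^{\ell}_{I,I_k}=F_{1,\ell}^{I,I_k}+\iota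 F_{2,\ell}^{I,I_k}:D\to\mathbb{C}$ ($\ell=1,2$). The stem function $F$ is a stem-Nash function if there exist $I\in\mathbb{S}_A$ and a splitting base associated to $I$ for which all the $F^{\ell}_{I,I_k}$ are complex Nash functions on $D$. The slice function $f=\mathcal{I}(F)$ is slice-Nash on $\Omega_D$ if it is slice regular and $F$ is stem-Nash on $D$. Real components: for a real base $\mathcal{B}=\{e_0,\ldots,e_{d_A}\}$ of $A$, $\Omega_{\mathcal{B}}=\{(x_0,\ldots,x_{d_A})\in\mathbb{R}^{d_A+1}:\sum x_\ell e_\ell\in\Omega\}$, and $f_\ell^{\mathcal{B}}:\Omega_{\mathcal{B}}\to\mathbb{R}$ are the unique functions with $f(\sum_j x_je_j)=\sum_\ell f_\ell^{\mathcal{B}}(x_0,\ldots,x_{d_A})e_\ell$. *)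

(* Defs.v *)
From HB Require Import structures.
From mathcomp Require Import all_boot all_order all_algebra finmap.
From mathcomp Require Import all_classical all_reals all_analysis.
From mathcomp Require Import summability complex.
From mathcomp Require mpoly.
(* The notations of mpoly clash with those of analysis. *)
Import (canonicals, coercions) mpoly.

Set Implicit Arguments.
Unset Strict Implicit.
Unset Printing Implicit Defensive.

Import Order.TTheory GRing.Theory Num.Theory.
Import numFieldNormedType.Exports.

Local Open Scope classical_set_scope.
Local Open Scope ring_scope.
Local Open Scope complex_scope.

(* Functions with a restricted domain are represented by total functions; every
   predicate below depends only on their values on that domain. *)

Section CayleyDickson.
Variable R : realType.

Fixpoint cd_dim (n : nat) : nat :=
  if n is m.+1 then (cd_dim m + cd_dim m)%N else 1%N.

Fixpoint cd_conj (n : nat) : 'rV[R]_(cd_dim n) -> 'rV[R]_(cd_dim n) :=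
  match n with
  | 0 => fun x => x
  | m.+1 => fun x => row_mx (cd_conj (lsubmx x)) (- rsubmx x)
  end.

(* (a, b) (c, d) = (a c - d^c b, d a + b c^c) *)
Fixpoint cd_mul (n : nat) :
    'rV[R]_(cd_dim n) -> 'rV[R]_(cd_dim n) -> 'rV[R]_(cd_dim n) :=
  match n with
  | 0 => fun x y => x 0 0 *: y
  | m.+1 => fun x y =>
      let a := lsubmx x in let b := rsubmx x in
      let c := lsubmx y in let d := rsubmx y in
      row_mx (cd_mul a c - cd_mul (cd_conj d) b)
             (cd_mul d a + cd_mul b (cd_conj c))
  end.

End CayleyDickson.

Variant hypercomplex := Quaternions | Octonions.

Definition dA (A : hypercomplex) : nat :=
  match A with Quaternions => 3 | Octonions => 7 end.

Definition uA (A : hypercomplex) : nat :=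
  match A with Quaternions => 1 | Octonions => 3 end.

(* R^4 for the quaternions and R^8 for the octonions: the real vector space
   structure and the Euclidean topology are those of row vectors. *)
Notation carrier R A := ('rV[R]_(dA A).+1) (only parsing).

Definition amul (R : realType) (A : hypercomplex) :
    carrier R A -> carrier R A -> carrier R A :=
  match A with
  | Quaternions => @cd_mul R 2
  | Octonions => @cd_mul R 3
  end.

Definition aone (R : realType) (A : hypercomplex) : carrier R A :=
  delta_mx 0 0.

Section Nash.
Variables (K : numFieldType) (n : nat).

(* Sum of the power series at a with coefficients c, as the unconditional sum
   over all multi-indices. *)
Definition power_series_sum (c : {ffun 'I_n -> nat} -> K) (a x : 'rV[K]_n)
    (l : K) : Prop :=
  partial_sum (fun m => c m * \prod_(i < n) (x 0 i - a 0 i) ^+ m i)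
    @ totally --> l.

Definition analytic_on (U : set 'rV[K]_n) (g : 'rV[K]_n -> K) : Prop :=
  forall a, U a -> exists c : {ffun 'I_n -> nat} -> K,
    \forall x \near a, power_series_sum c a x (g x).

(* Meant for K = R and K = R[i]. *)
Definition nash (U : set 'rV[K]_n) (g : 'rV[K]_n -> K) : Prop :=
  forall x0, U x0 -> exists U' : set 'rV[K]_n,
    [/\ open U', U' x0, U' `<=` U, analytic_on U' g &
      exists2 P : mpoly.mpoly (n + 1) K, P != 0 &
        forall x, U' x ->
          mpoly.meval (fun i => row_mx x (g x)%:M 0 i) P = 0].

End Nash.

Definition nash1 (K : numFieldType) (U : set K) (g : K -> K) : Prop :=
  @nash K 1 [set v | U (v 0 0)] (fun v => g (v 0 0)).

Section Slice.
Variables (R : realType) (A : hypercomplex).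

Local Notation AA := (carrier R A).
(* R[i]^o is R[i] seen as a normed space over itself, with its topology. *)
Local Notation C := (R[i]^o).
Local Notation "x ** y" := (amul x y) (at level 40, left associativity).
Local Notation one := (aone R A).

Definition imag_unit : set AA := [set I | I ** I = - one].

Definition phi (I : AA) (z : C) : AA := complex.Re z *: one + complex.Im z *: I.

Definition conj_invariant (D : set C) : Prop :=
  forall z, D z -> D (conjc z).

Definition circularization (D : set C) : set AA :=
  [set x | exists z I, [/\ D z, imag_unit I & x = phi I z]].

Definition circular (Omega : set AA) : Prop :=
  exists2 D, conj_invariant D & Omega = circularization D.

(* The pair (x, y) stands for x + iota y in the complexification of A. *)
Definition conjAC (w : AA * AA) : AA * AA := (w.1, - w.2).
Definition iotaAC (w : AA * AA) : AA * AA := (- w.2, w.1).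

Definition stem_function (D : set C) (F : C -> AA * AA) : Prop :=
  [/\ open D, conj_invariant D &
      forall z, D z -> F (conjc z) = conjAC (F z)].

Definition re_line (F : C -> AA * AA) (z : C) : R -> AA * AA :=
  fun t => F (t +i* complex.Im z).
Definition im_line (F : C -> AA * AA) (z : C) : R -> AA * AA :=
  fun t => F (complex.Re z +i* t).

Definition d_re (F : C -> AA * AA) (z : C) : AA * AA :=
  'D_1 (re_line F z) (complex.Re z).
Definition d_im (F : C -> AA * AA) (z : C) : AA * AA :=
  'D_1 (im_line F z) (complex.Im z).

Definition C1_on (D : set C) (F : C -> AA * AA) : Prop :=
  forall z, D z ->
    [/\ derivable (re_line F z) (complex.Re z) 1,
        derivable (im_line F z) (complex.Im z) 1,
        {for z, continuous (d_re F)} & {for z, continuous (d_im F)}].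

Definition holomorphic_on (D : set C) (F : C -> AA * AA) : Prop :=
  C1_on D F /\ forall z, D z -> d_re F z + iotaAC (d_im F z) = 0.

(* f : Omega -> A is the slice function induced by F : D -> A (x) C. *)
Definition induced_by (Omega : set AA) (f : AA -> AA) (D : set C)
    (F : C -> AA * AA) : Prop :=
  [/\ stem_function D F, Omega = circularization D &
      forall z I, D z -> imag_unit I ->
        f (phi I z) = (F z).1 + I ** (F z).2].

Definition slice_function (Omega : set AA) (f : AA -> AA) : Prop :=
  exists D F, induced_by Omega f D F.

Definition slice_regular (Omega : set AA) (f : AA -> AA) : Prop :=
  exists D F, induced_by Omega f D F /\ holomorphic_on D F.

(* J = (I_0, ..., I_u): base of A over C_I, with C_I acting on the left. *)
Definition CI_comb (I : AA) (J : 'I_(uA A).+1 -> AA)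
    (c : 'rV[R[i]]_(uA A).+1) : AA :=
  \sum_k phi I (c 0 k) ** J k.

Definition CI_base (I : AA) (J : 'I_(uA A).+1 -> AA) : Prop :=
  (forall c, CI_comb I J c = 0 -> c = 0) /\
  (forall x, exists c, x = CI_comb I J c).

(* The splitting base {1, I, I_1, I I_1, ...} is determined by I and J. *)
Definition splitting_base (I : AA) (J : 'I_(uA A).+1 -> AA) : Prop :=
  [/\ imag_unit I, J 0 = one & CI_base I J].

(* Coordinates over C_I, read in C through phi I. *)
Definition CI_coord (I : AA) (J : 'I_(uA A).+1 -> AA) (x : AA) :
    'rV[R[i]]_(uA A).+1 :=
  xget 0 [set c | x = CI_comb I J c].

(* With c_s the k-th coordinate of F_s, the real functions F_{s,1} and F_{s,2}
   attached to I_k are Re c_s and Im c_s. *)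
Definition stem_comp1 (I : AA) (J : 'I_(uA A).+1 -> AA) (F : C -> AA * AA)
    (k : 'I_(uA A).+1) (z : R[i]) : R[i] :=
  complex.Re (CI_coord I J (F z).1 0 k) +i*
  complex.Re (CI_coord I J (F z).2 0 k).
Definition stem_comp2 (I : AA) (J : 'I_(uA A).+1 -> AA) (F : C -> AA * AA)
    (k : 'I_(uA A).+1) (z : R[i]) : R[i] :=
  complex.Im (CI_coord I J (F z).1 0 k) +i*
  complex.Im (CI_coord I J (F z).2 0 k).

Definition stem_nash (D : set C) (F : C -> AA * AA) : Prop :=
  exists I J, splitting_base I J /\
    forall k, @nash1 R[i] D (stem_comp1 I J F k) /\
              @nash1 R[i] D (stem_comp2 I J F k).

Definition slice_nash (Omega : set AA) (f : AA -> AA) : Prop :=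
  exists D F,
    [/\ induced_by Omega f D F, holomorphic_on D F & stem_nash D F].

(* The component f_k : Omega_I -> C_I and its domain, both transported to C
   by phi I. *)
Definition slice_domain (Omega : set AA) (I : AA) : set R[i] :=
  [set z | Omega (phi I z)].
Definition slice_comp (f : AA -> AA) (I : AA) (J : 'I_(uA A).+1 -> AA)
    (k : 'I_(uA A).+1) (z : R[i]) : R[i] :=
  CI_coord I J (f (phi I z)) 0 k.

Definition real_comb (B : (dA A).+1.-tuple AA) (x : 'rV[R]_(dA A).+1) : AA :=
  \sum_j x 0 j *: tnth B j.
Definition real_domain (Omega : set AA) (B : (dA A).+1.-tuple AA) :
    set 'rV[R]_(dA A).+1 :=
  [set x | Omega (real_comb B x)].
Definition real_comp (f : AA -> AA) (B : (dA A).+1.-tuple AA)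
    (l : 'I_(dA A).+1) (x : 'rV[R]_(dA A).+1) : R :=
  coord B l (f (real_comb B x)).

End Slice.

(* Main.v *)
(** A complex Nash germ is handled as a pair: a power series, absolutely summable on
    a polydisc, and a polynomial equation; both notions are closed under sums and
    products (resultants) and can be tested on real points.

    On a slice, f = F_1 + I F_2, and F_1 and F_2 are recovered from the values of f
    at z and at its conjugate, so the components of f and those of the stem function
    are complex combinations of each other; a change of splitting base is also such a
    combination.

    For x in A put z(x) = Re x + i |Im x|. In a real base, f(x) is a combination of the
    functions Re G(z(x)) and (x_i / |Im x|) Im G(z(x)), with G a stem component. They
    are algebraic because |Im x|^2 is a polynomial. They are analytic where Im x <> 0 by
    composition, and at real points because (a + i b)^k = p_k + i b q_k with p_k and q_k
    polynomials in a and b^2, while G has real Taylor coefficients there.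

    Conversely, if the real components are Nash, then each F_1 + i F_2 is, coordinate
    by coordinate, a power series in the two real variables of z, and the
    Cauchy-Riemann equation turns it into a power series in z. Restricting the
    polynomial equations to a horizontal line gives an equation P(z, G(z)) = 0 on a
    real segment, hence near z by the identity theorem. *)

Require Import Defs.
From HB Require Import structures.
From mathcomp Require Import all_boot all_order all_algebra finmap.
From mathcomp Require Import all_classical all_reals all_analysis.
From mathcomp Require Import summability complex.
From mathcomp Require Import ring lra.
From mathcomp Require polyXY mpoly.
Import (canonicals, coercions) mpoly.

Set Implicit Arguments.
Unset Strict Implicit.
Unset Printing Implicit Defensive.

Import Order.TTheory GRing.Theory Num.Theory.
Import numFieldNormedType.Exports.
Import ComplexField.Normc.

Local Open Scope fset_scope.
Local Open Scope classical_set_scope.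
Local Open Scope complex_scope.
Local Open Scope ring_scope.

(** Convergence is unconditional throughout, and each power series carries a bound for its weighted
    l1-norm on a polydisc. This norm is submultiplicative, so products, compositions and regroupings
    all reduce to summation over the fibres of a map between index sets. Germs at real points are
    kept as complex-valued functions of real variables: complex combinations then make sense, and
    the same polynomial lemmas serve both fields. An algebraic equation is demanded pointwise, so a
    non-zero polynomial may well vanish identically on a smaller set. This is harmless for sums and
    products, because a resultant lies in the ideal of its two polynomials, but it is the obstacle
    when a function is restricted to a line. For a general imaginary unit the product of octonions
    is used only through bilinearity, the unit and I (I y) = - y, which left alternativity
    provides. *)

Local Notation mpolyvar K i := (@mpoly.mpolyX _ K (mpoly.mnm1 i)).

(** * Unconditional sums *)

Section Normc.
Variable R : realType.
Implicit Types z w : R[i].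

Lemma normc_ge0 z : 0 <= normc z.
Proof. by case: z => a b; exact: sqrtr_ge0. Qed.

Lemma normC_normc z : `|z| = (normc z)%:C.
Proof. by rewrite normc_def; case: z. Qed.

Lemma ler_normcD z w : normc (z + w) <= normc z + normc w.
Proof. exact: (@le_normcD R). Qed.

Lemma normcN' z : normc (- z) = normc z.
Proof. exact: (@normcN R). Qed.

Lemma normc_real (x : R) : normc x%:C = `|x|.
Proof. by rewrite /normc /= expr0n addr0 sqrtr_sqr. Qed.

Lemma normc_conj z : normc (conjc z) = normc z.
Proof. by case: z => a b; rewrite /normc /= sqrrN. Qed.

Lemma normcX z n : normc (z ^+ n) = normc z ^+ n.
Proof.
by elim: n => [|n IH]; rewrite ?expr0 ?normc1 // !exprS normcM IH.
Qed.

Lemma ler_normc_sum (I : Type) (r : seq I) (P : pred I) (F : I -> R[i]) :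
  normc (\sum_(i <- r | P i) F i) <= \sum_(i <- r | P i) normc (F i).
Proof.
elim/big_ind2 : _ => [|x1 x2 y1 y2 h1 h2|//]; first by rewrite normc0.
by apply: (le_trans (ler_normcD _ _)); exact: lerD.
Qed.

Lemma normc_prod (I : Type) (r : seq I) (P : pred I) (F : I -> R[i]) :
  normc (\prod_(i <- r | P i) F i) = \prod_(i <- r | P i) normc (F i).
Proof.
elim/big_rec2 : _ => [|i x y _ h]; first by rewrite normc1.
by rewrite normcM h.
Qed.

Lemma Re_le_normc z : `|complex.Re z| <= normc z.
Proof. by have := normc_ge_Re z; rewrite normC_normc lecR. Qed.

Lemma Im_le_normc z : `|complex.Im z| <= normc z.
Proof.
have := Re_le_normc ('i%C * z); rewrite normcM.
have -> : normc ('i%C : R[i]) = 1.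
  by rewrite /normc /= expr0n add0r expr1n sqrtr1.
by rewrite mul1r; case: z => a b /=; rewrite mul0r mul1r sub0r normrN.
Qed.

Lemma normc_le_ReIm z : normc z <= `|complex.Re z| + `|complex.Im z|.
Proof.
case: z => a b /=.
have h : 0 <= `|a| + `|b| by rewrite addr_ge0.
rewrite -(ger0_norm h) -sqrtr_sqr ler_wsqrtr // sqrrD !real_normK ?num_real //.
by rewrite lerD2r lerDl mulrn_wge0 // mulr_ge0.
Qed.

Lemma normc0_eq0 z : (forall e : R, 0 < e -> normc z <= e) -> z = 0.
Proof.
move=> h; apply: eq0_normc; apply/eqP; rewrite eq_le normc_ge0 andbT.
by apply/ler_addgt0Pl => e e0; rewrite addr0; exact: h.
Qed.

End Normc.

Section Unconditional.
Local Open Scope fset_scope.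
Local Open Scope ring_scope.
Variable R : realType.
Local Notation C := (R[i]).

(** Convergence along the net of finite subsets, with a real epsilon so that one predicate serves
    real and complex series; [partial_sum_cvgC] and [partial_sum_cvgR] identify it with the limit
    along [totally]. *)
Definition has_sum (I : choiceType) (f : I -> C) (l : C) : Prop :=
  forall e : R, 0 < e -> exists S0 : {fset I}, forall S : {fset I},
    S0 `<=` S -> normc (\sum_(i <- S) f i - l) <= e.

(** Absolute summability with an explicit bound, which products and compositions transform by simple
    formulas. *)
Definition sum_bounded (I : choiceType) (f : I -> C) (B : R) : Prop :=
  forall S : {fset I}, \sum_(i <- S) normc (f i) <= B.

Section Basic.
Variable I : choiceType.
Implicit Types (f g : I -> C) (S T : {fset I}).

Lemma has_sum_unique f l l' : has_sum f l -> has_sum f l' -> l = l'.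
Proof.
move=> h h'; apply/eqP; rewrite -subr_eq0; apply/eqP/normc0_eq0 => e e0.
have e2 : 0 < e / 2 by rewrite divr_gt0.
have [S hS] := h _ e2; have [S' hS'] := h' _ e2.
have := hS _ (fsubsetUl S S'); have := hS' _ (fsubsetUr S S').
set s := \sum_(i <- _) _ => h1 h2.
have -> : l - l' = (s - l') - (s - l) by ring.
rewrite (le_trans (ler_normcD _ _)) // normcN'.
by rewrite (le_trans (lerD h1 h2)) // -splitr.
Qed.

Lemma eq_has_sum f g l : f =1 g -> has_sum f l -> has_sum g l.
Proof. by move=> /funext ->. Qed.

Lemma has_sumD f g l l' :
  has_sum f l -> has_sum g l' -> has_sum (fun i => f i + g i) (l + l').
Proof.
move=> h h' e e0; have e2 : 0 < e / 2 by rewrite divr_gt0.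
have [S hS] := h _ e2; have [S' hS'] := h' _ e2.
exists (S `|` S') => T; rewrite fsubUset => /andP[hT hT'].
rewrite big_split /=.
have -> : \sum_(i <- T) f i + \sum_(i <- T) g i - (l + l') =
  (\sum_(i <- T) f i - l) + (\sum_(i <- T) g i - l') by ring.
rewrite (le_trans (ler_normcD _ _)) //.
by rewrite (le_trans (lerD (hS _ hT) (hS' _ hT'))) // -splitr.
Qed.

Lemma has_sumZ f l c : has_sum f l -> has_sum (fun i => c * f i) (c * l).
Proof.
move=> h e e0; have c1 : 0 < normc c + 1 by rewrite ltr_wpDl ?normc_ge0.
have [|S hS] := h (e / (normc c + 1)); first by rewrite divr_gt0.
exists S => T /hS hT; rewrite -mulr_sumr -mulrBr normcM.
have := ler_pM (normc_ge0 _) (normc_ge0 _) (lexx (normc c)) hT.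
move/le_trans; apply; rewrite mulrCA -[leRHS]mulr1 ler_pM2l //.
by rewrite ler_pdivrMr // mul1r lerDl.
Qed.

Lemma has_sumN f l : has_sum f l -> has_sum (fun i => - f i) (- l).
Proof.
by move=> /(has_sumZ (-1)); rewrite mulN1r; apply: eq_has_sum => i; rewrite mulN1r.
Qed.

Lemma has_sumB f g l l' :
  has_sum f l -> has_sum g l' -> has_sum (fun i => f i - g i) (l - l').
Proof. by move=> h /has_sumN; exact: has_sumD. Qed.

Lemma has_sum_conj f l :
  has_sum f l -> has_sum (fun i => conjc (f i)) (conjc l).
Proof.
move=> h e e0; have [S hS] := h _ e0; exists S => T /hS.
by rewrite -rmorph_sum -rmorphB normc_conj.
Qed.

Lemma has_sum_finite f S :
  (forall i, i \notin S -> f i = 0) -> has_sum f (\sum_(i <- S) f i).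
Proof.
move=> h e e0; exists S => T hT; rewrite -(big_fset_incl _ hT).
  by rewrite subrr normc0 ltW.
by move=> i _ /h.
Qed.

Lemma has_sum0 : has_sum (fun _ : I => 0) 0.
Proof. by move=> e e0; exists fset0 => S _; rewrite big1 // subr0 normc0 ltW. Qed.

Lemma has_sum_bigsum (J : Type) (r : seq J) (F : J -> I -> C) (l : J -> C) :
  (forall j, has_sum (F j) (l j)) ->
  has_sum (fun i => \sum_(j <- r) F j i) (\sum_(j <- r) l j).
Proof.
move=> h; elim: r => [|j r IH].
  by rewrite big_nil; apply: eq_has_sum has_sum0 => i; rewrite big_nil.
rewrite big_cons; apply: eq_has_sum (has_sumD (h j) IH) => i.
by rewrite big_cons.
Qed.

Lemma has_sum_le f l B : sum_bounded f B -> has_sum f l -> normc l <= B.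
Proof.
move=> hB h; apply/ler_addgt0Pl => e e0; have [S hS] := h _ e0.
have -> : l = \sum_(i <- S) f i - (\sum_(i <- S) f i - l) by ring.
rewrite (le_trans (ler_normcD _ _)) // normcN' addrC lerD ?hS //.
by rewrite (le_trans (ler_normc_sum _ _ _)).
Qed.

Lemma sum_bounded_ge0 f B : sum_bounded f B -> 0 <= B.
Proof. by move=> /(_ fset0); rewrite big_seq_fset0. Qed.

Lemma sum_bounded_le f B B' : B <= B' -> sum_bounded f B -> sum_bounded f B'.
Proof. by move=> h hB S; exact: le_trans (hB S) h. Qed.

Lemma sum_bounded_dom f g B : (forall i, normc (f i) <= normc (g i)) ->
  sum_bounded g B -> sum_bounded f B.
Proof. by move=> h hB S; apply: le_trans (hB S); exact: ler_sum. Qed.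

Lemma sum_boundedZ f B c :
  sum_bounded f B -> sum_bounded (fun i => c * f i) (normc c * B).
Proof.
move=> h S; under eq_bigr do rewrite normcM.
by rewrite -mulr_sumr ler_wpM2l ?normc_ge0.
Qed.

Lemma sum_boundedD f g B B' : sum_bounded f B -> sum_bounded g B' ->
  sum_bounded (fun i => f i + g i) (B + B').
Proof.
move=> h h' S; apply: le_trans (lerD (h S) (h' S)); rewrite -big_split /=.
by apply: ler_sum => i _; exact: ler_normcD.
Qed.

Lemma big_fset_subset (V : nmodType) (F : I -> V) S T : S `<=` T ->
  \sum_(i <- T) F i = \sum_(i <- S) F i + \sum_(i <- T `\` S) F i.
Proof.
move=> /fsubsetP ST; rewrite (big_fsetID _ (mem S) T) /=; congr (_ + _).
  apply: eq_fbigl => x; rewrite !inE /=; apply/andP/idP => [[]//|xS].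
  by split=> //; exact: ST.
by apply: eq_fbigl => x; rewrite !inE /= andbC.
Qed.

Lemma fsetDUl_disj S T : [disjoint S & T]%fset -> (S `|` T) `\` S = T.
Proof.
move=> ST; apply/fsetP => x; rewrite !inE; have := fdisjointP ST x.
by case: (x \in S) => //= h; apply/esym/negbTE/h.
Qed.

Lemma ler_fset_sum (a : I -> R) S T : (forall i, 0 <= a i) -> S `<=` T ->
  \sum_(i <- S) a i <= \sum_(i <- T) a i.
Proof. by move=> a0 /big_fset_subset ->; rewrite lerDl sumr_ge0. Qed.

(** The sum is the supremum of the finite partial sums. *)
Lemma ge0_has_sum (a : I -> R) B : (forall i, 0 <= a i) ->
  (forall S, \sum_(i <- S) a i <= B) ->
  exists2 l : R, has_sum (fun i => (a i)%:C) l%:C & l <= B.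
Proof.
move=> a0 aB; pose E : set R := [set x | exists S, x = \sum_(i <- S) a i]%classic.
have E0 : (E !=set0)%classic by exists (\sum_(i <- fset0) a i); exists fset0.
have EB : ubound E B by move=> _ [S ->].
have hE : has_sup E by split => //; exists B.
exists (sup E); last exact: ge_sup.
move=> e e0; have [_ [S ->] hS] := sup_adherent e0 hE.
exists S => T ST; rewrite -rmorph_sum -rmorphB normc_real.
rewrite distrC ger0_norm; last first.
  by rewrite subr_ge0; apply: (ub_le_sup hE.2); exists T.
rewrite lerBlDr -lerBlDl (le_trans (ltW hS)) //.
exact: ler_fset_sum.
Qed.

Lemma sum_bounded_has_sum f B : sum_bounded f B -> exists l, has_sum f l.
Proof.
move=> hB.
(* A real family dominated by [normc] is the difference of the non-negative families [|p| + p] and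
   [|p|]; this is applied to real and imaginary parts. *)
have key (p : C -> R) : (forall z, `|p z| <= normc z) ->
  exists l, has_sum (fun i => (p (f i))%:C) l.
  move=> hp.
  have [l1 h1 _] : exists2 l : R, has_sum (fun i => `|p (f i)|%:C) l%:C & l <= B.
    apply: ge0_has_sum => // S; apply: le_trans (hB S).
    by apply: ler_sum => i _; exact: hp.
  have [l2 h2 _] : exists2 l : R,
      has_sum (fun i => (`|p (f i)| + p (f i))%:C) l%:C & l <= B + B.
    apply: ge0_has_sum => [i|S].
      by have := ler_norm (- p (f i)); rewrite normrN; lra.
    apply: le_trans (lerD (hB S) (hB S)); rewrite -big_split /=.
    apply: ler_sum => i _; apply: lerD; first exact: hp.
    exact: le_trans (ler_norm _) (hp _).
  exists (l2%:C - l1%:C); apply: eq_has_sum (has_sumB h2 h1) => i.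
  by rewrite rmorphD /= addrAC subrr add0r.
have [l1 h1] := key _ (@Re_le_normc R).
have [l2 h2] := key _ (@Im_le_normc R).
exists (l1 + 'i%C * l2); apply: eq_has_sum (has_sumD h1 (has_sumZ _ h2)) => i.
by rewrite -complexE.
Qed.

Lemma sum_bounded_norm f B : sum_bounded f B ->
  exists2 l : R, has_sum (fun i => (normc (f i))%:C) l%:C & l <= B.
Proof. by move=> hB; apply: ge0_has_sum => // i; exact: normc_ge0. Qed.

Lemma sum_bounded_tail f B e : 0 < e -> sum_bounded f B ->
  exists S0 : {fset I}, forall T, [disjoint S0 & T]%fset ->
    \sum_(i <- T) normc (f i) <= e.
Proof.
move=> e0 /sum_bounded_norm [l hl _]; have [|S hS] := hl (e / 2).
  by rewrite divr_gt0.
exists S => T ST.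
have -> : \sum_(i <- T) normc (f i) =
  (\sum_(i <- S `|` T) normc (f i) - l) - (\sum_(i <- S) normc (f i) - l).
  by rewrite (big_fset_subset _ (fsubsetUl S T)) fsetDUl_disj //; ring.
have h1 := hS _ (fsubsetUl S T); have h2 := hS _ (fsubset_refl S).
move: h1 h2; rewrite -!rmorph_sum -!rmorphB !normc_real => h1 h2.
by rewrite (le_trans (ler_norm _)) // (le_trans (ler_normB _ _)) // (splitr e) lerD.
Qed.

(** Unconditional convergence is absolute in finite dimension. Finite sums outside [S0] have modulus
    at most 2, being differences of two partial sums within 1 of [l]; separating the terms by the
    sign of their real part gives the bound 4, and likewise for the imaginary part. *)
Lemma has_sum_sum_bounded f l : has_sum f l -> exists B, sum_bounded f B.
Proof.
move=> /(_ 1 ltr01) [S0 h0].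
have tail T : [disjoint S0 & T]%fset -> normc (\sum_(i <- T) f i) <= 2.
  move=> ST; have h1 := h0 _ (fsubsetUl S0 T); have h2 := h0 _ (fsubset_refl S0).
  have -> : \sum_(i <- T) f i =
    (\sum_(i <- S0 `|` T) f i - l) - (\sum_(i <- S0) f i - l).
    by rewrite (big_fset_subset _ (fsubsetUl S0 T)) fsetDUl_disj //; ring.
  by rewrite (le_trans (ler_normcD _ _)) // normcN' -[2](@natrD _ 1 1) lerD.
have part (p : {additive C -> R}) : (forall z, `|p z| <= normc z) ->
   forall T, [disjoint S0 & T]%fset -> \sum_(i <- T) `|p (f i)| <= 4.
  move=> hp T ST; rewrite (big_fsetID _ (fun i => 0 <= p (f i)) T) /=.
  have hsub (Q : pred I) : [disjoint S0 & [fset x | x in T & Q x]].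
    apply/fdisjointP => x /(fdisjointP ST); apply: contraNN.
    by rewrite !inE => /andP[].
  have half U : [disjoint S0 & U] -> `|\sum_(i <- U) p (f i)| <= 2.
    move=> hU; rewrite -raddf_sum; apply: le_trans (hp _) (tail _ hU).
  have -> : 4 = 2 + 2 :> R by ring.
  apply: lerD.
    apply: le_trans (half _ (hsub (fun i => 0 <= p (f i)))).
    rewrite ger0_norm; last first.
      by rewrite big_seq sumr_ge0 // => i; rewrite !inE => /andP[].
    rewrite big_seq [leRHS]big_seq; apply: ler_sum => i; rewrite !inE => /andP[_ h].
    by rewrite ger0_norm.
  apply: le_trans (half _ (hsub (fun i => ~~ (0 <= p (f i))))).
  rewrite ler0_norm; last first.
    rewrite big_seq sumr_le0 // => i; rewrite !inE -ltNge => /andP[_]; exact: ltW.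
  rewrite -sumrN big_seq [leRHS]big_seq; apply: ler_sum => i.
  by rewrite !inE -ltNge => /andP[_ h]; rewrite ltr0_norm.
exists (\sum_(i <- S0) normc (f i) + (4 + 4)) => S.
rewrite (big_fset_subset _ (fsubsetIl S S0)) lerD //.
  by apply: ler_fset_sum => [i|]; [exact: normc_ge0 | exact: fsubsetIr].
have hd : [disjoint S0 & S `\` (S `&` S0)].
  apply/fdisjointP => x xS; rewrite !inE xS andbT.
  by case: (x \in S).
have hR := part (@complex.Re R) (@Re_le_normc R) _ hd.
have hI := part (@complex.Im R) (@Im_le_normc R) _ hd.
apply: le_trans (lerD hR hI); rewrite -big_split /=.
by apply: ler_sum => i _; exact: normc_le_ReIm.
Qed.

End Basic.

(** The preimage is listed by [pmap] along a partial inverse of [h] obtained by choice. *)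
Lemma fset_preimage (I K : choiceType) (h : I -> K) (T : {fset K}) :
  injective h -> exists U : {fset I}, forall i, (i \in U) = (h i \in T).
Proof.
move=> hinj; pose q k := if pselect (exists i, k = h i) is left ex
  then Some (projT1 (cid ex)) else None.
exists [fset x in pmap q T] => i; rewrite !inE mem_pmap; apply/mapP/idP.
  move=> [k kT]; rewrite /q; case: pselect => // ex [->].
  by case: cid => j /= <-.
move=> iT; exists (h i) => //; rewrite /q; case: pselect => [ex|]; last by case; exists i.
by case: cid => j /= /hinj ->.
Qed.

Lemma has_sum_reindex (I K : choiceType) (h : I -> K) (f : K -> C) l :
  injective h -> (forall k, (forall i, k <> h i) -> f k = 0) ->
  has_sum (fun i => f (h i)) l <-> has_sum f l.
Proof.
move=> hinj h0.
have key (U : {fset I}) (T : {fset K}) : (forall i, i \in U -> h i \in T) ->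
    (forall i, h i \in T -> i \in U) ->
    \sum_(i <- U) f (h i) = \sum_(k <- T) f k.
  move=> hUT hTU; transitivity (\sum_(k <- h @` U) f k).
    by rewrite big_imfset //= => ? ? _ _ /hinj.
  apply: big_fset_incl.
    by apply/fsubsetP => k /imfsetP [i /= /hUT iT ->].
  move=> k kT knot; apply: h0 => i ki; move: knot; rewrite ki in_imfset //=.
  by apply: hTU; rewrite -ki.
split=> H e e0; have [S hS] := H _ e0.
  exists (h @` S) => T hT; have [U hU] := fset_preimage T hinj.
  rewrite -(key U) ?hS // => [|i|i]; rewrite ?hU //.
  by apply/fsubsetP => i iS; rewrite hU (fsubsetP hT) ?in_imfset.
have [U hU] := fset_preimage S hinj; exists U => T hT.
rewrite (key _ (S `|` h @` T)) ?hS ?fsubsetUl // => i.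
  by move=> iT; rewrite inE in_imfset // orbT.
rewrite inE => /orP[|/imfsetP [j /= jT /hinj -> //]].
by rewrite -hU => /(fsubsetP hT).
Qed.

(** * Summation over the fibres of a map between index sets *)

Section Fubini.
Variables (J K : choiceType) (p : K -> J) (f : K -> C) (g : J -> C).
Hypothesis hg : forall j, has_sum (fun k => if p k == j then f k else 0) (g j).

(** Choose a finite [S] whose sum approximates [l] and outside of which the total mass is at most
    e/2. If [T] contains the image of [S], the fibre sums over [T] and the sum over [S] differ only
    by terms of [f] outside [S]. *)
Lemma has_sum_fibers B l : sum_bounded f B -> has_sum f l -> has_sum g l.
Proof.
move=> hB hl e e0; have e2 : 0 < e / 2 by rewrite divr_gt0.
have [S0 h0] := sum_bounded_tail e2 hB; have [S1 h1] := hl _ e2.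
have [S [S0S /h1 hS]] : exists S : {fset K}, S0 `<=` S /\ S1 `<=` S.
  by exists (S0 `|` S1); rewrite fsubsetUl fsubsetUr.
exists (p @` S) => T hT.
have -> : \sum_(j <- T) g j - l = (\sum_(j <- T) g j - \sum_(k <- S) f k)
  + (\sum_(k <- S) f k - l) by ring.
rewrite (le_trans (ler_normcD _ _)) // [leRHS]splitr lerD //.
pose fT k := if p k \in T then f k else 0.
have hfT : has_sum fT (\sum_(j <- T) g j).
  apply: eq_has_sum (has_sum_bigsum (enum_fset T) hg) => k; rewrite /fT.
  case: ifPn => kT.
    rewrite (big_fsetD1 (p k)) //= eqxx big_seq big1 ?addr0 // => j.
    by rewrite !inE => /andP[/negbTE]; rewrite eq_sym => ->.
  rewrite big_seq big1 // => j jT; case: eqP => // pk.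
  by move: kT; rewrite pk jT.
pose fS k := if k \in S then f k else 0.
have hfS : has_sum fS (\sum_(k <- S) f k).
  have -> : \sum_(k <- S) f k = \sum_(k <- S) fS k.
    by rewrite big_seq [RHS]big_seq; apply: eq_bigr => k kS; rewrite /fS kS.
  by apply: has_sum_finite => k /negbTE kS; rewrite /fS kS.
apply: has_sum_le (has_sumB hfT hfS) => U.
rewrite (big_fsetID _ (mem S) U) /= big_seq big1 ?add0r; last first.
  move=> k; rewrite !inE /= => /andP[_ kS]; rewrite /fT /fS kS.
  by rewrite (fsubsetP hT) ?subrr ?normc0 // in_imfset.
apply: le_trans (h0 [fset x | x in U & x \notin S] _); last first.
  apply/fdisjointP => k kS0; rewrite !inE negb_and; apply/orP; right.
  by rewrite (fsubsetP S0S).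
rewrite big_seq [leRHS]big_seq; apply: ler_sum => k; rewrite !inE => /andP[_].
move=> kS; rewrite /fT /fS (negbTE kS) subr0; case: ifP => // _.
by rewrite normc0 normc_ge0.
Qed.

(** The fibre sums [G] of the norms dominate [g], and a finite sum of values of [G] is the sum of
    the norms over finitely many disjoint fibres. *)
Lemma sum_bounded_fibers B : sum_bounded f B -> sum_bounded g B.
Proof.
move=> hB.
have hn j : exists2 l : R,
    has_sum (fun k => (normc (if p k == j then f k else 0))%:C) l%:C & l <= B.
  apply: sum_bounded_norm; apply: sum_bounded_dom hB => k.
  by case: ifP => // _; rewrite normc0 normc_ge0.
pose G j := s2val (cid2 (hn j)).
have hG j : has_sum (fun k => if p k == j then (normc (f k))%:C else 0) (G j)%:C.
  apply: eq_has_sum (s2valP (cid2 (hn j))) => k; case: ifP => //.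
  by rewrite normc0.
have gG j : normc (g j) <= G j.
  apply: has_sum_le (hg j) => S.
  apply/ler_addgt0Pl => e e0; have [S' hS'] := s2valP (cid2 (hn j)) _ e0.
  have := hS' _ (fsubsetUl S' S); rewrite -/(G j) -rmorph_sum -rmorphB normc_real.
  rewrite ler_norml => /andP[_]; rewrite lerBlDr; apply: le_trans.
  by apply: ler_fset_sum; [move=> i; exact: normc_ge0|exact: fsubsetUr].
move=> S; apply: (@le_trans _ _ (\sum_(j <- S) G j)); first exact: ler_sum.
have hfin : has_sum (fun k => if p k \in S then (normc (f k))%:C else 0)
   (\sum_(j <- S) (G j)%:C).
  apply: eq_has_sum (has_sum_bigsum (enum_fset S) hG) => k.
  case: ifPn => kT.
    rewrite (big_fsetD1 (p k)) //= eqxx big_seq big1 ?addr0 // => j.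
    by rewrite !inE => /andP[/negbTE]; rewrite eq_sym => ->.
  rewrite big_seq big1 // => j jT; case: eqP => // pk.
  by move: kT; rewrite pk jT.
have h0 : 0 <= \sum_(j <- S) G j.
  by apply: sumr_ge0 => j _; exact: le_trans (normc_ge0 _) (gG j).
rewrite -[leLHS]ger0_norm // -normc_real rmorph_sum; apply: has_sum_le hfin.
apply: sum_bounded_dom hB => k; case: ifP => _; last by rewrite normc0 normc_ge0.
by rewrite normc_real ger0_norm ?normc_ge0.
Qed.

End Fubini.

Section Product.
Variables (I J : choiceType) (f : I -> C) (g : J -> C) (A B : R).
Hypotheses (hf : sum_bounded f A) (hg : sum_bounded g B).

(** A finite set of pairs lies in the product of its two projections. *)
Lemma sum_bounded_prod : sum_bounded (fun k : I * J => f k.1 * g k.2) (A * B).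
Proof.
move=> S; have h0 (k : I * J) : 0 <= normc (f k.1 * g k.2) by exact: normc_ge0.
pose T := [fset k.1 | k in S] ; pose U := [fset k.2 | k in S].
apply: le_trans (ler_pM (sumr_ge0 _ _) (sumr_ge0 _ _) (hf T) (hg U)) => //; last first.
- by move=> i _; exact: normc_ge0.
- by move=> i _; exact: normc_ge0.
rewrite mulr_suml; under [leRHS]eq_bigr do rewrite mulr_sumr.
have -> : \sum_(i <- T) \sum_(j <- U) normc (f i) * normc (g j) =
   \sum_(k <- T `*` U) normc (f k.1 * g k.2).
  rewrite /fsetM big_imfset2 /=; last by move=> [x y] [x' y'] _ _ /= [-> ->].
  by apply: eq_bigr => i _; apply: eq_bigr => j _; rewrite normcM.
apply: ler_fset_sum => //; apply/fsubsetP => k kS.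
by rewrite in_fsetM; apply/andP; split; apply/imfsetP; exists k.
Qed.

(** The double series is summed over the fibres of the first projection, each of which contributes
    [f i * m]; uniqueness of sums concludes. *)
Lemma has_sum_prod l m : has_sum f l -> has_sum g m ->
  has_sum (fun k : I * J => f k.1 * g k.2) (l * m).
Proof.
move=> hl hm; have [s hs] := sum_bounded_has_sum sum_bounded_prod.
suff -> : l * m = s by [].
have hfib i : has_sum (fun k : I * J => if k.1 == i then f k.1 * g k.2 else 0)
   (f i * m).
  apply/(@has_sum_reindex J _ (fun j => (i, j))); first by move=> x y [].
    by move=> [x y] h; case: eqP => //= xi; case: (h y); rewrite xi.
  by apply: eq_has_sum (has_sumZ (f i) hm) => j /=; rewrite eqxx.
have := has_sum_fibers hfib sum_bounded_prod hs.
apply: has_sum_unique; rewrite mulrC.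
by apply: eq_has_sum (has_sumZ m hl) => i; rewrite mulrC.
Qed.

End Product.

End Unconditional.

(** * Power series in several variables *)

Section PowerSeries.
Local Open Scope fset_scope.
Local Open Scope ring_scope.
Variable R : realType.
Local Notation C := (R[i]).

Section Monomials.
Variable n : nat.
Implicit Types (y : 'I_n -> C) (m : {ffun 'I_n -> nat}).

Definition mono y m : C := \prod_i y i ^+ m i.

Definition mdegree m : nat := (\sum_i m i)%N.

Definition madd m m' : {ffun 'I_n -> nat} := [ffun i => (m i + m' i)%N].

Lemma mono_add y m m' : mono y (madd m m') = mono y m * mono y m'.
Proof.
by rewrite -big_split /=; apply: eq_bigr => i _; rewrite ffunE exprD.
Qed.

Lemma mdegree_add m m' : mdegree (madd m m') = (mdegree m + mdegree m')%N.
Proof. by rewrite -big_split /=; apply: eq_bigr => i _; rewrite ffunE. Qed.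

Lemma normc_mono_le y m (r : R) : (forall i, normc (y i) <= r) ->
  normc (mono y m) <= r ^+ mdegree m.
Proof.
move=> h; rewrite normc_prod /mdegree -prodrXr; apply: ler_prod => i _.
by rewrite normcX exprn_ge0 ?normc_ge0 //= lerXn2r ?nnegrE ?normc_ge0 // (le_trans (normc_ge0 _) (h i)).
Qed.

Lemma mono_conj y m : conjc (mono y m) = mono (fun i => conjc (y i)) m.
Proof. by rewrite rmorph_prod; apply: eq_bigr => i _; rewrite rmorphXn. Qed.

Definition mvar (i : 'I_n) : {ffun 'I_n -> nat} := [ffun j => (j == i : nat)].

Lemma mono_var y i : mono y (mvar i) = y i.
Proof.
rewrite /mono (bigD1 i) //= ffunE eqxx expr1 big1 ?mulr1 // => j /negbTE ji.
by rewrite ffunE ji expr0.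
Qed.

Lemma mdegree_var i : mdegree (mvar i) = 1%N.
Proof.
rewrite /mdegree (bigD1 i) //= ffunE eqxx big1 ?addn0 // => j /negbTE ji.
by rewrite ffunE ji.
Qed.

Lemma mono_0 y : mono y [ffun => 0%N] = 1.
Proof. by rewrite /mono big1 // => i _; rewrite ffunE expr0. Qed.

Lemma mdegree_0 : mdegree [ffun => 0%N] = 0%N.
Proof. by rewrite /mdegree big1 // => i _; rewrite ffunE. Qed.

Lemma mdegree_eq0 m : mdegree m = 0%N -> m = [ffun => 0%N].
Proof.
move=> /eqP; rewrite /mdegree sum_nat_eq0 => /forallP h.
by apply/ffunP => i; rewrite ffunE; exact/eqP/(h i).
Qed.

Definition polydisc (r : R) y := forall i, normc (y i) <= r.

(** [B] bounds the l1-norm of the coefficients with weights [r ^+ mdegree m]. This norm is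
    submultiplicative and dominates the supremum on the polydisc of radius [r]; outside the polydisc
    [g] is unconstrained. *)
Definition ps_coef (c : {ffun 'I_n -> nat} -> C) (r B : R) (g : ('I_n -> C) -> C) : Prop :=
  sum_bounded (fun m => c m * (r ^+ mdegree m)%:C) B /\
  forall y, polydisc r y -> has_sum (fun m => c m * mono y m) (g y).

Definition ps (r B : R) (g : ('I_n -> C) -> C) : Prop := exists c, ps_coef c r B g.

Lemma sum_bounded_mono (L : choiceType) (a : L -> C) (p : L -> {ffun 'I_n -> nat}) r B y :
  sum_bounded (fun l => a l * (r ^+ mdegree (p l))%:C) B -> polydisc r y ->
  sum_bounded (fun l => a l * mono y (p l)) B.
Proof.
move=> h hy; apply: sum_bounded_dom h => l; rewrite !normcM ler_wpM2l ?normc_ge0 //.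
apply: le_trans (normc_mono_le _ hy) _; rewrite normc_real; exact: ler_norm.
Qed.

Lemma ps_norm r B g y : ps r B g -> polydisc r y -> normc (g y) <= B.
Proof.
move=> [c [hB hg]] hy; apply: has_sum_le (hg y hy).
exact: (sum_bounded_mono (p := id)).
Qed.

Lemma ps_ge0 r B g : ps r B g -> 0 <= B.
Proof. by move=> [c [/sum_bounded_ge0]]. Qed.

Lemma ps_le r B B' g : B <= B' -> ps r B g -> ps r B' g.
Proof. by move=> h [c [hB hg]]; exists c; split=> //; exact: sum_bounded_le hB. Qed.

Lemma eq_ps r B g g' : (forall y, polydisc r y -> g y = g' y) ->
  ps r B g -> ps r B g'.
Proof. by move=> h [c [hB hg]]; exists c; split=> // y hy; rewrite -h //; exact: hg. Qed.

(* A series of scaled monomials indexed by any set is a power series: collect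
   the terms with the same exponent. *)
Lemma ps_generalized (L : choiceType) (a : L -> C)
    (p : L -> {ffun 'I_n -> nat}) r B g :
  0 < r -> sum_bounded (fun l => a l * (r ^+ mdegree (p l))%:C) B ->
  (forall y, polydisc r y -> has_sum (fun l => a l * mono y (p l)) (g y)) ->
  ps r B g.
Proof.
move=> r0 hB hg.
have hc m : exists c, has_sum (fun l => if p l == m then a l else 0) c.
  (* On the fibre over [m] the weight is a non-zero constant, so that dividing by it bounds the bare
     coefficients. *)
  apply: (@sum_bounded_has_sum _ _ _ (normc ((r ^+ mdegree m)%:C)^-1 * B)).
  apply: sum_bounded_dom (sum_boundedZ ((r ^+ mdegree m)%:C)^-1 hB) => l.
  case: eqP => [<-|_]; last by rewrite normc0 normc_ge0.
  rewrite mulrC mulfK // fmorph_eq0 expf_neq0 //; exact: lt0r_neq0.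
have [c {}hc] := choice hc; exists c; split.
  apply: (@sum_bounded_fibers _ _ _ p _ _ _ _ hB).
  move=> m; rewrite mulrC; apply: eq_has_sum (has_sumZ _ (hc m)) => l.
  by case: eqP => [->|_]; rewrite ?mulr0 // mulrC.
move=> y hy; apply: (has_sum_fibers (p := p)) (sum_bounded_mono hB hy) (hg y hy) => m.
rewrite mulrC; apply: eq_has_sum (has_sumZ _ (hc m)) => l.
by case: eqP => [->|_]; rewrite ?mulr0 // mulrC.
Qed.

Lemma ps_term r m a : 0 < r -> ps r (normc a * r ^+ mdegree m) (fun y => a * mono y m).
Proof.
move=> r0; apply: (@ps_generalized unit (fun _ => a) (fun _ => m)) => //.
  move=> S; have ST : S `<=` [fset tt] by apply/fsubsetP => -[] _; rewrite inE.
  apply: le_trans (ler_fset_sum _ ST) _ => [i|]; first exact: normc_ge0.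
  by rewrite big_seq_fset1 normcM normc_real ger0_norm ?exprn_ge0 ?(ltW r0).
move=> y hy; have := @has_sum_finite R unit (fun _ => a * mono y m) [fset tt].
by rewrite big_seq_fset1; apply; case; rewrite inE.
Qed.

Lemma ps_const r a : 0 < r -> ps r (normc a) (fun _ => a).
Proof.
move=> r0; have := ps_term [ffun => 0%N] a r0; rewrite mdegree_0 expr0 mulr1.
by apply: eq_ps => y _; rewrite mono_0 mulr1.
Qed.

Lemma ps_var r i : 0 < r -> ps r r (fun y => y i).
Proof.
move=> r0; have := ps_term (mvar i) 1 r0; rewrite mdegree_var normc1 mul1r expr1.
by apply: eq_ps => y _; rewrite mono_var mul1r.
Qed.

Lemma ps_add r B B' g g' : ps r B g -> ps r B' g' ->
  ps r (B + B') (fun y => g y + g' y).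
Proof.
move=> [c [hB hg]] [c' [hB' hg']]; exists (fun m => c m + c' m); split.
  apply: sum_bounded_dom (sum_boundedD hB hB') => m.
  by rewrite mulrDl.
move=> y hy; apply: eq_has_sum (has_sumD (hg y hy) (hg' y hy)) => m.
by rewrite mulrDl.
Qed.

Lemma ps_scale r B g a : ps r B g -> ps r (normc a * B) (fun y => a * g y).
Proof.
move=> [c [hB hg]]; exists (fun m => a * c m); split.
  by apply: sum_bounded_dom (sum_boundedZ a hB) => m; rewrite mulrA.
by move=> y hy; apply: eq_has_sum (has_sumZ a (hg y hy)) => m; rewrite mulrA.
Qed.

Lemma ps_mul r B B' g g' : 0 < r -> ps r B g -> ps r B' g' ->
  ps r (B * B') (fun y => g y * g' y).
Proof.
move=> r0 [c [hB hg]] [c' [hB' hg']].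
apply: (@ps_generalized _ (fun k => c k.1 * c' k.2) (fun k => madd k.1 k.2)) => //.
  apply: sum_bounded_dom (sum_bounded_prod hB hB') => k.
  by rewrite mdegree_add exprD rmorphM /= mulrACA.
move=> y hy; apply: eq_has_sum (has_sum_prod _ _ (hg y hy) (hg' y hy)).
- by move=> k /=; rewrite mono_add mulrACA.
- exact: (sum_bounded_mono (p := id) hB hy).
- exact: (sum_bounded_mono (p := id) hB' hy).
Qed.

Lemma ps_exp r B g k : 0 < r -> ps r B g -> ps r (B ^+ k) (fun y => g y ^+ k).
Proof.
move=> r0 h; elim: k => [|k IH].
  rewrite expr0 -(normc1 R); apply: eq_ps (ps_const 1 r0) => y _.
  by rewrite expr0.
by rewrite exprS; apply: eq_ps (ps_mul r0 h IH) => y _; rewrite exprS.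
Qed.

Lemma ps_prod (J : Type) (s : seq J) r (B : J -> R) (g : J -> ('I_n -> C) -> C) :
  0 < r -> (forall j, ps r (B j) (g j)) ->
  ps r (\prod_(j <- s) B j) (fun y => \prod_(j <- s) g j y).
Proof.
move=> r0 h; elim: s => [|j s IH].
  rewrite big_nil -(normc1 R); apply: eq_ps (ps_const 1 r0) => y _.
  by rewrite big_nil.
by rewrite big_cons; apply: eq_ps (ps_mul r0 (h j) IH) => y _; rewrite big_cons.
Qed.

Lemma ps_bigsum (J : Type) (s : seq J) r (B : J -> R) (g : J -> ('I_n -> C) -> C) :
  0 < r -> (forall j, ps r (B j) (g j)) ->
  ps r (\sum_(j <- s) B j) (fun y => \sum_(j <- s) g j y).
Proof.
move=> r0 h; elim: s => [|j s IH].
  rewrite big_nil -(normc0 R); apply: eq_ps (ps_const 0 r0) => y _.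
  by rewrite big_nil.
by rewrite big_cons; apply: eq_ps (ps_add (h j) IH) => y _; rewrite big_cons.
Qed.

(** Weierstrass's theorem in l1-form: the double family of all coefficients is summable, so
    collecting it by exponent and summing it by [k] give the same function. *)
Lemma ps_series (K : choiceType) r (b : K -> R) B (g : K -> ('I_n -> C) -> C) G :
  0 < r -> (forall k, ps r (b k) (g k)) ->
  sum_bounded (fun k => (b k)%:C) B ->
  (forall y, polydisc r y -> has_sum (fun k => g k y) (G y)) ->
  ps r B G.
Proof.
move=> r0 hk hB hG; have [c hc] := choice hk.
have bnd : sum_bounded
    (fun k : K * {ffun 'I_n -> nat} => c k.1 k.2 * (r ^+ mdegree k.2)%:C) B.
  move=> S; pose T := [fset k.1 | k in S]; pose U := [fset k.2 | k in S].
  apply: (@le_trans _ _ (\sum_(k <- T `*` U) normc (c k.1 k.2 * (r ^+ mdegree k.2)%:C))).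
    apply: ler_fset_sum => [k|]; first exact: normc_ge0.
    apply/fsubsetP => k kS.
    by rewrite in_fsetM; apply/andP; split; apply/imfsetP; exists k.
  rewrite /fsetM big_imfset2 /=; last by move=> [x y] [x' y'] _ _ /= [-> ->].
  apply: le_trans (hB T); apply: ler_sum => k _.
  by apply: le_trans ((hc k).1 U) _; rewrite normc_real ler_norm.
apply: (@ps_generalized _ (fun k => c k.1 k.2) (fun k => k.2)) => // y hy.
have bndy := sum_bounded_mono bnd hy.
have [l hl] := sum_bounded_has_sum bndy.
suff -> : G y = l by [].
apply: has_sum_unique (hG y hy) _; apply: (has_sum_fibers (p := fst)) bndy hl.
move=> k /=; apply/(@has_sum_reindex _ _ _ (fun m => (k, m))); first by move=> ? ? [].
  move=> [k' m] h; case: eqP => //= kk; case: (h m); by rewrite kk.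
by apply: eq_has_sum ((hc k).2 y hy) => m /=; rewrite eqxx.
Qed.

Lemma polydisc_le r r' y : r <= r' -> polydisc r y -> polydisc r' y.
Proof. by move=> h hy i; exact: le_trans (hy i) h. Qed.

Lemma ps_shrink r r' B g : 0 <= r' -> r' <= r -> ps r B g -> ps r' B g.
Proof.
move=> r0 rr [c [hB hg]]; exists c; split=> [|y /(polydisc_le rr)]; last exact: hg.
apply: sum_bounded_dom hB => m; rewrite !normcM ler_wpM2l ?normc_ge0 //.
by rewrite !normc_real !normrX lerXn2r ?nnegrE ?normr_ge0 // !ger0_norm // (le_trans r0).
Qed.

Lemma ps_coef0 c r B g : 0 <= r -> ps_coef c r B g -> c [ffun => 0%N] = g (fun _ => 0).
Proof.
move=> r0 [_ /(_ (fun _ => 0))] h.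
apply: has_sum_unique (h _); last by move=> i; rewrite normc0.
have := @has_sum_finite R _ (fun m => c m * mono (fun _ : 'I_n => 0) m) [fset [ffun => 0%N]].
rewrite big_seq_fset1 mono_0 mulr1; apply => m; rewrite inE => m0.
have /existsP [i mi] : [exists i, m i != 0%N].
  rewrite -negb_forall; apply: contra m0 => /forallP mm; apply/eqP/ffunP => i.
  by rewrite ffunE; apply/eqP/mm.
by rewrite /mono (bigD1 i) //= expr0n (negbTE mi) mul0r mulr0.
Qed.

(** Without constant term every monomial has degree at least 1, so its weight shrinks at least by
    the factor r'/r. This makes inner functions small enough to be composed. *)
Lemma ps_small r r' B g : 0 < r -> 0 <= r' -> r' <= r -> g (fun _ => 0) = 0 ->
  ps r B g -> ps r' (B * (r' / r)) g.
Proof.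
move=> r0 r'0 rr g0 [c hc]; have c0 := ps_coef0 (ltW r0) hc; case: hc => hB hg.
exists c; split=> [|y /(polydisc_le rr)]; last exact: hg.
have q1 : r' / r <= 1 by rewrite ler_pdivrMr // mul1r.
have q0 : 0 <= r' / r by rewrite divr_ge0 // ltW.
have := sum_boundedZ (r' / r)%:C hB; rewrite normc_real ger0_norm // [_ * B]mulrC.
apply: sum_bounded_dom => m; have [m0|mpos] := posnP (mdegree m).
  by rewrite (mdegree_eq0 m0) c0 g0 mul0r normc0 normc_ge0.
rewrite mulrCA !normcM ler_wpM2l ?normc_ge0 // !normc_real -normrM.
rewrite !ger0_norm ?mulr_ge0 ?exprn_ge0 ?invr_ge0 ?(ltW r0) //.
rewrite -{1}(divfK (lt0r_neq0 r0) r') exprMn ler_wpM2r ?exprn_ge0 ?(ltW r0) //.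
by rewrite -(prednK mpos) exprS ler_piMr // exprn_ile1.
Qed.

Lemma ps_conj r B g : ps r B g -> ps r B (fun y => conjc (g (fun i => conjc (y i)))).
Proof.
move=> [c [hB hg]]; exists (fun m => conjc (c m)); split.
  apply: sum_bounded_dom hB => m; rewrite !normcM normc_conj //.
move=> y hy; have hy' : polydisc r (fun i => conjc (y i)).
  by move=> i; rewrite normc_conj.
apply: eq_has_sum (has_sum_conj (hg _ hy')) => m.
rewrite rmorphM /= mono_conj; congr (_ * mono _ _).
by apply/funext => i; rewrite conjcK.
Qed.

End Monomials.

(** The term of exponent [m] becomes a product of powers of the [u j] with bound
    [normc (c m) * B ^+ mdegree m], and [B <= s] compares it with the outer series. *)
Lemma ps_comp n k r s B B' (c : {ffun 'I_k -> nat} -> C) G (u : 'I_k -> ('I_n -> C) -> C) :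
  0 < r -> ps_coef c s B' G -> (forall j, ps r B (u j)) -> B <= s ->
  ps r B' (fun y => G (fun j => u j y)).
Proof.
move=> r0 [hB hG] hu Bs.
have B0 : forall j : 'I_k, 0 <= B by move=> j; exact: ps_ge0 (hu j).
apply: (@ps_series n _ r (fun m => normc (c m) * \prod_j B ^+ m j) _
   (fun m y => c m * mono (fun j => u j y) m)) => //.
- move=> m; apply: ps_scale; apply: ps_prod => // j; exact: ps_exp.
- apply: sum_bounded_dom hB => m; rewrite prodrXr -/(mdegree m).
  rewrite rmorphM !normcM !normc_real ger0_norm ?normc_ge0 //.
  rewrite ler_wpM2l ?normc_ge0 // !normrX.
  (* For [k = 0] there is no inner function to make [B] non-negative; in positive degree some [u i]
     does. *)
  have [m0|mpos] := posnP (mdegree m); first by rewrite m0 !expr0.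
  have /existsP [i mi] : [exists i, m i != 0%N].
    rewrite -negb_forall; apply: contraTN mpos => /forallP mm.
    by rewrite -eqn0Ngt /mdegree big1 // => j _; apply/eqP/mm.
  by rewrite lerXn2r ?nnegrE ?normr_ge0 // !ger0_norm ?(B0 i) // (le_trans (B0 i)).
- move=> y hy; apply: hG => j; apply: le_trans Bs; exact: ps_norm (hu j) hy.
Qed.

Lemma ps_comp_nat n r s B (c : nat -> C) B' (G : C -> C) (u : ('I_n -> C) -> C) :
  0 < r -> sum_bounded (fun k => c k * (s ^+ k)%:C) B' ->
  (forall w, normc w <= s -> has_sum (fun k => c k * w ^+ k) (G w)) ->
  ps r B u -> B <= s -> ps r B' (fun y => G (u y)).
Proof.
move=> r0 hB hG hu Bs; have B0 := ps_ge0 hu.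
apply: (@ps_series n _ r (fun k => normc (c k) * B ^+ k) _
   (fun k y => c k * u y ^+ k)) => //.
- by move=> k; apply: ps_scale; exact: ps_exp.
- apply: sum_bounded_dom hB => k; rewrite rmorphM !normcM !normc_real.
  rewrite ger0_norm ?normc_ge0 // ler_wpM2l ?normc_ge0 // !normrX.
  by rewrite lerXn2r ?nnegrE ?normr_ge0 // !ger0_norm // (le_trans B0).
- by move=> y hy; apply: hG; apply: le_trans Bs; exact: ps_norm hu hy.
Qed.

End PowerSeries.

(** * Derivatives and uniqueness of power series *)

Section Derivative.
Local Open Scope fset_scope.
Local Open Scope ring_scope.
Variable R : realType.
Local Notation C := (R[i]).

Lemma sum_bounded_reindex (I K : choiceType) (h : I -> K) (f : K -> C) B :
  injective h -> sum_bounded f B -> sum_bounded (fun i => f (h i)) B.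
Proof.
move=> hinj hB S; apply: le_trans (hB (h @` S)).
by rewrite big_imfset //= => ? ? _ _ /hinj.
Qed.

Lemma normc_natr k : normc (k%:R : C) = k%:R.
Proof. by rewrite -(rmorph_nat (real_complex R)) normc_real normr_nat. Qed.

(** The remainders satisfy E(k+1) = (z + t) E(k) + k t^2 z^(k-1). The factor rho^2 on the left
    stands for an exponent k - 2 on the right, which would be negative for small k. *)
Lemma taylor_monomial (rho : R) (z t : C) (k : nat) : 0 <= rho ->
  normc z <= rho -> normc (z + t) <= rho ->
  rho ^+ 2 * normc ((z + t) ^+ k - z ^+ k - t * (k%:R * z ^+ k.-1))
    <= k%:R ^+ 2 * rho ^+ k * normc t ^+ 2.
Proof.
move=> rho0 hz hzt; elim: k => [|k IH].
  by rewrite !expr0 mul0r mulr0 subr0 subrr normc0 mulr0 expr0n /= !mul0r.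
set E := _ - _ - _ in IH.
have -> : (z + t) ^+ k.+1 - z ^+ k.+1 - t * (k.+1%:R * z ^+ k.+1.-1) =
  (z + t) * E + k%:R * t ^+ 2 * z ^+ k.-1.
  by rewrite /E /= !exprS -natr1; case: (k) => [|j]; rewrite /= ?exprS ?expr0; ring.
have h1 : rho ^+ 2 * normc ((z + t) * E) <= rho * (k%:R ^+ 2 * rho ^+ k * normc t ^+ 2).
  rewrite normcM mulrCA; apply: ler_pM => //; first exact: normc_ge0.
  by rewrite mulr_ge0 ?exprn_ge0 ?normc_ge0.
have h2 : rho ^+ 2 * normc (k%:R * t ^+ 2 * z ^+ k.-1) <= k%:R * rho ^+ k.+1 * normc t ^+ 2.
  rewrite !normcM normc_natr !normcX.
  case: (k) => [|j]; first by rewrite !mul0r mulr0.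
  have -> : rho ^+ 2 * (j.+1%:R * normc t ^+ 2 * normc z ^+ j) =
    (j.+1%:R * normc t ^+ 2 * rho ^+ 2) * normc z ^+ j by ring.
  have -> : j.+1%:R * rho ^+ j.+2 * normc t ^+ 2 =
    (j.+1%:R * normc t ^+ 2 * rho ^+ 2) * rho ^+ j by rewrite !exprS; ring.
  rewrite ler_wpM2l ?mulr_ge0 ?exprn_ge0 ?normc_ge0 //.
  by rewrite lerXn2r ?nnegrE ?normc_ge0.
rewrite (le_trans (ler_wpM2l _ (ler_normcD _ _))) ?exprn_ge0 // mulrDr.
apply: le_trans (lerD h1 h2) _.
rewrite -natr1 (exprS rho k).
have hT : 0 <= normc t ^+ 2 by rewrite exprn_ge0 ?normc_ge0.
have hp : 0 <= rho * rho ^+ k by rewrite mulr_ge0 ?exprn_ge0.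
have -> : rho * (k%:R ^+ 2 * rho ^+ k * normc t ^+ 2) + k%:R * (rho * rho ^+ k) * normc t ^+ 2
  = (k%:R ^+ 2 + k%:R) * (rho * rho ^+ k) * normc t ^+ 2 by ring.
rewrite ler_wpM2r // ler_wpM2r //.
have k0 : 0 <= k%:R :> R by [].
have -> : (k%:R + 1) ^+ 2 = k%:R ^+ 2 + k%:R + (k%:R + 1) :> R by ring.
by rewrite lerDl addr_ge0.
Qed.

Section Multi.
Variable n : nat.
Implicit Types (y : 'I_n -> C) (m : {ffun 'I_n -> nat}).

Definition shift y (i : 'I_n) (t : C) : 'I_n -> C :=
  fun j => if j == i then y j + t else y j.

Definition deriv_coef (i : 'I_n) (c : {ffun 'I_n -> nat} -> C) m : C :=
  (m i).+1%:R * c (madd m (mvar i)).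

Definition mpred m (i : 'I_n) : {ffun 'I_n -> nat} := [ffun j => m j - (j == i)]%N.

Lemma madd_var_inj i : injective (fun m => madd m (mvar i)).
Proof.
by move=> m m' /ffunP h; apply/ffunP => j; move: (h j); rewrite !ffunE => /addIn.
Qed.

Lemma maddK i m : mpred (madd m (mvar i)) i = m.
Proof. by apply/ffunP => j; rewrite !ffunE addnK. Qed.

Lemma mpredK i m : (0 < m i)%N -> madd (mpred m i) (mvar i) = m.
Proof.
move=> h; apply/ffunP => j; rewrite !ffunE; case: eqP => [->|_]; first by rewrite subnK.
by rewrite subn0 addn0.
Qed.

Lemma madd_var_outside i m : (forall m', m <> madd m' (mvar i)) -> m i = 0%N.
Proof. by case: (posnP (m i)) => // h /(_ (mpred m i)); rewrite mpredK. Qed.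

Lemma mono_split y m i : mono y m = y i ^+ m i * \prod_(j | j != i) y j ^+ m j.
Proof. by rewrite /mono (bigD1 i). Qed.

Lemma mdegree_split m i : mdegree m = (m i + \sum_(j | j != i) m j)%N.
Proof. by rewrite /mdegree (bigD1 i). Qed.

Lemma leq_mdegree m i : (m i <= mdegree m)%N.
Proof. by rewrite (mdegree_split m i) leq_addr. Qed.

(** The derivative and the quadratic remainder cost factors k and k^2 per coefficient. A radius four
    times smaller absorbs them, since k <= 2^k gives k^2 <= 4^k. *)
Lemma ps_deriv i c r B g : 0 < r -> ps_coef c r B g ->
  exists g' : ('I_n -> C) -> C, exists B',
  ps_coef (deriv_coef i c) (r / 4) B' g' /\
  exists2 K : R, 0 <= K & forall y t, polydisc (r / 4) y -> polydisc (r / 4) (shift y i t) ->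
    normc (g (shift y i t) - g y - t * g' y) <= K * normc t ^+ 2.
Proof.
move=> r0 [hB hg]; set rho := r / 4.
have rho0 : 0 < rho by rewrite divr_gt0.
have rr : rho <= r by rewrite ler_pdivrMr // ler_peMr ?ler1n // ltW.
have r4 k : r ^+ k = 4 ^+ k * rho ^+ k.
  by rewrite -exprMn [4 * _]mulrC divfK ?pnatr_eq0.
clearbody rho.
have hk (k d : nat) : (k <= d)%N -> k%:R ^+ 2 * rho ^+ d <= r ^+ d.
  move=> kd; rewrite r4 ler_wpM2r ?exprn_ge0 ?(ltW rho0) // -natrX -(natrX _ 4) ler_nat.
  rewrite -[4%N]/(2 ^ 2)%N -expnM mulnC expnM leq_exp2r //.
  by rewrite (leq_trans kd) // ltnW // ltn_expl.
have hk1 (k d : nat) : (k <= d)%N -> k%:R * rho ^+ d <= r ^+ d.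
  case: k => [|k] kd; first by rewrite mul0r exprn_ge0 // ltW.
  apply: le_trans (hk _ _ kd); rewrite ler_wpM2r ?exprn_ge0 ?(ltW rho0) // expr2.
  by rewrite ler_peMr // ler1n.
(* Derivatives of the monomials, still indexed by the original exponents; the terms with [m i = 0]
   vanish, which permits reindexing by [madd _ (mvar i)]. *)
pose F y m := c m * (m i)%:R * mono y (mpred m i).
have hF0 y m : (forall m', m <> madd m' (mvar i)) -> F y m = 0.
  by move=> /madd_var_outside h; rewrite /F h mulr0 mul0r.
have hFh y m : F y (madd m (mvar i)) = deriv_coef i c m * mono y m.
  by rewrite /F maddK /deriv_coef !ffunE eqxx addn1 [c _ * _]mulrC.
have hD : sum_bounded (fun m => deriv_coef i c m * (rho ^+ mdegree m)%:C) (normc (rho^-1)%:C * B).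
  have : sum_bounded (fun m => c m * (m i)%:R * (rho ^+ (mdegree m).-1)%:C) (normc (rho^-1)%:C * B).
    apply: sum_bounded_dom (sum_boundedZ _ hB) => m.
    rewrite mulrCA -!mulrA !normcM ler_wpM2l ?normc_ge0 // normc_natr.
    case: (posnP (m i)) => [->|mi].
      by rewrite mul0r mulr_ge0 ?normc_ge0.
    have dpos : (0 < mdegree m)%N by apply: leq_trans mi (leq_mdegree m i).
    rewrite !normc_real !ger0_norm ?exprn_ge0 ?invr_ge0 ?(ltW rho0) ?(ltW r0) //.
    rewrite ler_pdivlMl // mulrCA -exprS prednK //.
    exact: hk1 (leq_mdegree m i).
  move=> /(sum_bounded_reindex (@madd_var_inj i)); apply: sum_bounded_dom => m.
  rewrite mdegree_add mdegree_var addn1 /= /deriv_coef !ffunE eqxx addn1.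
  by rewrite [c _ * _]mulrC.
have hg' y : exists l, polydisc rho y -> has_sum (fun m => deriv_coef i c m * mono y m) l.
  case: (pselect (polydisc rho y)) => hy; last by exists 0.
  have [l hl] := sum_bounded_has_sum (sum_bounded_mono (p := id) hD hy).
  by exists l.
have [g' {}hg'] := choice hg'; exists g'; exists (normc (rho^-1)%:C * B).
split; first by split.
exists (rho ^- 2 * B) => [|y t hy hyt].
  by rewrite mulr_ge0 ?invr_ge0 ?exprn_ge0 ?(sum_bounded_ge0 hB) // ltW.
have hFs : has_sum (F y) (g' y).
  apply/(@has_sum_reindex _ _ _ _ (F y) _ (@madd_var_inj i) (hF0 y)).
  by apply: eq_has_sum (hg' y hy) => m; rewrite hFh.
have hs := hg _ (polydisc_le rr hyt).
have hs' := hg _ (polydisc_le rr hy).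
have hT : 0 <= normc t ^+ 2 by rewrite exprn_ge0 ?normc_ge0.
apply: has_sum_le (has_sumB (has_sumB hs hs') (has_sumZ t hFs)).
have := sum_boundedZ (rho ^- 2 * normc t ^+ 2)%:C hB.
rewrite normc_real ger0_norm ?mulr_ge0 ?invr_ge0 ?exprn_ge0 ?normc_ge0 ?(ltW rho0) //.
rewrite mulrAC; apply: sum_bounded_dom => m.
rewrite /F (mono_split _ _ i) (mono_split y m i) (mono_split y (mpred m i) i).
rewrite {1}/shift eqxx !ffunE eqxx subn1.
have -> : \prod_(j | j != i) shift y i t j ^+ m j = \prod_(j | j != i) y j ^+ m j.
  by apply: eq_bigr => j /negbTE ji; rewrite /shift ji.
have -> : \prod_(j | j != i) y j ^+ mpred m i j = \prod_(j | j != i) y j ^+ m j.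
  by apply: eq_bigr => j /negbTE ji; rewrite !ffunE ji subn0.
set P := \prod_(j | _) _.
have hP : normc P <= rho ^+ (\sum_(j | j != i) m j).
  rewrite normc_prod -prodrXr; apply: ler_prod => j _.
  by rewrite normcX exprn_ge0 ?normc_ge0 //= lerXn2r ?nnegrE ?normc_ge0 ?(ltW rho0) ?hy.
have -> : c m * ((y i + t) ^+ m i * P) - c m * (y i ^+ m i * P) -
   t * (c m * (m i)%:R * (y i ^+ (m i).-1 * P)) =
   c m * (((y i + t) ^+ m i - y i ^+ m i - t * ((m i)%:R * y i ^+ (m i).-1)) * P) by ring.
have hti : normc (y i + t) <= rho by have := hyt i; rewrite /shift eqxx.
have := taylor_monomial (m i) (ltW rho0) (hy i) hti.
set E := _ - _ - _ => hE.
rewrite [X in _ <= normc X]mulrCA !normcM ler_wpM2l ?normc_ge0 // !normc_real.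
rewrite !ger0_norm ?mulr_ge0 ?invr_ge0 ?exprn_ge0 ?normc_ge0 ?(ltW rho0) ?(ltW r0) //.
rewrite -mulrA ler_pdivlMl ?exprn_gt0 // mulrA.
apply: le_trans (ler_pM _ _ hE hP) _; rewrite ?mulr_ge0 ?exprn_ge0 ?normc_ge0 ?(ltW rho0) //.
rewrite mulrAC [leRHS]mulrC ler_wpM2r // -mulrA -exprD -mdegree_split.
exact: hk (leq_mdegree m i).
Qed.

(* Vanishing on the real points suffices: the derivatives in real directions
   already determine the coefficients. *)
Lemma ps_real_eq0 c (r r' : R) B g : 0 < r -> 0 < r' -> ps_coef c r B g ->
  (forall y : 'I_n -> R, (forall i, `|y i| <= r') -> g (fun i => (y i)%:C) = 0) ->
  forall m, c m = 0.
Proof.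
move=> r0 r'0 hc h0 m.
(* Induction on the degree for all series at once: up to a non-zero integer, [c m] is a coefficient
   of lower degree of a partial derivative, which again vanishes at real points. *)
have [k] := ubnP (mdegree m); elim: k => // k IH in c r r' B g m r0 r'0 hc h0 *.
move=> mk; case: (posnP (mdegree m)) => [m0|mpos].
  rewrite (mdegree_eq0 m0) (ps_coef0 (ltW r0) hc).
  have := h0 (fun=> 0); apply => i; by rewrite normr0 ltW.
have /existsP [i mi] : [exists i, m i != 0%N].
  rewrite -negb_forall; apply: contraTN mpos => /forallP mm.
  by rewrite -eqn0Ngt /mdegree big1 // => j _; apply/eqP/mm.
rewrite -lt0n in mi; rewrite -(mpredK mi).
have [g' [B' [hc' [K K0 hK]]]] := ps_deriv i r0 hc.
have r40 : 0 < r / 4 by rewrite divr_gt0.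
pose s : R := Num.min r' (r / 4) / 2.
have s0 : 0 < s by rewrite divr_gt0 // lt_min r'0.
have sr' : s + s <= r' by rewrite -splitr ge_min lexx.
have sr : s + s <= r / 4 by rewrite -splitr ge_min lexx orbT.
have ss : s <= s + s by rewrite lerDl ltW.
(* Both values of [g] in the difference quotient vanish, which leaves t |g' y| <= K t^2 for
   arbitrarily small real t > 0. *)
have h' (y : 'I_n -> R) : (forall i, `|y i| <= s) -> g' (fun i => (y i)%:C) = 0.
  move=> hy; apply: normc0_eq0 => e e0.
  pose t := Num.min s (e / (K + 1)).
  have K1 : 0 < K + 1 by rewrite ltr_wpDl.
  have t0 : 0 < t by rewrite lt_min s0 divr_gt0.
  have ts : t <= s by rewrite ge_min lexx.
  pose y' j := if j == i then y j + t else y j.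
  have y'E : shift (fun i => (y i)%:C) i t%:C = (fun j => (y' j)%:C).
    by apply/funext => j; rewrite /shift /y'; case: ifP => // _; rewrite rmorphD.
  have hy' j : `|y' j| <= s + s.
    rewrite /y'; case: ifP => _; last exact: le_trans (hy j) ss.
    by rewrite (le_trans (ler_normD _ _)) // lerD // ger0_norm // ltW.
  have := hK (fun i => (y i)%:C) t%:C.
  rewrite y'E h0 => [|j]; last exact: le_trans (hy' j) sr'.
  rewrite h0 => [|j]; last by apply: le_trans (hy j) _; apply: le_trans ss sr'.
  rewrite subrr sub0r normcN' normcM normc_real ger0_norm ?(ltW t0) //.
  have p1 : polydisc (r / 4) (fun i => (y i)%:C).
    by move=> j; rewrite normc_real; apply: le_trans (hy j) _; apply: le_trans ss sr.
  have p2 : polydisc (r / 4) (fun i => (y' i)%:C).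
    by move=> j; rewrite normc_real; apply: le_trans (hy' j) sr.
  move=> /(_ p1 p2); rewrite expr2 mulrCA ler_pM2l // => /le_trans; apply.
  have : t <= e / (K + 1) by rewrite ge_min lexx orbT.
  rewrite ler_pdivlMr // mulrC => hte; apply: le_trans hte.
  by rewrite ler_wpM2r ?(ltW t0) // lerDl.
have mk' : (mdegree (mpred m i) < k)%N.
  move: mk; rewrite -[in X in (X < _)%N](mpredK mi) mdegree_add mdegree_var addn1.
  by rewrite ltnS.
have := IH (deriv_coef i c) (r / 4) s B' g' (mpred m i) r40 s0 hc' h' mk'.
by move=> /eqP; rewrite /deriv_coef mulf_eq0 pnatr_eq0 /= => /eqP.
Qed.

Lemma ps_coef_eq0 c r B g y : ps_coef c r B g -> (forall m, c m = 0) ->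
  polydisc r y -> g y = 0.
Proof.
move=> [_ hg] c0 hy; apply: has_sum_unique (hg y hy) _.
by apply: eq_has_sum (has_sum0 _) => m; rewrite c0 mul0r.
Qed.

(** A Lipschitz bound at the origin, from [ps_small] applied to [g - g 0]. *)
Lemma ps_continuous0 r B g : 0 < r -> ps r B g ->
  exists2 K : R, 0 <= K & forall s y, 0 <= s -> s <= r -> polydisc s y ->
    normc (g y - g (fun => 0)) <= K * s.
Proof.
move=> r0 hg; pose h y := g y + -1 * g (fun => 0).
have hh : ps r (B + normc (-1 * g (fun=> 0))) h by exact: (ps_add hg (ps_const n (-1 * g (fun=> 0)) r0)).
exists ((B + normc (-1 * g (fun=> 0))) / r).
  by rewrite divr_ge0 ?(ltW r0) // (ps_ge0 hh).
move=> s y s0 sr hy; have h0 : h (fun=> 0) = 0 by rewrite /h mulN1r subrr.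
have := ps_norm (ps_small r0 s0 sr h0 hh) hy.
by rewrite /h mulN1r mulrA mulrAC.
Qed.

End Multi.
End Derivative.

(** * The square root series *)

Section SquareRoot.
Local Open Scope fset_scope.
Local Open Scope ring_scope.
Variable R : realType.
Local Notation C := (R[i]).

Lemma has_sum_finType (I : finType) (f : I -> C) : has_sum f (\sum_i f i).
Proof.
move=> e e0; exists [fset i in I] => S hS.
suff -> : \sum_(i <- S) f i = \sum_i f i by rewrite subrr normc0 ltW.
apply: perm_big; apply: uniq_perm; rewrite ?fset_uniq ?index_enum_uniq // => i.
by rewrite mem_index_enum; apply: (fsubsetP hS); rewrite !inE.
Qed.

Lemma sum_bounded_geometric (q : R) : 0 <= q -> q < 1 ->
  sum_bounded (fun k : nat => (q ^+ k)%:C) (1 - q)^-1.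
Proof.
move=> q0 q1 S; pose N := (\max_(i <- S) i).+1.
have q1' : 0 < 1 - q by rewrite subr_gt0.
apply: (@le_trans _ _ (\sum_(k <- [fset k in iota 0 N]) normc (q ^+ k)%:C)).
  apply: ler_fset_sum => [i|]; first exact: normc_ge0.
  apply/fsubsetP => i iS; rewrite in_fset /= ; change (i \in iota 0 N).
  by rewrite mem_iota leq0n add0n ltnS (@leq_bigmax_seq _ _ xpredT id).
have -> : \sum_(k <- [fset k in iota 0 N]) normc (q ^+ k)%:C = \sum_(k < N) q ^+ k.
  rewrite -(big_mkord xpredT (fun k => q ^+ k)) /index_iota subn0.
  rewrite [RHS](eq_bigr (fun k => normc (q ^+ k)%:C)) => [|k _]; last first.
    by rewrite normc_real ger0_norm ?exprn_ge0.
  apply: perm_big; apply: uniq_perm; rewrite ?fset_uniq ?iota_uniq // => i.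
  by rewrite !inE.
have := subrX1 q N; rewrite -opprB -[q - 1]opprB mulNr => /oppr_inj h.
rewrite -[leRHS]mul1r ler_pdivlMr // mulrC -h lerBlDr lerDl exprn_ge0 //.
Qed.

(** The generalized binomial coefficient of 1/2 over [k], that is the Taylor coefficient of sqrt (1
    + t). *)
Fixpoint binom_half (k : nat) : R :=
  if k is j.+1 then binom_half j * (2^-1 - j%:R) / j.+1%:R else 1.

Lemma binom_half_le1 k : `|binom_half k| <= 1.
Proof.
elim: k => [|k IH] /=; first by rewrite normr1.
rewrite -mulrA normrM mulr_ile1 ?normr_ge0 // normrM normfV normr_nat.
rewrite ler_pdivrMr ?ltr0n // mul1r ler_norml -natr1.
have k0 : 0 <= k%:R :> R by [].
by apply/andP; split; lra.
Qed.

(* The truncated series p satisfies 2 (1 + X) p' = p, hence (1 + X) (p^2)' = p^2,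
   up to the truncation order. *)
Lemma binom_half_conv k :
  \sum_(i < k.+1) binom_half i * binom_half (k - i) = (k <= 1)%:R.
Proof.
pose N := k.+2; pose p : {poly R} := \poly_(i < N) binom_half i.
have pE i : (i < N)%N -> p`_i = binom_half i by move=> h; rewrite coef_poly h.
pose q := p * p.
have qE i : (i < N)%N -> q`_i = \sum_(j < i.+1) binom_half j * binom_half (i - j).
  move=> iN; rewrite coefM; apply: eq_bigr => j _; rewrite !pE //.
    by apply: leq_ltn_trans (leq_subr _ _) iN.
  by apply: leq_trans iN; rewrite ltnS -ltnS.
pose h := ((1 + 'X) * p^`()) *+ 2.
have hE i : (i.+1 < N)%N -> h`_i = p`_i.
  move=> iN; rewrite coefMn mulrDl mul1r coefD coefXM !coef_deriv.
  case: i iN => [|i] iN; rewrite (pE _ iN) (pE _ (ltnW iN)) /=.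
    by rewrite mulr1n addr0 mul1r subr0 divr1 -mulr_natr; field.
  set a := binom_half i.
  set u : R := i.+1%:R; set v : R := i.+2%:R; set w : R := 2^-1; set x : R := i%:R.
  have hu : u = x + 1 by rewrite /u /x natr1.
  have hv : v = x + 1 + 1 by rewrite /v /x !natr1.
  have hw : w = 1 / (1 + 1) by rewrite /w div1r.
  have x0 : 0 <= x by [].
  rewrite -(mulr_natr _ i.+2) -(mulr_natr _ i.+1) -(mulr_natr _ 2) -/u -/v hu hv hw.
  by field; rewrite ?gt_eqF /=; lra.
have dq : (1 + 'X) * q^`() = p * h.
  by rewrite /q derivM /h -mulrnAr; ring.
(* Compare coefficients in (1 + X) q' = q. The factor [1 - i] vanishes for i = 1 and thereby kills
   the coefficients of [q] from degree 2 on. *)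
have rec i : (i.+1 < N)%N -> i.+1%:R * q`_i.+1 = (1 - i%:R) * q`_i.
  move=> iN; have : ((1 + 'X) * q^`())`_i = q`_i.
    rewrite dq /q !coefM; apply: eq_bigr => j _; rewrite hE //.
    by apply: leq_ltn_trans iN; rewrite ltnS leq_subr.
  rewrite mulrDl mul1r coefD coefXM !coef_deriv.
  have -> : (if i == 0%N then 0 else q`_i.-1.+1 *+ i.-1.+1) = i%:R * q`_i.
    by case: (i) => [|j]; rewrite /= ?mul0r // mulr_natl.
  by move=> hq; rewrite mulrBl mul1r -{1}hq mulr_natl addrK.
have q0 : q`_0 = 1 by rewrite qE // big_ord1 /= mulr1.
have q1 : q`_1 = 1 by have := rec 0%N isT; rewrite q0 mul1r subr0 mulr1.
rewrite -qE //; case: k @N p pE @q qE @h hE dq rec q0 q1 => [|[|k]] N p pE q qE h hE dq rec q0 q1 //.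
have : (k.+2 < N)%N by rewrite /N.
elim: (k) => [|j IH] jN.
  have := rec 1%N; rewrite subrr mul0r => /(_ jN)/eqP.
  by rewrite mulf_eq0 pnatr_eq0 /= => /eqP.
have := rec j.+2 jN; rewrite IH ?(ltnW jN) // mulr0 => /eqP.
by rewrite mulf_eq0 pnatr_eq0 /= => /eqP.
Qed.

Lemma sum_bounded_binom_half : sum_bounded (fun k => (binom_half k)%:C * (2^-1 ^+ k)%:C) 2.
Proof.
have := @sum_bounded_geometric 2^-1; rewrite invr_ge0 ler0n => /(_ isT).
have -> : 1 - 2^-1 = 2^-1 :> R by lra.
rewrite invrK invf_lt1 ?ltr1n // => /(_ isT); apply: sum_bounded_dom => k.
rewrite normcM -[leRHS]mul1r ler_wpM2r ?normc_ge0 // normc_real.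
exact: binom_half_le1.
Qed.

(** The Cauchy product and [binom_half_conv] give G^2 = 1 + w. For real [t] the smaller radius 1/4
    keeps [G t] within distance 1 of 1, so [G t] is the non-negative root. *)
Lemma sqrt_series : exists G : C -> C,
  [/\ forall w, normc w <= 2^-1 -> has_sum (fun k => (binom_half k)%:C * w ^+ k) (G w),
      forall w, normc w <= 2^-1 -> G w ^+ 2 = 1 + w &
      forall t : R, `|t| <= 4^-1 -> G t%:C = (Num.sqrt (1 + t))%:C].
Proof.
have bnd (w : C) : normc w <= 2^-1 -> sum_bounded (fun k => (binom_half k)%:C * w ^+ k) 2.
  move=> hw; apply: sum_bounded_dom sum_bounded_binom_half => k.
  rewrite !normcM ler_wpM2l ?normc_ge0 // normc_real normcX ger0_norm ?exprn_ge0 ?invr_ge0 //.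
  by rewrite lerXn2r ?nnegrE ?normc_ge0 ?invr_ge0.
have ex (w : C) : exists l, normc w <= 2^-1 -> has_sum (fun k => (binom_half k)%:C * w ^+ k) l.
  case: (pselect (normc w <= 2^-1)) => hw; last by exists 0.
  by have [l hl] := sum_bounded_has_sum (bnd w hw); exists l.
have [G hG] := choice ex; exists G.
have sqG w : normc w <= 2^-1 -> G w ^+ 2 = 1 + w.
  move=> hw; have hp := has_sum_prod (bnd w hw) (bnd w hw) (hG w hw) (hG w hw).
  have hfib k : has_sum (fun x : nat * nat => if (x.1 + x.2)%N == k
      then (binom_half x.1)%:C * w ^+ x.1 * ((binom_half x.2)%:C * w ^+ x.2) else 0)
      ((k <= 1)%:R * w ^+ k).
    have hinj : injective (fun i : 'I_k.+1 => (i : nat, k - i)%N).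
      by move=> i j [/val_inj].
    apply/(@has_sum_reindex _ _ _ _ _ _ hinj) => [[i j]|].
      move=> h; case: eqP => //= ijk; have ik : (i < k.+1)%N by rewrite ltnS -ijk leq_addr.
      by case: (h (Ordinal ik)); rewrite /= -ijk addKn.
    rewrite -(rmorph_nat (real_complex R)) -binom_half_conv rmorph_sum mulr_suml.
    apply: eq_has_sum (has_sum_finType _) => i /=.
    have ik : (i <= k)%N by rewrite -ltnS.
    rewrite subnKC // eqxx rmorphM /= mulrACA -exprD subnKC //.
  have h1 := has_sum_fibers hfib (sum_bounded_prod (bnd w hw) (bnd w hw)) hp.
  rewrite expr2; apply: has_sum_unique h1 _.
  have := @has_sum_finite _ _ (fun k => (k <= 1)%:R * w ^+ k) [fset 0%N; 1%N].
  rewrite big_fsetU1 ?inE //= big_seq_fset1 !mul1r expr0 expr1; apply => k.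
  by rewrite !inE; case: k => [|[|k]] //; rewrite mul0r.
split=> // t ht.
have ht2 : normc t%:C <= 2^-1.
  by rewrite normc_real (le_trans ht) // lef_pV2 ?posrE ?ltr0n // ler_nat.
have Greal : conjc (G t%:C) = G t%:C.
  apply: has_sum_unique (hG _ ht2); apply: eq_has_sum (has_sum_conj (hG _ ht2)) => k.
  by rewrite -rmorphXn -rmorphM conjc_real.
have G1 : normc (G t%:C - 1) <= 1.
  have h1 : has_sum (fun k => if k == 0%N then 1 else 0) (1 : C).
    have := @has_sum_finite _ _ (fun k => if k == 0%N then 1 else 0 : C) [fset 0%N].
    by rewrite big_seq_fset1; apply => k; rewrite inE => /negbTE ->.
  apply: has_sum_le (has_sumB (hG _ ht2) h1).
  have -> : 1 = normc (2^-1)%:C * 2 :> R by rewrite normc_real ger0_norm ?invr_ge0 // mulVf ?pnatr_eq0.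
  apply: sum_bounded_dom (sum_boundedZ _ sum_bounded_binom_half) => k.
  case: k => [|k].
    by rewrite [binom_half 0]/= rmorph1 expr0 mulr1 subrr normc0 normc_ge0.
  rewrite subr0 mulrCA !normcM ler_wpM2l ?normc_ge0 // -normcM -rmorphM -rmorphXn !normc_real.
  rewrite normrX [leRHS]ger0_norm ?mulr_ge0 ?exprn_ge0 ?invr_ge0 //.
  (* The constant term is gone, so the exponent is at least 1 and 4^-(k+1) <= 2^-1 * 2^-(k+1). *)
  apply: (@le_trans _ _ (4^-1 ^+ k.+1)).
    by rewrite lerXn2r ?nnegrE ?normr_ge0 ?invr_ge0.
  have -> : 4^-1 = 2^-1 * 2^-1 :> R by field.
  rewrite exprMn ler_wpM2r ?exprn_ge0 ?invr_ge0 // exprS.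
  by rewrite ler_piMr ?invr_ge0 // exprn_ile1 ?invr_ge0 // invf_le1 ?ler1n ?ltr0n.
have GR : G t%:C = (complex.Re (G t%:C))%:C.
  case: (G t%:C) Greal => a b [] /eqP; rewrite eqNr => /eqP -> //.
set g := complex.Re _ in GR.
have g0 : 0 <= g.
  move: G1; rewrite GR -(rmorph1 (real_complex R)) -rmorphB normc_real ler_norml => /andP[+ _].
  lra.
rewrite GR; congr (_ %:C); have := sqG _ ht2; rewrite GR -rmorphXn.
rewrite -(rmorph1 (real_complex R)) -rmorphD => /complexI <-.
by rewrite sqrtr_sqr ger0_norm.
Qed.

Lemma geometric_series : exists G : C -> C,
  (forall w, normc w <= 2^-1 -> has_sum (fun k => (-1) ^+ k * w ^+ k) (G w)) /\
  (forall w, normc w <= 2^-1 -> G w * (1 + w) = 1).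
Proof.
have bnd (w : C) : normc w <= 2^-1 -> sum_bounded (fun k => (-1) ^+ k * w ^+ k) (1 - 2^-1)^-1.
  move=> hw; have := @sum_bounded_geometric 2^-1; rewrite invr_ge0 ler0n => /(_ isT).
  rewrite invf_lt1 ?ltr1n // => /(_ isT); apply: sum_bounded_dom => k.
  rewrite normcM !normcX (normcN' 1) normc1 expr1n mul1r normc_real.
  by rewrite ger0_norm ?exprn_ge0 ?invr_ge0 // lerXn2r ?nnegrE ?normc_ge0 ?invr_ge0.
have ex (w : C) : exists l, normc w <= 2^-1 -> has_sum (fun k => (-1) ^+ k * w ^+ k) l.
  case: (pselect (normc w <= 2^-1)) => hw; last by exists 0.
  by have [l hl] := sum_bounded_has_sum (bnd w hw); exists l.
have [G hG] := choice ex; exists G; split=> // w hw.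
have h1 : has_sum (fun k => if k == 0%N then 1 else 0) (1 : C).
  have := @has_sum_finite _ _ (fun k => if k == 0%N then 1 else 0 : C) [fset 0%N].
  by rewrite big_seq_fset1; apply => k; rewrite inE => /negbTE ->.
(* Multiplication by [- w] shifts the series by one place. *)
have h2 : has_sum (fun k => if k == 0%N then 0 else (-1) ^+ k * w ^+ k) (- w * G w).
  apply/(@has_sum_reindex _ _ _ succn) => [i j []//|[|k] h //|].
    by case: (h k).
  apply: eq_has_sum (has_sumZ (- w) (hG w hw)) => k /=.
  by rewrite !exprS; ring.
have : G w = 1 + - w * G w.
  apply: has_sum_unique (hG w hw) _; apply: eq_has_sum (has_sumD h1 h2) => -[|k] /=.
    by rewrite !expr0 mulr1 addr0.
  by rewrite add0r.
by move=> h; rewrite mulrDr mulr1 {1}h; ring.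
Qed.

End SquareRoot.

(** * Algebraic elements over polynomial rings *)

(** Reduces the identities between substitutions and evaluations below to constants and
    variables. *)
Lemma mpoly_rmorph_eq (n : nat) (K S : comNzRingType)
    (f g : {rmorphism mpoly.mpoly n K -> S}) :
  (forall c, f (mpoly.mpolyC n c) = g (mpoly.mpolyC n c)) ->
  (forall i, f (mpolyvar K i) = g (mpolyvar K i)) -> f =1 g.
Proof.
move=> hC hX p; rewrite (mpoly.mpolyE p) !rmorph_sum; apply: eq_bigr => m _.
rewrite -mpoly.mul_mpolyC !rmorphM hC mpoly.mpolyXE_id !rmorph_prod.
by congr (_ * _); apply: eq_bigr => i _; rewrite !rmorphXn hX.
Qed.

Lemma poly_nat_nonroot (F : numDomainType) (p : {poly F}) : p != 0 ->
  exists k : nat, p.[k%:R] != 0.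
Proof.
move=> p0; apply: contrapT => /forallNP h.
pose rs := [seq k%:R : F | k <- iota 0 (size p)].
have := @max_poly_roots _ p rs p0; rewrite size_map size_iota ltnn => H.
suff : false by []; apply: H.
  apply/allP => _ /mapP [k _ ->]; apply/rootP/eqP.
  by apply/negPn/negP; exact: h.
by rewrite map_inj_uniq ?iota_uniq //; exact: mulrIn (oner_neq0 _).
Qed.

(** The product of [P] with its conjugate under X -> -X is even: it is the norm of [P] for the
    quadratic extension generated by a square root of the variable. It serves to eliminate square
    roots. *)
Lemma even_odd_norm (D : comNzRingType) (P : {poly D}) :
  (even_poly P ^+ 2 - 'X * odd_poly P ^+ 2) \Po 'X^2 = P * (P \Po - 'X).
Proof.
have := poly_even_odd P; move: (even_poly P) (odd_poly P) => E O <-.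
have XX : 'X^2 \Po - 'X = 'X^2 :> {poly D}.
  by rewrite !expr2 comp_polyM comp_polyX mulrNN.
have YE := expr2 ('X : {poly D}).
move: 'X^2 XX YE => Y XX YE; rewrite !expr2 comp_polyB !comp_polyM comp_polyX.
rewrite comp_polyD comp_polyM comp_polyX -!comp_polyA XX.
by move: (E \Po Y) (O \Po Y) => E' O'; rewrite YE; ring.
Qed.

Section Evaluation.
Variables (K : fieldType) (n : nat).
Implicit Types (P Q : {poly mpoly.mpoly n K}) (x : 'I_n -> K).

Definition pev x P (t : K) : K := (map_poly (mpoly.meval x) P).[t].

Definition pev_rmorph x t : {rmorphism {poly mpoly.mpoly n K} -> K} :=
  horner_eval t \o map_poly (mpoly.meval x).

Lemma pevE x P t : pev x P t = pev_rmorph x t P. Proof. by []. Qed.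

(** The resultant of P(X + Y) and Q(Y) with respect to Y. It lies in the ideal they generate, hence
    vanishes at every [x], even where leading coefficients degenerate. If [P] or [Q] has degree 0 in
    the last variable, its vanishing depends on [x] alone and it serves itself as [N]. *)
Lemma pev_sub P Q : P != 0 -> Q != 0 -> exists2 N, N != 0 &
  forall x u v, pev x P u = 0 -> pev x Q v = 0 -> pev x N (u - v) = 0.
Proof.
move=> P0 Q0; case: (leqP (size P) 1) => [sP|sP].
  exists P => // x u v; rewrite /pev (size1_polyC sP) map_polyC !hornerC //.
case: (leqP (size Q) 1) => [sQ|sQ].
  exists Q => // x u v _; rewrite /pev (size1_polyC sQ) map_polyC !hornerC //.
exists (polyXY.sub_annihilant P Q); first exact: polyXY.sub_annihilant_neq0.
move=> x u v hP hQ.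
have sP' : (1 < size (polyXY.poly_XaY P))%N by rewrite polyXY.size_poly_XaY.
have sQ' : (1 < size (map_poly polyC Q))%N by rewrite size_map_polyC.
have [uv _ Dr] := resultant_in_ideal sP' sQ'.
(* [chi] specializes X to [u - v]; with Y = [v] the sum X + Y becomes [u]. *)
pose chi : {rmorphism {poly mpoly.mpoly n K} -> K} :=
  horner_eval (u - v) \o map_poly (mpoly.meval x).
have chiC : chi \o polyC =1 mpoly.meval x.
  by move=> c; rewrite /chi /= map_polyC /horner_eval hornerC.
have -> : pev x (polyXY.sub_annihilant P Q) (u - v) =
  (map_poly chi (uv.1 * polyXY.poly_XaY P + uv.2 * map_poly polyC Q)).[v].
  by rewrite -Dr map_polyC hornerC.
rewrite rmorphD !rmorphM /= hornerD !hornerM.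
rewrite /polyXY.poly_XaY map_comp_poly horner_comp rmorphD /= map_polyX map_polyC /=.
rewrite -!map_poly_comp !(eq_map_poly chiC) !hornerE.
rewrite [horner_eval _ (map_poly _ 'X)]/horner_eval map_polyX hornerX.
have -> : v + (u - v) = u by ring.
by move: hP hQ; rewrite /pev => -> ->; rewrite !mulr0 addr0.
Qed.

Lemma pev_comp x P Q t : pev x (P \Po Q) t = pev x P (pev x Q t).
Proof. by rewrite /pev map_comp_poly horner_comp. Qed.

Lemma pevM x P Q t : pev x (P * Q) t = pev x P t * pev x Q t.
Proof. by rewrite /pev rmorphM hornerM. Qed.

Lemma pevX x t : pev x 'X t = t.
Proof. by rewrite /pev map_polyX hornerX. Qed.

Lemma pevC x c t : pev x c%:P t = mpoly.meval x c.
Proof. by rewrite /pev map_polyC hornerC. Qed.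

Lemma pev_scale P c : P != 0 -> exists2 N, N != 0 &
  forall x u, pev x P u = 0 -> pev x N (c * u) = 0.
Proof.
move=> P0; have [->|c0] := eqVneq c 0.
  exists 'X; first by rewrite polyX_eq0.
  by move=> x u _; rewrite mul0r pevX.
have cm0 : mpoly.mpolyC n c^-1 != 0 by rewrite mpoly.mpolyC_eq0 invr_eq0.
exists (P \Po ((mpoly.mpolyC n c^-1)%:P * 'X)).
  by rewrite comp_poly2_eq0 // size_Cmul // size_polyX.
move=> x u hP; rewrite pev_comp pevM pevC pevX mpoly.mevalC mulrA mulVf // mul1r.
exact: hP.
Qed.

Lemma pev_sqr P : P != 0 -> exists2 N, N != 0 &
  forall x u, pev x P u = 0 -> pev x N (u ^+ 2) = 0.
Proof.
move=> P0; pose N := even_poly P ^+ 2 - 'X * odd_poly P ^+ 2.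
have NE : N \Po 'X^2 = P * (P \Po - 'X) by exact: even_odd_norm.
exists N.
  apply: contraNneq P0 => N0; move/eqP: NE; rewrite N0 comp_poly0 eq_sym mulf_eq0.
  by rewrite comp_poly2_eq0 ?orbb // size_polyN size_polyX.
move=> x u hP; have -> : u ^+ 2 = pev x 'X^2 u.
  by rewrite /pev map_polyXn hornerXn.
by rewrite -pev_comp NE pevM hP mul0r.
Qed.

End Evaluation.

Section NumEvaluation.
Variables (K : numFieldType) (n : nat).
Implicit Types (P Q : {poly mpoly.mpoly n K}) (x : 'I_n -> K).

Lemma pev_add P Q : P != 0 -> Q != 0 -> exists2 N, N != 0 &
  forall x u v, pev x P u = 0 -> pev x Q v = 0 -> pev x N (u + v) = 0.
Proof.
move=> P0 /(pev_scale (-1)) [Q' Q'0 hQ'].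
have [N N0 hN] := pev_sub P0 Q'0; exists N => // x u v hu /hQ' hv.
by have := hN _ _ _ hu hv; rewrite mulN1r opprK.
Qed.

(** Polarization: 4 u v = (u + v)^2 - (u - v)^2. *)
Lemma pev_mul P Q : P != 0 -> Q != 0 -> exists2 N, N != 0 &
  forall x u v, pev x P u = 0 -> pev x Q v = 0 -> pev x N (u * v) = 0.
Proof.
move=> P0 Q0; have [A A0 hA] := pev_add P0 Q0; have [B B0 hB] := pev_sub P0 Q0.
have [A2 A20 hA2] := pev_sqr A0; have [B2 B20 hB2] := pev_sqr B0.
have [D D0 hD] := pev_sub A20 B20; have [N N0 hN] := pev_scale (4^-1) D0.
exists N => // x u v hu hv; have := hN _ _ (hD _ _ _ (hA2 _ _ (hA _ _ _ hu hv)) (hB2 _ _ (hB _ _ _ hu hv))).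
by congr (pev _ _ _ = 0); field.
Qed.

(** Elimination of a square root [b] of [s]: [N] is the norm H(b) H(-b), which involves only b^2 =
    s. The point [x0], [b0], [t0] certifies that [N] is non-zero. *)
Lemma pev_quadratic (H : {poly {poly mpoly.mpoly n K}}) (s : mpoly.mpoly n K) x0 b0 t0 :
  b0 ^+ 2 = mpoly.meval x0 s ->
  (map_poly (fun P => pev x0 P t0) H).[b0] != 0 ->
  (map_poly (fun P => pev x0 P t0) H).[- b0] != 0 ->
  exists2 N, N != 0 & forall x b t, b ^+ 2 = mpoly.meval x s ->
    (map_poly (fun P => pev x P t) H).[b] = 0 -> pev x N t = 0.
Proof.
move=> hb h1 h2; pose N := (even_poly H).[s%:P] ^+ 2 - s%:P * (odd_poly H).[s%:P] ^+ 2.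
have NE x t b : b ^+ 2 = mpoly.meval x s ->
    pev x N t = (map_poly (fun P => pev x P t) H).[b] *
                (map_poly (fun P => pev x P t) H).[- b].
  move=> hb'; have HE c : (map_poly (fun P => pev x P t) H).[c] =
      (map_poly (pev_rmorph x t) (even_poly H)).[c ^+ 2] +
      (map_poly (pev_rmorph x t) (odd_poly H)).[c ^+ 2] * c.
    rewrite (eq_map_poly (pevE x ^~ t)) -{1}(poly_even_odd H) rmorphD rmorphM.
    by rewrite /= !map_comp_poly map_polyXn map_polyX hornerD hornerM !horner_comp hornerXn hornerX.
  have evs : pev_rmorph x t s%:P = mpoly.meval x s by rewrite -pevE pevC.
  rewrite !HE sqrrN hb' pevE /N rmorphB (rmorphM _ s%:P) !rmorphXn -!horner_map evs -hb'.
  by move: (horner _ _) (horner _ _) => ? ?; ring.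
exists N => [|x b t hx h].
  by apply: contraNneq (mulf_neq0 h1 h2) => N0; rewrite -(NE _ _ _ hb) N0 /pev map_poly0 horner0.
by rewrite (NE _ _ _ hx) h mul0r.
Qed.

End NumEvaluation.

(** * Polynomials in n + 1 variables as univariate polynomials over n variables *)

Section MpolySucc.
Variables (K : fieldType) (n : nat).

Definition mpoly_widen : {rmorphism mpoly.mpoly n K -> mpoly.mpoly (n + 1) K} :=
  mpoly.mmap (@mpoly.mpolyC (n + 1) K) (fun i => mpolyvar K (lshift 1 i)).

Lemma mpoly_widenC c : mpoly_widen (mpoly.mpolyC n c) = mpoly.mpolyC (n + 1) c.
Proof. exact: mpoly.mmapC. Qed.

Lemma mpoly_widenX i : mpoly_widen (mpolyvar K i) = mpolyvar K (lshift 1 i).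
Proof. by rewrite /mpoly_widen /= mpoly.mmapX mpoly.mmap1U. Qed.

Definition mpoly_of_poly (P : {poly mpoly.mpoly n K}) : mpoly.mpoly (n + 1) K :=
  (map_poly mpoly_widen P).[mpolyvar K (rshift n (ord0 : 'I_1))].

Definition poly_of_mpoly : {rmorphism mpoly.mpoly (n + 1) K -> {poly mpoly.mpoly n K}} :=
  mpoly.mmap (polyC \o @mpoly.mpolyC n K)
    (fun i => match fintype.split i with inl j => (mpolyvar K j)%:P | inr _ => 'X end).

Lemma poly_of_mpolyC c : poly_of_mpoly (mpoly.mpolyC (n + 1) c) = (mpoly.mpolyC n c)%:P.
Proof. exact: mpoly.mmapC. Qed.

Lemma poly_of_mpolyX i : poly_of_mpoly (mpolyvar K i) =
  match fintype.split i with inl j => (mpolyvar K j)%:P | inr _ => 'X end.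
Proof. by rewrite /poly_of_mpoly /= mpoly.mmapX mpoly.mmap1U. Qed.

Lemma split_lshift (i : 'I_n) : fintype.split (lshift 1 i) = inl i.
Proof. exact: (unsplitK (inl i)). Qed.

Lemma split_rshift (i : 'I_1) : fintype.split (rshift n i) = inr i.
Proof. exact: (unsplitK (inr i)). Qed.

Lemma mpoly_of_polyK P : poly_of_mpoly (mpoly_of_poly P) = P.
Proof.
rewrite /mpoly_of_poly -horner_map -map_poly_comp poly_of_mpolyX split_rshift.
have -> : map_poly (poly_of_mpoly \o mpoly_widen) P = map_poly polyC P.
  apply: eq_map_poly.
  apply: (@mpoly_rmorph_eq _ _ _ (poly_of_mpoly \o mpoly_widen) polyC) => [c|i].
    by rewrite [LHS](_ : _ = poly_of_mpoly (mpoly_widen (mpoly.mpolyC n c))) // mpoly_widenC poly_of_mpolyC.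
  rewrite [LHS](_ : _ = poly_of_mpoly (mpoly_widen (mpolyvar K i))) //.
  by rewrite mpoly_widenX poly_of_mpolyX split_lshift.
exact: comp_polyXr.
Qed.

Lemma poly_of_mpolyK p : mpoly_of_poly (poly_of_mpoly p) = p.
Proof.
set t := mpolyvar K (rshift n (ord0 : 'I_1)).
pose f : {rmorphism {poly mpoly.mpoly n K} -> mpoly.mpoly (n + 1) K} :=
  horner_eval t \o map_poly mpoly_widen.
apply: (@mpoly_rmorph_eq _ _ _ (f \o poly_of_mpoly) idfun) => [c|i].
  rewrite [LHS](_ : _ = mpoly_of_poly (poly_of_mpoly (mpoly.mpolyC (n + 1) c))) //.
  by rewrite poly_of_mpolyC /mpoly_of_poly map_polyC hornerC; exact: mpoly_widenC.
rewrite [LHS](_ : _ = mpoly_of_poly (poly_of_mpoly (mpolyvar K i))) //.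
rewrite poly_of_mpolyX /mpoly_of_poly /=; case: splitP => j ij.
  rewrite map_polyC hornerC; apply: etrans (mpoly_widenX j) _.
  by congr (mpoly.mpolyX _ (mpoly.mnm1 _)); apply: val_inj; rewrite /= ij.
rewrite map_polyX hornerX; congr (mpoly.mpolyX _ (mpoly.mnm1 _)).
by apply: val_inj; rewrite /= ij (ord1 j).
Qed.

Lemma meval_mpoly_of_poly (x : 'rV[K]_n) t P :
  mpoly.meval (fun i => row_mx x t%:M 0 i) (mpoly_of_poly P) = pev (x 0) P t.
Proof.
rewrite /mpoly_of_poly /pev; set v := fun i => _.
have hX : mpoly.meval v (mpolyvar K (rshift n (ord0 : 'I_1))) = t.
  by rewrite mpoly.mevalXU /v row_mxEr mxE eqxx.
rewrite -horner_map -map_poly_comp [X in _.[X]]hX; congr _.[_]; apply: eq_map_poly.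
apply: (@mpoly_rmorph_eq _ _ _ (mpoly.meval v \o mpoly_widen) (mpoly.meval (x 0))) => [c|i].
  rewrite [LHS](_ : _ = mpoly.meval v (mpoly_widen (mpoly.mpolyC n c))) //.
  by rewrite mpoly_widenC mpoly.mevalC; exact/esym/mpoly.mevalC.
rewrite [LHS](_ : _ = mpoly.meval v (mpoly_widen (mpolyvar K i))) //.
rewrite mpoly_widenX mpoly.mevalXU /v row_mxEl; exact/esym/mpoly.mevalXU.
Qed.

Lemma mpoly_of_poly_eq0 P : (mpoly_of_poly P == 0) = (P == 0).
Proof.
apply/eqP/eqP => [h|->]; last by rewrite /mpoly_of_poly map_poly0 horner0.
by rewrite -(mpoly_of_polyK P) h rmorph0.
Qed.

End MpolySucc.

(** * Complex polynomials at real points and along lines *)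

Section ComplexEvaluation.
Variables (R : realType) (n : nat).
Local Notation C := (R[i]).

(** A polynomial is a power series on the unit polydisc, and [ps_real_eq0] recovers its coefficients
    from real points. *)
Lemma mpoly_real_nonzero (p : mpoly.mpoly n C) : p != 0 ->
  exists x : 'I_n -> R, mpoly.meval (fun i => (x i)%:C) p != 0.
Proof.
move=> p0; apply: contrapT => /forallNP h.
have h0 x : mpoly.meval (fun i => (x i)%:C) p = 0.
  by apply/eqP/negPn/negP; exact: h.
pose toM (m : {ffun 'I_n -> nat}) := mpoly.Multinom [tuple m i | i < n].
pose ofM (m : mpoly.multinom n) : {ffun 'I_n -> nat} := [ffun i => m i].
have toMK m : toM (ofM m) = m.
  by apply/mpoly.mnmP => i; rewrite mpoly.mnmE ffunE.
have ofMK m : ofM (toM m) = m.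
  by apply/ffunP => i; rewrite ffunE mpoly.mnmE.
pose c m := mpoly.mcoeff (toM m) p.
have hs y : has_sum (fun m => c m * mono y m) (mpoly.meval y p).
  have -> : mpoly.meval y p = \sum_(m <- (ofM @` [fset m in mpoly.msupp p])%fset) c m * mono y m.
    rewrite big_imfset /=; last by move=> m m' _ _ /(congr1 toM); rewrite !toMK.
    rewrite mpoly.mevalE.
    have -> : \sum_(m <- mpoly.msupp p) mpoly.mcoeff m p * \prod_i y i ^+ m i =
      \sum_(m <- mpoly.msupp p) c (ofM m) * mono y (ofM m).
      apply: eq_bigr => m _; rewrite /c toMK; congr (_ * _).
      by apply: eq_bigr => i _; rewrite ffunE.
    apply: perm_big; apply: uniq_perm => [||m]; rewrite ?mpoly.msupp_uniq ?fset_uniq //.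
    by rewrite !inE.
  apply: has_sum_finite => m hm; rewrite /c.
  suff -> : mpoly.mcoeff (toM m) p = 0 by rewrite mul0r.
  apply: mpoly.memN_msupp_eq0; apply: contra hm => hm.
  by rewrite -(ofMK m) in_imfset //= !inE.
have [B hB] := has_sum_sum_bounded (hs (fun=> 1)).
have hc : ps_coef c 1 B (fun y => mpoly.meval y p).
  split=> [|y _]; last exact: hs.
  apply: sum_bounded_dom hB => m; rewrite expr1n rmorph1 !mulr1.
  by rewrite /mono big1 ?mulr1 // => i _; rewrite expr1n.
have c0 := ps_real_eq0 ltr01 ltr01 hc (fun y _ => h0 y).
move/eqP: p0; apply; apply/mpoly.mpolyP => m.
by rewrite mpoly.mcoeff0 -(toMK m) -/(c _) c0.
Qed.

Lemma pev_real_nonzero (P : {poly mpoly.mpoly n C}) : P != 0 ->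
  exists x : 'I_n -> R, exists t, pev (fun i => (x i)%:C) P t != 0.
Proof.
rewrite -lead_coef_eq0 => /mpoly_real_nonzero [x hx]; exists x.
have : map_poly (mpoly.meval (fun i => (x i)%:C)) P != 0.
  apply: contraNneq hx => h; have := congr1 (fun p : {poly C} => p`_(size P).-1) h.
  by rewrite coef_map coef0 => /eqP.
by move=> /poly_nat_nonroot [k hk]; exists k%:R.
Qed.

Lemma pev_conj (P : {poly mpoly.mpoly n C}) : P != 0 ->
  exists2 N, N != 0 & forall x t, pev x P t = 0 ->
    pev (fun i => conjc (x i)) N (conjc t) = 0.
Proof.
move=> P0; exists (map_poly (mpoly.map_mpoly (@conjc R)) P).
  apply: contraNneq P0 => h; apply/eqP/polyP => k; apply/mpoly.mpolyP => m.
  have := congr1 (fun p : {poly mpoly.mpoly n C} => mpoly.mcoeff m p`_k) h.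
  rewrite coef_map !coef0 mpoly.mcoeff_map_mpoly mpoly.mcoeff0.
  by move/eqP; rewrite conjc_eq0 => /eqP.
move=> x t h; have -> : pev (fun i => conjc (x i)) (map_poly (mpoly.map_mpoly (@conjc R)) P)
    (conjc t) = conjc (pev x P t).
  rewrite /pev -horner_map -!map_poly_comp; congr _.[_].
  apply: eq_map_poly.
  apply: (@mpoly_rmorph_eq _ _ _ (mpoly.meval (fun i => conjc (x i)) \o mpoly.map_mpoly (@conjc R))
    (@conjc R \o mpoly.meval x)) => [c|i] /=.
    by rewrite mpoly.map_mpolyC /= !mpoly.mevalC.
  by rewrite mpoly.map_mpolyX !mpoly.mevalXU.
by rewrite h conjc0.
Qed.

(** Splitting the coefficients gives p = q1 + i q2 with real polynomials. At a real zero of [p] both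
    vanish, and at least one of them is non-zero as a polynomial. *)
Lemma real_part_mpoly (m : nat) (p : mpoly.mpoly m C) : p != 0 ->
  exists2 q : mpoly.mpoly m R, q != 0 & forall v : 'I_m -> R,
    mpoly.meval (fun i => (v i)%:C) p = 0 -> mpoly.meval v q = 0.
Proof.
move=> p0.
have key (f : {additive C -> R}) : (forall c x, f (c * x%:C) = f c * x) ->
    forall v : 'I_m -> R, mpoly.meval (fun i => (v i)%:C) p = 0 ->
    mpoly.meval v (mpoly.map_mpoly f p) = 0.
  move=> hf v hv.
  have -> : mpoly.map_mpoly f p =
      \sum_(k <- mpoly.msupp p) f (mpoly.mcoeff k p) *: mpoly.mpolyX R k.
    rewrite {1}(mpoly.mpolyE p) raddf_sum; apply: eq_bigr => k _.
    apply/mpoly.mpolyP => j; rewrite mpoly.mcoeff_map_mpoly !mpoly.mcoeffZ !mpoly.mcoeffX.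
    by rewrite -hf rmorph_nat.
  have -> : 0 = f (mpoly.meval (fun i => (v i)%:C) p) by rewrite hv raddf0.
  rewrite [in RHS]mpoly.mevalE !raddf_sum; apply: eq_bigr => k _.
  rewrite /= mpoly.mevalZ mpoly.mevalX -hf rmorph_prod.
  by congr (f (_ * _)); apply: eq_bigr => i _; rewrite rmorphXn.
have [h|h] := eqVneq (mpoly.map_mpoly (@complex.Re R) p) 0; last first.
  by exists (mpoly.map_mpoly (@complex.Re R) p) => //; apply: key => -[a b] x /=; rewrite mulr0 subr0.
exists (mpoly.map_mpoly (@complex.Im R) p); last first.
  by apply: key => -[a b] x /=; rewrite mulr0 add0r.
apply: contraNneq p0 => h'; apply/eqP/mpoly.mpolyP => k.
have := congr1 (mpoly.mcoeff k) h; have := congr1 (mpoly.mcoeff k) h'.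
rewrite !mpoly.mcoeff_map_mpoly !mpoly.mcoeff0.
by case: (mpoly.mcoeff k p) => a b /= -> ->.
Qed.

(* Restriction to the line a + C e_{i0}: the polynomial is first divided by the
   largest possible power of a parameter transverse to the line. *)
Lemma pev_line (P : {poly mpoly.mpoly n C}) (a : 'I_n -> C) (i0 : 'I_n) : P != 0 ->
  (forall i, complex.Im (a i) = 0) ->
  exists (w : 'I_n -> R) (k : nat) (q : {poly {poly {poly C}}}), q.[0] != 0 /\
   forall al tau t,
    pev (fun i => a i + (i == i0)%:R * al + tau * (w i)%:C) P t =
    tau ^+ k * q.[tau%:P%:P].[t%:P].[al].
Proof.
move=> P0 ha; have [x [t0 hx]] := pev_real_nonzero P0.
(* The direction from [a] to a point where [P] does not vanish: the parameters al = 0 and tau = 1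
   reach that point, whence [T != 0] below. *)
pose w i := x i - complex.Re (a i).
(* Three nested variables: tau is the outermost, t the middle one, al the innermost. *)
pose Th : mpoly.mpoly n C -> {poly {poly {poly C}}} :=
  mpoly.mmap (polyC \o polyC \o @polyC C)
    (fun i => (a i)%:P%:P%:P + ((i == i0)%:R * 'X)%:P%:P + 'X * ((w i)%:C)%:P%:P%:P).
pose T := (map_poly Th P).['X%:P].
pose ev al tau t (W : {poly {poly {poly C}}}) := W.[tau%:P%:P].[t%:P].[al].
have evE al tau t : ev al tau t =
  (horner_eval al \o (horner_eval t%:P \o horner_eval tau%:P%:P)) by [].
have TE al tau t : ev al tau t T =
    pev (fun i => a i + (i == i0)%:R * al + tau * (w i)%:C) P t.
  rewrite evE /T -horner_map -map_poly_comp /pev /=.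
  have -> : (horner_eval al (horner_eval t%:P (horner_eval tau%:P%:P 'X%:P))) = t.
    by rewrite /horner_eval hornerC hornerX hornerC.
  congr _.[_]; apply: eq_map_poly.
  apply: (@mpoly_rmorph_eq _ _ _ ((horner_eval al \o (horner_eval t%:P \o horner_eval tau%:P%:P)) \o Th)
      (mpoly.meval _)) => [c|i] /=.
    by rewrite /Th mpoly.mmapC /= /horner_eval !hornerC mpoly.mevalC.
  rewrite /Th mpoly.mmapX mpoly.mmap1U mpoly.mevalXU /horner_eval.
  rewrite !(hornerD, hornerC, hornerM, hornerX).
  by rewrite -polyC_natr hornerC.
have T0 : T != 0.
  have xE : (fun i => (x i)%:C) = (fun i => a i + (i == i0)%:R * 0 + 1 * (w i)%:C).
    apply/funext => i; rewrite mulr0 addr0 mul1r /w rmorphB /=.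
    have -> : a i = (complex.Re (a i))%:C by case: (a i) (ha i) => ? ? /= ->.
    by rewrite addrC subrK.
  by apply: contraNneq hx => T0; rewrite xE -TE T0 /ev !horner0.
have [k [q]] := multiplicity_XsubC T 0; rewrite T0 subr0 /root /= => q0 Tq.
exists w, k, q; split=> // al tau t; rewrite -TE Tq /ev.
rewrite hornerM hornerXn hornerM hornerM mulrC; congr (_ * _).
by rewrite -!rmorphXn !hornerC.
Qed.

End ComplexEvaluation.

(** * The Cayley-Dickson construction *)

Section CayleyDicksonTheory.
Variable R : realType.

(** Index of the coordinate of 1. It follows the recursion of [cd_dim], whose value is not visibly a
    successor for a variable [n]. *)
Definition cd_zero_ord (n : nat) : 'I_(cd_dim n).
Proof.
elim: n => [|n IH]; first exact: ord0.
exact: (lshift _ IH).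
Defined.

Definition cd_one (n : nat) : 'rV[R]_(cd_dim n) := delta_mx 0 (cd_zero_ord n).
Definition cd_re (n : nat) (x : 'rV[R]_(cd_dim n)) : R := x 0 (cd_zero_ord n).
Definition cd_norm2 (n : nat) (x : 'rV[R]_(cd_dim n)) : R := \sum_i x 0 i ^+ 2.

Local Notation M := (@cd_mul R _).
Local Notation J := (@cd_conj R _).

Lemma lsubmxD m n (x y : 'rV[R]_(m + n)) : lsubmx (x + y) = lsubmx x + lsubmx y.
Proof. by apply/matrixP => i j; rewrite !mxE. Qed.
Lemma rsubmxD m n (x y : 'rV[R]_(m + n)) : rsubmx (x + y) = rsubmx x + rsubmx y.
Proof. by apply/matrixP => i j; rewrite !mxE. Qed.
Lemma lsubmxZ m n a (x : 'rV[R]_(m + n)) : lsubmx (a *: x) = a *: lsubmx x.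
Proof. by apply/matrixP => i j; rewrite !mxE. Qed.
Lemma rsubmxZ m n a (x : 'rV[R]_(m + n)) : rsubmx (a *: x) = a *: rsubmx x.
Proof. by apply/matrixP => i j; rewrite !mxE. Qed.

Lemma cd_conjD n (x y : 'rV[R]_(cd_dim n)) : J (x + y) = J x + J y.
Proof.
elim: n x y => [//|n IH] x y /=.
by rewrite lsubmxD rsubmxD IH opprD add_row_mx.
Qed.

Lemma cd_conjZ n a (x : 'rV[R]_(cd_dim n)) : J (a *: x) = a *: J x.
Proof.
elim: n x => [//|n IH] x /=.
by rewrite lsubmxZ rsubmxZ IH -scalerN scale_row_mx.
Qed.

(** Mutual induction: in [d a] and [d^c b] the doubling formula puts the left argument on the right,
    so that additivity on one side calls for the other side one level below. *)
Lemma cd_mulDl n (x y z : 'rV[R]_(cd_dim n)) : M (x + y) z = M x z + M y z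
with cd_mulDr n (x y z : 'rV[R]_(cd_dim n)) : M z (x + y) = M z x + M z y.
Proof.
- case: n x y z => [|n] x y z /=; first by rewrite mxE scalerDl.
  rewrite !lsubmxD !rsubmxD !cd_mulDr !cd_mulDl add_row_mx.
  by congr row_mx; [rewrite opprD addrACA | rewrite addrACA].
- case: n x y z => [|n] x y z /=; first by rewrite scalerDr.
  rewrite !lsubmxD !rsubmxD !cd_conjD !cd_mulDr !cd_mulDl add_row_mx.
  by congr row_mx; [rewrite opprD addrACA | rewrite addrACA].
Qed.

Lemma cd_mulZl n a (x z : 'rV[R]_(cd_dim n)) : M (a *: x) z = a *: M x z
with cd_mulZr n a (x z : 'rV[R]_(cd_dim n)) : M z (a *: x) = a *: M z x.
Proof.
- case: n x z => [|n] x z /=; first by rewrite mxE scalerA.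
  by rewrite !lsubmxZ !rsubmxZ !cd_mulZr !cd_mulZl -scalerBr -scalerDr scale_row_mx.
- case: n x z => [|n] x z /=; first by rewrite !scalerA mulrC.
  by rewrite !lsubmxZ !rsubmxZ !cd_conjZ !cd_mulZr !cd_mulZl -scalerBr -scalerDr scale_row_mx.
Qed.

Lemma cd_mulNl n (x z : 'rV[R]_(cd_dim n)) : M (- x) z = - M x z.
Proof. by rewrite -scaleN1r cd_mulZl scaleN1r. Qed.
Lemma cd_mulNr n (x z : 'rV[R]_(cd_dim n)) : M z (- x) = - M z x.
Proof. by rewrite -scaleN1r cd_mulZr scaleN1r. Qed.
Lemma cd_mul0l n (z : 'rV[R]_(cd_dim n)) : M 0 z = 0.
Proof. by apply: (addrI (M 0 z)); rewrite -cd_mulDl !addr0. Qed.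
Lemma cd_mul0r n (z : 'rV[R]_(cd_dim n)) : M z 0 = 0.
Proof. by apply: (addrI (M z 0)); rewrite -cd_mulDr !addr0. Qed.

Lemma cd_one_succ n : cd_one n.+1 = row_mx (cd_one n) 0.
Proof.
apply/rowP => i; rewrite !mxE; case: splitP => j ij; rewrite !mxE.
  by rewrite -!(inj_eq val_inj) /=; congr (nat_of_bool (_ == _))%:R.
suff -> : (i == cd_zero_ord n.+1) = false by rewrite andbF.
apply/eqP => /(congr1 val) h; have := ltn_ord (cd_zero_ord n).
by rewrite -[X in (X < _)%N]h [val i]ij ltnNge leq_addr.
Qed.

Lemma cd_conj0 n : J (0 : 'rV[R]_(cd_dim n)) = 0.
Proof. by apply: (addrI (J 0)); rewrite -cd_conjD !addr0. Qed.

Lemma cd_conj1 n : J (cd_one n) = cd_one n.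
Proof.
elim: n => [//|n IH]; rewrite cd_one_succ /= row_mxKl row_mxKr IH oppr0 //.
Qed.

Lemma cd_mul1l n (x : 'rV[R]_(cd_dim n)) : M (cd_one n) x = x
with cd_mul1r n (x : 'rV[R]_(cd_dim n)) : M x (cd_one n) = x.
Proof.
- case: n x => [|n] x; first by rewrite /= mxE eqxx scale1r.
  rewrite cd_one_succ /= row_mxKl row_mxKr cd_mul1l cd_mul1r cd_mul0r cd_mul0l.
  by rewrite subr0 addr0 hsubmxK.
- case: n x => [|n] x.
    by apply/rowP => i; rewrite /= !mxE (ord1 i) eqxx mulr1.
  rewrite cd_one_succ /= row_mxKl row_mxKr cd_conj0 cd_conj1 cd_mul1r cd_mul1r cd_mul0l cd_mul0l.
  by rewrite subr0 add0r hsubmxK.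
Qed.

Lemma cd_re_succ n (x : 'rV[R]_(cd_dim n.+1)) : cd_re x = cd_re (lsubmx x).
Proof. by rewrite /cd_re mxE. Qed.

Lemma cd_norm2_succ n (x : 'rV[R]_(cd_dim n.+1)) :
  cd_norm2 x = cd_norm2 (lsubmx x) + cd_norm2 (rsubmx x).
Proof.
rewrite /cd_norm2 /= big_split_ord /=.
by congr (_ + _); apply: eq_bigr => i _; rewrite mxE.
Qed.

Lemma cd_add_conj n (x : 'rV[R]_(cd_dim n)) : x + J x = (2 * cd_re x) *: cd_one n.
Proof.
elim: n x => [|n IH] x.
  apply/rowP => i; rewrite (ord1 i) !mxE eqxx mulr1 mulr_natl mulr2n.
  by rewrite /cd_re; congr (x _ _ + x _ _); apply: val_inj.
rewrite cd_one_succ scale_row_mx cd_re_succ -IH scaler0 /= -{1}(hsubmxK x) add_row_mx.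
by rewrite subrr.
Qed.

Lemma cd_conj_mul n (x : 'rV[R]_(cd_dim n)) : M (J x) x = cd_norm2 x *: cd_one n.
Proof.
elim: n x => [|n IH] x.
  apply/rowP => i; rewrite (ord1 i) /= !mxE eqxx mulr1 /cd_norm2.
  by rewrite (big_ord_recl 0) big_ord0 addr0 expr2.
rewrite cd_norm2_succ cd_one_succ scale_row_mx scaler0 scalerDl -!IH /=.
rewrite row_mxKl row_mxKr; congr row_mx; first by rewrite cd_mulNr opprK.
by rewrite cd_mulNl subrr.
Qed.

(** Each element is a root of a real quadratic polynomial, at every level: expand the product of
    [x + J x] and [x], whose trace and norm are real. *)
Lemma cd_sqr n (x : 'rV[R]_(cd_dim n)) :
  M x x = (2 * cd_re x) *: x - cd_norm2 x *: cd_one n.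
Proof.
rewrite -cd_conj_mul; apply: (addIr (M (J x) x)).
by rewrite subrK -cd_mulDl cd_add_conj cd_mulZl cd_mul1l.
Qed.

Definition cd_assoc n := forall x y z : 'rV[R]_(cd_dim n), M x (M y z) = M (M x y) z.

Lemma cd_conjK n (x : 'rV[R]_(cd_dim n)) : J (J x) = x.
Proof.
elim: n x => [//|n IH] x /=.
by rewrite row_mxKl row_mxKr IH opprK hsubmxK.
Qed.

Lemma cd_conjN n (x : 'rV[R]_(cd_dim n)) : J (- x) = - J x.
Proof. by rewrite -scaleN1r cd_conjZ scaleN1r. Qed.

Lemma cd_conjM n (x y : 'rV[R]_(cd_dim n)) : J (M x y) = M (J y) (J x).
Proof.
elim: n x y => [|n IH] x y /=.
  by apply/rowP => i; rewrite !mxE (ord1 i) mulrC.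
rewrite !row_mxKl !row_mxKr; congr row_mx.
  by rewrite cd_conjD cd_conjN !IH cd_conjK cd_conjN cd_mulNl cd_mulNr opprK.
by rewrite opprD cd_mulNl cd_mulNl cd_conjK addrC.
Qed.

Lemma cd_comm0 (x y : 'rV[R]_(cd_dim 0)) : M x y = M y x.
Proof. by apply/rowP => i; rewrite /= !mxE (ord1 i) mulrC. Qed.

Lemma cd_assoc0 : cd_assoc 0.
Proof. by move=> x y z; apply/rowP => i; rewrite /= !mxE (ord1 i) mulrA. Qed.

Lemma cd_comm1 (x y : 'rV[R]_(cd_dim 1)) : M x y = M y x.
Proof.
rewrite /cd_mul -/(@cd_mul R 0) /= ; congr row_mx.
  by rewrite -!/(@cd_mul R 0 _ _) (cd_comm0 (lsubmx x)) (cd_comm0 (rsubmx y)).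
by rewrite -!/(@cd_mul R 0 _ _) addrC (cd_comm0 (rsubmx x)) (cd_comm0 (rsubmx y)) (cd_comm0 (lsubmx y)) (cd_comm0 (lsubmx x)).
Qed.

(** Used twice, from the reals to the quaternions. Commutativity one level below sorts the factors
    of each term. *)
Lemma cd_assoc_succ n : cd_assoc n ->
  (forall x y : 'rV[R]_(cd_dim n), M x y = M y x) -> cd_assoc n.+1.
Proof.
move=> A K x y z /=; rewrite !row_mxKl !row_mxKr.
move: (lsubmx x) (rsubmx x) (lsubmx y) (rsubmx y) (lsubmx z) (rsubmx z) => a b c d e f.
congr row_mx; rewrite !(cd_conjD, cd_conjN, cd_conjM, cd_conjK, cd_mulDl, cd_mulDr, cd_mulNl, cd_mulNr).
  move: (J c) (J d) (J f) => c' d' f'.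
  rewrite (A a c e) (K a (M f' d)) -(A f' d a) -(A c' f' b) (K c' (M f' b)) -(A f' b c').
  rewrite -(A e d' b) (K e (M d' b)).
  by rewrite !opprD !addrA [X in _ = X - _]addrAC [RHS]addrAC.
move: (J c) (J d) (J e) => c' d' e'.
rewrite -(A f c a) (K c a) -(A d e' a) (K e' a) (A d a e') (K e' c') (A b c' e').
rewrite (K b (M d' f)) (K d' f) -(A f d' b).
by rewrite !addrA [X in _ = X + _]addrAC [RHS]addrAC.
Qed.

Lemma cd_assoc2 : cd_assoc 2.
Proof. by apply: cd_assoc_succ cd_comm1; apply: cd_assoc_succ cd_comm0; exact: cd_assoc0. Qed.

Lemma cd_norm2J n (x : 'rV[R]_(cd_dim n)) : cd_norm2 (J x) = cd_norm2 x.
Proof.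
elim: n x => [//|n IH] x; rewrite !cd_norm2_succ /= row_mxKl row_mxKr IH; congr (_ + _).
by apply: eq_bigr => i _; rewrite mxE sqrrN.
Qed.

Lemma cd_mul_conj n (x : 'rV[R]_(cd_dim n)) : M x (J x) = cd_norm2 x *: cd_one n.
Proof. by rewrite -{1}(cd_conjK x) cd_conj_mul cd_norm2J. Qed.

(** With associativity one level below, the mixed terms cancel and the others contract to norms. For
    octonions this takes the place of associativity. *)
Lemma cd_conj_mulK n (x y : 'rV[R]_(cd_dim n.+1)) : cd_assoc n ->
  M (J x) (M x y) = cd_norm2 x *: y.
Proof.
move=> A; rewrite cd_norm2_succ -[X in _ = _ *: X](hsubmxK y) scale_row_mx /= !row_mxKl !row_mxKr.
move: (lsubmx x) (rsubmx x) (lsubmx y) (rsubmx y) => a b c d.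
congr row_mx; rewrite !(cd_conjD, cd_conjN, cd_conjM, cd_conjK, cd_mulDl, cd_mulDr, cd_mulNl, cd_mulNr).
  rewrite opprD !opprK (A (J a) (J d)) addrA subrK (A (J a) a) -(A c) !cd_conj_mul.
  by rewrite cd_mulZl cd_mulZr cd_mul1l cd_mul1r scalerDl.
rewrite opprK -(A d) cd_mul_conj cd_mulZr cd_mul1r -(A b) (A b (J b)) cd_mul_conj.
by rewrite cd_mulZl cd_mul1l addrA addrK scalerDl.
Qed.

(** Multiply [M x y] on the left by [x + J x], which is real, and compare with [cd_sqr]. *)
Lemma cd_left_alternative n (x y : 'rV[R]_(cd_dim n.+1)) : cd_assoc n ->
  M x (M x y) = M (M x x) y.
Proof.
move=> A; apply: (addIr (M (J x) (M x y))).
rewrite -cd_mulDl cd_add_conj cd_mulZl cd_mul1l (cd_conj_mulK _ _ A) cd_sqr.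
by rewrite cd_mulDl cd_mulNl !cd_mulZl cd_mul1l subrK.
Qed.

End CayleyDicksonTheory.

Lemma sum_ord4 (V : nmodType) (F : 'I_4 -> V) :
  \sum_i F i = F 0 + F 1 + (F 2 + F 3).
Proof.
rewrite !big_ord_recl big_ord0 addr0 addrA.
have -> : lift ord0 ord0 = 1 :> 'I_4 by apply: val_inj.
have -> : lift ord0 (lift ord0 ord0) = 2 :> 'I_4 by apply: val_inj.
by have -> : lift ord0 (lift ord0 (lift ord0 ord0)) = 3 :> 'I_4 by apply: val_inj.
Qed.

(** * The algebras H and O and their imaginary units *)

Section ImaginaryUnits.
Variable R : realType.
Local Notation M := (@cd_mul R _).
Local Notation J := (@cd_conj R _).

Lemma cd_norm2_scale1 n (a : R) : cd_norm2 (a *: cd_one R n) = a ^+ 2.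
Proof.
rewrite /cd_norm2 (bigD1 (cd_zero_ord n)) //= !mxE !eqxx mulr1 big1 ?addr0 // => i /negbTE h.
by rewrite !mxE h andbF mulr0 expr0n.
Qed.

Lemma cd_sqr_opp1 n (x : 'rV[R]_(cd_dim n)) :
  M x x = - cd_one R n <-> cd_re x = 0 /\ cd_norm2 x = 1.
Proof.
rewrite cd_sqr; split=> [h|[-> ->]]; last by rewrite mulr0 scale0r sub0r scale1r.
have hx : (2 * cd_re x) *: x = (cd_norm2 x - 1) *: cd_one R n.
  by rewrite scalerBl scale1r -h addrC subrK.
have h0 : 2 * cd_re x ^+ 2 = cd_norm2 x - 1.
  have := congr1 (@cd_re R n) hx; rewrite /cd_re !mxE -/(cd_re x) !eqxx mulr1.
  by rewrite expr2 mulrA.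
have [r0|r0] := eqVneq (cd_re x) 0.
  by split=> //; apply/eqP; rewrite -subr_eq0 -h0 r0 expr0n mulr0.
(* If the real part is non-zero, then [x] is a real multiple of 1 and its square is a non-negative
   real: a contradiction. *)
have xE : x = cd_re x *: cd_one R n.
  have r20 : 2 * cd_re x != 0 by rewrite mulf_neq0 // pnatr_eq0.
  apply: (scalerI r20); rewrite hx scalerA -h0; congr (_ *: _); ring.
have := h0; rewrite [X in cd_norm2 X]xE cd_norm2_scale1 => h1.
have : 0 <= cd_re x ^+ 2 by exact: sqr_ge0.
lra.
Qed.

Definition anorm2 n (x : 'rV[R]_n.+1) : R := \sum_i x 0 i ^+ 2.

Lemma aone_H : aone R Quaternions = cd_one R 2.
Proof. by congr delta_mx; apply: val_inj. Qed.

Lemma aone_O : aone R Octonions = cd_one R 3.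
Proof. by congr delta_mx; apply: val_inj. Qed.

Section Algebra.
Variable A : hypercomplex.
Local Notation AA := ('rV[R]_(dA A).+1).
Local Notation "x ** y" := (amul x y) (at level 40, left associativity).
Local Notation one := (aone R A).

Lemma amulDl (x y z : AA) : (x + y) ** z = x ** z + y ** z.
Proof. by case: A x y z => x y z; [exact: (@cd_mulDl R 2)|exact: (@cd_mulDl R 3)]. Qed.

Lemma amulDr (x y z : AA) : z ** (x + y) = z ** x + z ** y.
Proof. by case: A x y z => x y z; [exact: (@cd_mulDr R 2)|exact: (@cd_mulDr R 3)]. Qed.

Lemma amulZl a (x z : AA) : (a *: x) ** z = a *: (x ** z).
Proof. by case: A x z => x z; [exact: (@cd_mulZl R 2)|exact: (@cd_mulZl R 3)]. Qed.

Lemma amulZr a (x z : AA) : z ** (a *: x) = a *: (z ** x).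
Proof. by case: A x z => x z; [exact: (@cd_mulZr R 2)|exact: (@cd_mulZr R 3)]. Qed.

Lemma amul0r (x : AA) : x ** 0 = 0.
Proof. by apply: (addrI (x ** 0)); rewrite -amulDr !addr0. Qed.

Lemma amul0l (x : AA) : 0 ** x = 0.
Proof. by apply: (addrI (0 ** x)); rewrite -amulDl !addr0. Qed.

Lemma amulNr (x z : AA) : z ** (- x) = - (z ** x).
Proof. by rewrite -scaleN1r amulZr scaleN1r. Qed.

Lemma amulNl (x z : AA) : (- x) ** z = - (x ** z).
Proof. by rewrite -scaleN1r amulZl scaleN1r. Qed.

Lemma amul_sumr (I : Type) (r : seq I) (F : I -> AA) (x : AA) :
  x ** (\sum_(i <- r) F i) = \sum_(i <- r) x ** F i.
Proof. by elim: r => [|i r IH]; rewrite ?big_nil ?amul0r // !big_cons amulDr IH. Qed.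

Lemma amul_suml (I : Type) (r : seq I) (F : I -> AA) (x : AA) :
  (\sum_(i <- r) F i) ** x = \sum_(i <- r) F i ** x.
Proof. by elim: r => [|i r IH]; rewrite ?big_nil ?amul0l // !big_cons amulDl IH. Qed.

Lemma amul1l (x : AA) : one ** x = x.
Proof.
by case: A x => x; [rewrite aone_H; exact: (@cd_mul1l R 2)|rewrite aone_O; exact: (@cd_mul1l R 3)].
Qed.

Lemma imag_unitP (I : AA) : @imag_unit R A I <-> I 0 0 = 0 /\ anorm2 I = 1.
Proof.
case: A I => I; rewrite /imag_unit /=; [rewrite aone_H|rewrite aone_O].
  rewrite (@cd_sqr_opp1 2 I) /cd_re /cd_norm2 /anorm2.
  by have -> : cd_zero_ord 2 = 0 by apply: val_inj.
rewrite (@cd_sqr_opp1 3 I) /cd_re /cd_norm2 /anorm2.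
by have -> : cd_zero_ord 3 = 0 by apply: val_inj.
Qed.

(** This instance of associativity survives for the octonions and makes left multiplication by C_I a
    complex vector space structure. *)
Lemma amul_imag_unit (I y : AA) : imag_unit I -> I ** (I ** y) = - y.
Proof.
rewrite /imag_unit /=; move=> h; rewrite -[in RHS](amul1l y) -amulNl -h.
case: A I y {h} => I y.
  exact: (@cd_left_alternative R 1 I y (cd_assoc_succ (@cd_assoc0 R) (@cd_comm0 R))).
exact: (@cd_left_alternative R 2 I y (@cd_assoc2 R)).
Qed.

End Algebra.

(** * An explicit splitting base of H and of O *)

Section StandardBase.

Definition cd_i1 : 'rV[R]_(cd_dim 1) := row_mx 0 (cd_one R 0).
Definition cd_i2 : 'rV[R]_(cd_dim 2) := row_mx cd_i1 0.
Definition cd_i3 : 'rV[R]_(cd_dim 3) := row_mx cd_i2 0.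

Definition cd_phi1 (c : R[i]) : 'rV[R]_(cd_dim 1) :=
  complex.Re c *: cd_one R 1 + complex.Im c *: cd_i1.

Lemma cd_phi1E c : cd_phi1 c = row_mx (complex.Re c *: cd_one R 0) (complex.Im c *: cd_one R 0).
Proof.
by rewrite /cd_phi1 cd_one_succ /cd_i1 !scale_row_mx add_row_mx !scaler0 addr0 add0r.
Qed.

Lemma cd_phi1_inj : injective cd_phi1.
Proof.
move=> [a b] [c d]; rewrite !cd_phi1E /= => /eq_row_mx [h1 h2].
have := congr1 (fun x : 'rV[R]_1 => x 0 0) h1.
have := congr1 (fun x : 'rV[R]_1 => x 0 0) h2.
by rewrite !mxE /= !mulr1 => -> ->.
Qed.

Lemma cd_phi1_surj (x : 'rV[R]_(cd_dim 1)) : exists c, x = cd_phi1 c.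
Proof.
exists ((lsubmx x : 'rV[R]_1) 0 0 +i* (rsubmx x : 'rV[R]_1) 0 0).
rewrite cd_phi1E /= -{1}(hsubmxK x); congr row_mx.
  by apply/rowP => i; rewrite !mxE (ord1 i) eqxx mulr1.
by apply/rowP => i; rewrite !mxE (ord1 i) eqxx mulr1.
Qed.

Lemma cd_conj_phi1 c : J (cd_phi1 c) = cd_phi1 (conjc c).
Proof. by case: c => a b; rewrite !cd_phi1E /= row_mxKl row_mxKr scaleNr. Qed.

Lemma cd_mul_ll n (a c : 'rV[R]_(cd_dim n)) :
  @cd_mul R n.+1 (row_mx a 0) (row_mx c 0) = row_mx (M a c) 0.
Proof. by rewrite /= !row_mxKl !row_mxKr cd_mul0l cd_conj0 cd_mul0l subr0 cd_mul0l addr0. Qed.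

Lemma cd_mul_lr n (a d : 'rV[R]_(cd_dim n)) :
  @cd_mul R n.+1 (row_mx a 0) (row_mx 0 d) = row_mx 0 (M d a).
Proof. by rewrite /= !row_mxKl !row_mxKr cd_mul0r cd_mul0r subrr cd_mul0l addr0. Qed.

Lemma cd_mul_rl n (b c : 'rV[R]_(cd_dim n)) :
  @cd_mul R n.+1 (row_mx 0 b) (row_mx c 0) = row_mx 0 (M b (J c)).
Proof. by rewrite /= !row_mxKl !row_mxKr cd_mul0l cd_conj0 cd_mul0l subrr cd_mul0l add0r. Qed.

Definition cd_l n (x : 'rV[R]_(cd_dim n)) : 'rV[R]_(cd_dim n.+1) := row_mx x 0.
Definition cd_r n (x : 'rV[R]_(cd_dim n)) : 'rV[R]_(cd_dim n.+1) := row_mx 0 x.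

Definition std_I (A : hypercomplex) : 'rV[R]_(dA A).+1 :=
  match A with Quaternions => cd_i2 | Octonions => cd_i3 end.

(** One generator for each piece of the iterated doubling, every piece being a copy of C. *)
Definition std_J (A : hypercomplex) : 'I_(uA A).+1 -> 'rV[R]_(dA A).+1 :=
  match A with
  | Quaternions => fun k => nth 0 [:: cd_l (cd_one R 1); cd_r (cd_one R 1)] k
  | Octonions => fun k => nth 0 [:: cd_l (cd_l (cd_one R 1)); cd_l (cd_r (cd_one R 1));
                                    cd_r (cd_l (cd_one R 1)); cd_r (cd_r (cd_one R 1))] k
  end.

Lemma cd_lr_inj n (a b c d : 'rV[R]_(cd_dim n)) :
  cd_l a + cd_r b = cd_l c + cd_r d -> a = c /\ b = d.
Proof. by rewrite /cd_l /cd_r !add_row_mx !addr0 !add0r => /eq_row_mx. Qed.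

Lemma cd_lr_split n (x : 'rV[R]_(cd_dim n.+1)) : x = cd_l (lsubmx x) + cd_r (rsubmx x).
Proof. by rewrite /cd_l /cd_r add_row_mx addr0 add0r hsubmxK. Qed.

Lemma cd_l0 n : cd_l (0 : 'rV[R]_(cd_dim n)) = 0. Proof. exact: row_mx0. Qed.
Lemma cd_r0 n : cd_r (0 : 'rV[R]_(cd_dim n)) = 0. Proof. exact: row_mx0. Qed.

Lemma cd_lD n (x y : 'rV[R]_(cd_dim n)) : cd_l (x + y) = cd_l x + cd_l y.
Proof. by rewrite /cd_l add_row_mx addr0. Qed.
Lemma cd_rD n (x y : 'rV[R]_(cd_dim n)) : cd_r (x + y) = cd_r x + cd_r y.
Proof. by rewrite /cd_r add_row_mx addr0. Qed.

Lemma cd_lZ n a (x : 'rV[R]_(cd_dim n)) : cd_l (a *: x) = a *: cd_l x.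
Proof. by rewrite /cd_l scale_row_mx scaler0. Qed.

Lemma phi_std_H c : @phi R Quaternions cd_i2 c = cd_l (cd_phi1 c).
Proof.
have E : complex.Re c *: cd_one R 2 + complex.Im c *: cd_i2 = cd_l (cd_phi1 c).
  by rewrite /cd_phi1 cd_lD !cd_lZ /cd_l -cd_one_succ.
by rewrite /phi aone_H; exact: E.
Qed.

Lemma phi_std_O c : @phi R Octonions cd_i3 c = cd_l (cd_l (cd_phi1 c)).
Proof.
have E : complex.Re c *: cd_one R 3 + complex.Im c *: cd_i3 = cd_l (cd_l (cd_phi1 c)).
  by rewrite /cd_phi1 !cd_lD !cd_lZ /cd_l -!cd_one_succ.
by rewrite /phi aone_O; exact: E.
Qed.

Lemma CI_comb_H c : @CI_comb R Quaternions cd_i2 (std_J (A:=Quaternions)) c =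
  cd_l (cd_phi1 (c 0 0)) + cd_r (cd_phi1 (c 0 1)).
Proof.
rewrite /CI_comb big_ord_recl big_ord1 !phi_std_H.
have E1 x : @amul R Quaternions (cd_l (cd_phi1 x)) (cd_l (cd_one R 1)) = cd_l (cd_phi1 x).
  by rewrite [LHS](@cd_mul_ll 1) cd_mul1r.
have E2 x : @amul R Quaternions (cd_l (cd_phi1 x)) (cd_r (cd_one R 1)) = cd_r (cd_phi1 x).
  by rewrite [LHS](@cd_mul_lr 1) cd_mul1l.
rewrite [std_J ord0](_ : _ = cd_l (cd_one R 1)) // E1.
rewrite [std_J _](_ : _ = cd_r (cd_one R 1)) // E2.
by have -> : lift ord0 ord0 = 1 :> 'I_2 by apply: val_inj.
Qed.

(** The last coefficient is conjugated because of the term [b c^c] of the doubling formula;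
    conjugation is bijective, so a base results all the same. *)
Lemma CI_comb_O c : @CI_comb R Octonions cd_i3 (std_J (A:=Octonions)) c =
  cd_l (cd_l (cd_phi1 (c 0 0)) + cd_r (cd_phi1 (c 0 1))) +
  cd_r (cd_l (cd_phi1 (c 0 2)) + cd_r (cd_phi1 (conjc (c 0 3)))).
Proof.
have E1 x : @amul R Octonions (cd_l (cd_l (cd_phi1 x))) (cd_l (cd_l (cd_one R 1))) =
    cd_l (cd_l (cd_phi1 x)).
  by rewrite [LHS](@cd_mul_ll 2) [X in row_mx X _](@cd_mul_ll 1) cd_mul1r.
have E2 x : @amul R Octonions (cd_l (cd_l (cd_phi1 x))) (cd_l (cd_r (cd_one R 1))) =
    cd_l (cd_r (cd_phi1 x)).
  by rewrite [LHS](@cd_mul_ll 2) [X in row_mx X _](@cd_mul_lr 1) cd_mul1l.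
have E3 x : @amul R Octonions (cd_l (cd_l (cd_phi1 x))) (cd_r (cd_l (cd_one R 1))) =
    cd_r (cd_l (cd_phi1 x)).
  by rewrite [LHS](@cd_mul_lr 2) [X in row_mx _ X](@cd_mul_ll 1) cd_mul1l.
have E4 x : @amul R Octonions (cd_l (cd_l (cd_phi1 x))) (cd_r (cd_r (cd_one R 1))) =
    cd_r (cd_r (cd_phi1 (conjc x))).
  by rewrite [LHS](@cd_mul_lr 2) [X in row_mx _ X](@cd_mul_rl 1) cd_mul1l cd_conj_phi1.
pose F k := amul (@phi R Octonions cd_i3 (c 0 k)) (@std_J Octonions k).
have F0 : F 0 = cd_l (cd_l (cd_phi1 (c 0 0))) by rewrite /F phi_std_O; exact: E1.
have F1 : F 1 = cd_l (cd_r (cd_phi1 (c 0 1))) by rewrite /F phi_std_O; exact: E2.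
have F2 : F 2 = cd_r (cd_l (cd_phi1 (c 0 2))) by rewrite /F phi_std_O; exact: E3.
have F3 : F 3 = cd_r (cd_r (cd_phi1 (conjc (c 0 3)))) by rewrite /F phi_std_O; exact: E4.
have -> : @CI_comb R Octonions cd_i3 (@std_J Octonions) c = F 0 + F 1 + (F 2 + F 3).
  exact: (sum_ord4 F).
by rewrite F0 F1 F2 F3 !cd_lD !cd_rD.
Qed.

Lemma cd_phi1_0 : cd_phi1 0 = 0.
Proof. by rewrite /cd_phi1 /= !scale0r addr0. Qed.

Lemma std_splitting_base A : splitting_base (std_I A) (@std_J A).
Proof.
case: A; split.
- apply/imag_unitP; rewrite /anorm2 -/(@cd_norm2 R 2 cd_i2).
  rewrite /cd_i2 cd_norm2_succ !row_mxKl !row_mxKr /cd_i1 cd_norm2_succ !row_mxKl !row_mxKr.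
  have n0 n : cd_norm2 (0 : 'rV[R]_(cd_dim n)) = 0 by rewrite /cd_norm2 big1 // => i _; rewrite mxE expr0n.
  rewrite !n0 -[cd_one R 0]scale1r cd_norm2_scale1 expr1n add0r addr0; split=> //.
  have -> : 0 = cd_zero_ord 2 :> 'I_4 by apply: val_inj.
  have E : cd_re cd_i2 = 0.
    by rewrite cd_re_succ /cd_i2 row_mxKl cd_re_succ /cd_i1 row_mxKl /cd_re mxE.
  exact: E.
- by rewrite aone_H (cd_one_succ R 1).
- split=> [c|x].
    move=> h; have : cd_l (cd_phi1 (c 0 0)) + cd_r (cd_phi1 (c 0 1)) =
        cd_l (cd_phi1 0) + cd_r (cd_phi1 0).
      by rewrite cd_phi1_0 cd_l0 cd_r0 addr0; exact: (etrans (esym (CI_comb_H c)) h).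
    move=> /cd_lr_inj [/cd_phi1_inj h0 /cd_phi1_inj h1]; apply/rowP => i; rewrite mxE.
    case: i => -[|[|//]] hi.
    + by rewrite -[RHS]h0; congr (c _ _); apply: val_inj.
    + by rewrite -[RHS]h1; congr (c _ _); apply: val_inj.
  have [a ha] := cd_phi1_surj (@lsubmx R 1 2 2 x).
  have [b hb] := cd_phi1_surj (@rsubmx R 1 2 2 x).
  exists (\row_k nth 0 [:: a; b] k); rewrite [RHS]CI_comb_H !mxE /= -ha -hb.
  exact: (@cd_lr_split 1).
- apply/imag_unitP; rewrite /anorm2 -/(@cd_norm2 R 3 cd_i3).
  rewrite /cd_i3 cd_norm2_succ !row_mxKl !row_mxKr /cd_i2 cd_norm2_succ !row_mxKl !row_mxKr.
  rewrite /cd_i1 cd_norm2_succ !row_mxKl !row_mxKr.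
  have n0 n : cd_norm2 (0 : 'rV[R]_(cd_dim n)) = 0 by rewrite /cd_norm2 big1 // => i _; rewrite mxE expr0n.
  rewrite !n0 -[cd_one R 0]scale1r cd_norm2_scale1 expr1n add0r !addr0; split=> //.
  have -> : 0 = cd_zero_ord 3 :> 'I_8 by apply: val_inj.
  have E : cd_re cd_i3 = 0.
    rewrite cd_re_succ /cd_i3 row_mxKl cd_re_succ /cd_i2 row_mxKl.
    by rewrite cd_re_succ /cd_i1 row_mxKl /cd_re mxE.
  exact: E.
- by rewrite aone_O (cd_one_succ R 2) (cd_one_succ R 1).
- split=> [c|x].
    move=> h; have : cd_l (cd_l (cd_phi1 (c 0 0)) + cd_r (cd_phi1 (c 0 1))) +
        cd_r (cd_l (cd_phi1 (c 0 2)) + cd_r (cd_phi1 (conjc (c 0 3)))) =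
        cd_l (cd_l (cd_phi1 0) + cd_r (cd_phi1 0)) +
        cd_r (cd_l (cd_phi1 0) + cd_r (cd_phi1 0)).
      rewrite cd_phi1_0 cd_l0 cd_r0 addr0 cd_l0 cd_r0 addr0.
      exact: (etrans (esym (CI_comb_O c)) h).
    move=> /cd_lr_inj [].
    move=> /cd_lr_inj [/cd_phi1_inj h0 /cd_phi1_inj h1].
    move=> /cd_lr_inj [/cd_phi1_inj h2 /cd_phi1_inj h3].
    have {}h3 : c 0 3 = 0 by rewrite -(conjcK (c 0 3)) h3 conjc0.
    apply/rowP => i; rewrite mxE; case: i => -[|[|[|[|//]]]] hi.
    + by rewrite -[RHS]h0; congr (c _ _); apply: val_inj.
    + by rewrite -[RHS]h1; congr (c _ _); apply: val_inj.
    + by rewrite -[RHS]h2; congr (c _ _); apply: val_inj.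
    + by rewrite -[RHS]h3; congr (c _ _); apply: val_inj.
  have [a ha] := cd_phi1_surj (@lsubmx R 1 2 2 (@lsubmx R 1 4 4 x)).
  have [b hb] := cd_phi1_surj (@rsubmx R 1 2 2 (@lsubmx R 1 4 4 x)).
  have [c hc] := cd_phi1_surj (@lsubmx R 1 2 2 (@rsubmx R 1 4 4 x)).
  have [d hd] := cd_phi1_surj (@rsubmx R 1 2 2 (@rsubmx R 1 4 4 x)).
  (* [conjc d] compensates for the conjugation in [CI_comb_O]. *)
  exists (\row_k nth 0 [:: a; b; c; conjc d] k); rewrite [RHS]CI_comb_O !mxE /= conjcK -ha -hb -hc -hd.
  by rewrite -!(@cd_lr_split 1) -(@cd_lr_split 2).
Qed.

End StandardBase.
End ImaginaryUnits.

(** * Germs of real and complex Nash functions *)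

Section Topology.
Variable K : numFieldType.

Lemma partial_sum_cvgP (I : choiceType) (f : I -> K) (l : K) :
  partial_sum f @ totally --> l <->
  forall e : K, 0 < e -> exists S0 : {fset I}, forall S : {fset I},
    (S0 `<=` S)%fset -> `|\sum_(i <- S) f i - l| < e.
Proof.
have psE S : partial_sum f S = \sum_(i <- S) f i.
  by rewrite /partial_sum big_seq_fsetE.
have FF : Filter (@totally I) by have := @totally_filter I; case.
split=> [/cvgrPdist_lt h e /h [S0 _ hS]|h].
  by exists S0 => S SS; rewrite distrC -psE; exact: hS.
apply/cvgrPdist_lt => e /h [S0 hS]; exists S0 => // S SS /=.
by rewrite distrC psE; exact: hS.
Qed.

Lemma nbhs_rowP n (a : 'rV[K]_n) (P : 'rV[K]_n -> Prop) :
  (\forall x \near a, P x) <->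
  exists2 e : K, 0 < e & forall x : 'rV[K]_n, (forall i, `|x 0 i - a 0 i| < e) -> P x.
Proof.
split=> [/nbhs_ballP [e e0 h]|[e e0 h]].
  exists e => // x hx; apply: h; split=> // i j.
  by rewrite /ball /= distrC (ord1 i).
apply/nbhs_ballP; exists e => // x hx; apply: h => i.
by have := hx.2 0 i; rewrite /ball /= distrC.
Qed.

End Topology.

Section Germs.
Variable R : realType.
Local Notation C := (R[i]).

Lemma posC_real (e : C) : 0 < e -> exists2 d : R, 0 < d & e = d%:C.
Proof.
by case: e => a b; rewrite ltcE /= => /andP[/eqP -> a0]; exists a.
Qed.

Lemma partial_sum_cvgC (I : choiceType) (f : I -> C) (l : C) :
  partial_sum f @ totally --> (l : (C : numFieldType)) <-> has_sum f l.
Proof.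
rewrite partial_sum_cvgP; split=> h e e0.
  have [|S0 hS] := h e%:C; first by rewrite ltcR.
  by exists S0 => S /hS; rewrite normC_normc ltcR => /ltW.
have [d d0 ->] := posC_real e0.
have [|S0 hS] := h (d / 2); first by rewrite divr_gt0.
exists S0 => S /hS hl; rewrite normC_normc ltcR (le_lt_trans hl) //.
by rewrite ltr_pdivrMr // ltr_pMr // ltr1n.
Qed.

Lemma partial_sum_cvgR (I : choiceType) (f : I -> R) (l : R) :
  partial_sum f @ totally --> (l : (R : numFieldType)) <->
  has_sum (fun i => (f i)%:C) l%:C.
Proof.
rewrite partial_sum_cvgP; split=> h e e0.
  have [S0 hS] := h e e0; exists S0 => S /hS.
  by rewrite -rmorph_sum -rmorphB normc_real => /ltW.
have [|S0 hS] := h (e / 2); first by rewrite divr_gt0.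
exists S0 => S /hS; rewrite -rmorph_sum -rmorphB normc_real => hl.
by rewrite (le_lt_trans hl) // ltr_pdivrMr // ltr_pMr // ltr1n.
Qed.

(** Abel's lemma: convergence at the corner (r, ..., r) bounds the coefficients, because
    unconditional convergence is absolute. *)
Lemma ps_of_point n (c : {ffun 'I_n -> nat} -> C) (r : R) l :
  0 < r -> has_sum (fun m => c m * mono (fun=> r%:C) m) l ->
  exists B g, ps_coef c r B g.
Proof.
move=> r0 /has_sum_sum_bounded [B hB].
have hB' : sum_bounded (fun m => c m * (r ^+ mdegree m)%:C) B.
  apply: sum_bounded_dom hB => m; rewrite /mono prodrXr -/(mdegree m) rmorphXn //.
have h y : exists l, polydisc r y -> has_sum (fun m => c m * mono y m) l.
  case: (pselect (polydisc r y)) => hy; last by exists 0.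
  have [l' hl'] := sum_bounded_has_sum (sum_bounded_mono (p := id) hB' hy).
  by exists l'.
by have [g hg] := choice h; exists B, g.
Qed.

(** * Germs at real points *)

Section RealGerms.
Variable n : nat.
Implicit Types (a x : 'rV[R]_n) (g : 'rV[R]_n -> C).

Definition box a (e : R) x : Prop := forall i, `|x 0 i - a 0 i| <= e.

Definition diffC a x : 'I_n -> C := fun i => (x 0 i - a 0 i)%:C.
Definition rowC x : 'I_n -> C := fun i => (x 0 i)%:C.

Definition analytic_at a g : Prop := exists r B h,
  [/\ 0 < r, ps r B h & forall x, box a r x -> h (diffC a x) = g x].

Definition algebraic_at a g : Prop := exists2 P : {poly mpoly.mpoly n C}, P != 0 &
  exists2 e : R, 0 < e & forall x, box a e x -> pev (rowC x) P (g x) = 0.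

Lemma box_le a (e e' : R) x : e <= e' -> box a e x -> box a e' x.
Proof. by move=> h hx i; exact: le_trans (hx i) h. Qed.

Lemma polydisc_diffC a (r : R) x : box a r x -> polydisc r (diffC a x).
Proof. by move=> h i; rewrite normc_real. Qed.

Lemma nbhs_boxP a (P : 'rV[R]_n -> Prop) :
  (\forall x \near a, P x) <-> exists2 e : R, 0 < e & forall x, box a e x -> P x.
Proof.
rewrite nbhs_rowP; split=> -[e e0 h].
  exists (e / 2); first by rewrite divr_gt0.
  move=> x hx; apply: h => i; apply: le_lt_trans (hx i) _.
  by rewrite ltr_pdivrMr // ltr_pMr // ltr1n.
by exists e => // x hx; apply: h => i; exact/ltW.
Qed.

Lemma eq_analytic_at a g g' : (exists2 e : R, 0 < e & forall x, box a e x -> g x = g' x) ->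
  analytic_at a g -> analytic_at a g'.
Proof.
move=> [e e0 he] [r [B [h [r0 hh hE]]]].
have m0 : 0 < Num.min e r by rewrite lt_min e0.
exists (Num.min e r), B, h; split=> //.
  by apply: ps_shrink hh; rewrite ?(ltW m0) // ge_min lexx orbT.
move=> x hx; rewrite hE; first by apply: he; apply: box_le hx; rewrite ge_min lexx.
by apply: box_le hx; rewrite ge_min lexx orbT.
Qed.

Lemma eq_algebraic_at a g g' : (exists2 e : R, 0 < e & forall x, box a e x -> g x = g' x) ->
  algebraic_at a g -> algebraic_at a g'.
Proof.
move=> [e e0 he] [P P0 [r r0 h]]; exists P => //.
have m0 : 0 < Num.min e r by rewrite lt_min e0.
exists (Num.min e r) => // x hx; rewrite -he; last by apply: box_le hx; rewrite ge_min lexx.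
by apply: h; apply: box_le hx; rewrite ge_min lexx orbT.
Qed.

Lemma analytic_at_add a g g' : analytic_at a g -> analytic_at a g' ->
  analytic_at a (fun x => g x + g' x).
Proof.
move=> [r [B [h [r0 hh hE]]]] [r' [B' [h' [r'0 hh' hE']]]].
have m0 : 0 < Num.min r r' by rewrite lt_min r0.
have mr : Num.min r r' <= r by rewrite ge_min lexx.
have mr' : Num.min r r' <= r' by rewrite ge_min lexx orbT.
exists (Num.min r r'), (B + B'), (fun y => h y + h' y); split=> //.
  by apply: ps_add; [apply: ps_shrink hh|apply: ps_shrink hh']; rewrite ?(ltW m0).
by move=> x hx; rewrite hE ?hE' //; exact: box_le hx.
Qed.

Lemma analytic_at_mul a g g' : analytic_at a g -> analytic_at a g' ->
  analytic_at a (fun x => g x * g' x).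
Proof.
move=> [r [B [h [r0 hh hE]]]] [r' [B' [h' [r'0 hh' hE']]]].
have m0 : 0 < Num.min r r' by rewrite lt_min r0.
have mr : Num.min r r' <= r by rewrite ge_min lexx.
have mr' : Num.min r r' <= r' by rewrite ge_min lexx orbT.
exists (Num.min r r'), (B * B'), (fun y => h y * h' y); split=> //.
  by apply: ps_mul => //; [apply: ps_shrink hh|apply: ps_shrink hh']; rewrite ?(ltW m0).
by move=> x hx; rewrite hE ?hE' //; exact: box_le hx.
Qed.

Lemma analytic_at_const a c : analytic_at a (fun=> c).
Proof. by exists 1, (normc c), (fun=> c); split=> //; exact: ps_const. Qed.

Lemma analytic_at_coord a i : analytic_at a (fun x => (x 0 i)%:C).
Proof.
exists 1, (1 + normc (a 0 i)%:C), (fun y => y i + (a 0 i)%:C); split=> //.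
  by apply: ps_add; [exact: ps_var|exact: ps_const].
by move=> x _; rewrite /diffC -rmorphD subrK.
Qed.

Lemma analytic_at_conj a g : analytic_at a g -> analytic_at a (fun x => conjc (g x)).
Proof.
move=> [r [B [h [r0 hh hE]]]].
exists r, B, (fun y => conjc (h (fun i => conjc (y i)))); split=> //; first exact: ps_conj.
by move=> x hx; rewrite -hE //; congr (conjc (h _)); apply/funext => i; rewrite conjc_real.
Qed.

Lemma analytic_at_sum (J : Type) (s : seq J) a (g : J -> 'rV[R]_n -> C) :
  (forall j, analytic_at a (g j)) -> analytic_at a (fun x => \sum_(j <- s) g j x).
Proof.
move=> h; elim: s => [|j s IH].
  by apply: eq_analytic_at (analytic_at_const a 0); exists 1 => // x _; rewrite big_nil.
apply: eq_analytic_at (analytic_at_add (h j) IH).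
by exists 1 => // x _; rewrite big_cons.
Qed.

Lemma algebraic_at_op (op : C -> C -> C) a g g' :
  (forall P Q : {poly mpoly.mpoly n C}, P != 0 -> Q != 0 -> exists2 N, N != 0 &
     forall y u v, pev y P u = 0 -> pev y Q v = 0 -> pev y N (op u v) = 0) ->
  algebraic_at a g -> algebraic_at a g' -> algebraic_at a (fun x => op (g x) (g' x)).
Proof.
move=> hop [P P0 [r r0 h]] [Q Q0 [r' r'0 h']].
have m0 : 0 < Num.min r r' by rewrite lt_min r0.
have mr : Num.min r r' <= r by rewrite ge_min lexx.
have mr' : Num.min r r' <= r' by rewrite ge_min lexx orbT.
have [N N0 hN] := hop _ _ P0 Q0; exists N => //; exists (Num.min r r') => // x hx.
by apply: hN; [apply: h; exact: box_le hx|apply: h'; exact: box_le hx].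
Qed.

Lemma algebraic_at_add a g g' : algebraic_at a g -> algebraic_at a g' ->
  algebraic_at a (fun x => g x + g' x).
Proof. by apply: algebraic_at_op; exact: pev_add. Qed.

Lemma algebraic_at_mul a g g' : algebraic_at a g -> algebraic_at a g' ->
  algebraic_at a (fun x => g x * g' x).
Proof. by apply: algebraic_at_op; exact: pev_mul. Qed.

Lemma algebraic_at_const a c : algebraic_at a (fun=> c).
Proof.
exists ('X - (mpoly.mpolyC n c)%:P); first by rewrite polyXsubC_eq0.
exists 1 => // x _; rewrite /pev rmorphB /= map_polyX map_polyC /= hornerD hornerN hornerX hornerC.
by rewrite mpoly.mevalC subrr.
Qed.

Lemma algebraic_at_conj a g : algebraic_at a g -> algebraic_at a (fun x => conjc (g x)).
Proof.
move=> [P P0 [r r0 h]]; have [N N0 hN] := pev_conj P0.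
exists N => //; exists r => // x hx; have := hN _ _ (h x hx).
suff -> : (fun i => conjc (rowC x i)) = rowC x by [].
by apply/funext => i; rewrite conjc_real.
Qed.

Lemma algebraic_at_sum (J : Type) (s : seq J) a (g : J -> 'rV[R]_n -> C) :
  (forall j, algebraic_at a (g j)) -> algebraic_at a (fun x => \sum_(j <- s) g j x).
Proof.
move=> h; elim: s => [|j s IH].
  by apply: eq_algebraic_at (algebraic_at_const a 0); exists 1 => // x _; rewrite big_nil.
apply: eq_algebraic_at (algebraic_at_add (h j) IH).
by exists 1 => // x _; rewrite big_cons.
Qed.

Lemma mono_real (y : 'I_n -> R) m :
  mono (fun i => (y i)%:C) m = (\prod_i y i ^+ m i)%:C.
Proof. by rewrite rmorph_prod; apply: eq_bigr => i _; rewrite rmorphXn. Qed.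

Lemma analytic_atP a (g : 'rV[R]_n -> R) :
  (exists c, \forall x \near a, @power_series_sum (R : numFieldType) n c a x (g x)) <->
  analytic_at a (fun x => (g x)%:C).
Proof.
split=> [[c /nbhs_boxP [r r0 h]]|[r [B [h [r0 [c [hB hc]] hE]]]]].
  have hs x : box a r x ->
      has_sum (fun m => (c m)%:C * mono (diffC a x) m) (g x)%:C.
    move=> /h /partial_sum_cvgR; apply: eq_has_sum => m.
    by rewrite rmorphM; congr (_ * _); exact: (esym (mono_real (fun i => x 0 i - a 0 i) m)).
  pose x0 : 'rV[R]_n := a + const_mx r.
  have b0 : box a r x0 by move=> i; rewrite !mxE addrAC subrr add0r ger0_norm // ltW.
  have [|B [h' hh']] := @ps_of_point n (fun m => (c m)%:C) r (g x0)%:C r0.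
    apply: eq_has_sum (hs _ b0) => m; congr (_ * mono _ _); apply/funext => i.
    by rewrite /diffC !mxE addrAC subrr add0r.
  exists r, B, h'; split=> //; first by exists (fun m => (c m)%:C).
  move=> x hx; apply: has_sum_unique (hs x hx).
  by apply: hh'.2; exact: polydisc_diffC.
(* The average of the series with its conjugate still sums to the real number [g x], and its
   coefficients are the real parts. *)
exists (fun m => complex.Re (c m)); apply/nbhs_boxP; exists r => // x hx.
apply/partial_sum_cvgR; have h1 := hc _ (polydisc_diffC hx); rewrite (hE x hx) in h1.
have h2 := has_sumZ (2^-1) (has_sumD h1 (has_sum_conj h1)).
have := h2; have -> : 2^-1 * ((g x)%:C + conjc (g x)%:C) = (g x)%:C.
  by rewrite conjc_real; field.
apply: eq_has_sum => m.
have pE : (\prod_i (x 0 i - a 0 i) ^+ m i)%:C = mono (diffC a x) m.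
  exact: (esym (mono_real (fun i => x 0 i - a 0 i) m)).
rewrite [in RHS]rmorphM [X in _ = _ * X]pE.
have mr : conjc (mono (diffC a x) m) = mono (diffC a x) m by rewrite -pE conjc_real.
have -> : conjc (c m * mono (diffC a x) m) = conjc (c m) * mono (diffC a x) m.
  by rewrite -[in RHS]mr; exact: rmorphM.
rewrite -mulrDl mulrA; congr (_ * _).
by rewrite mulrC; exact: (esym (ReJ_add (c m))).
Qed.

(** From real to complex coefficients by extension of scalars, and back by [real_part_mpoly]. *)
Lemma algebraic_atP a (g : 'rV[R]_n -> R) :
  (exists2 P : mpoly.mpoly (n + 1) R, P != 0 & \forall x \near a,
     mpoly.meval (fun i => row_mx x (g x)%:M 0 i) P = 0) <->
  algebraic_at a (fun x => (g x)%:C).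
Proof.
split=> [[P P0 /nbhs_boxP [e e0 h]]|[P P0 [e e0 h]]].
  pose PC : mpoly.mpoly (n + 1) C := mpoly.map_mpoly (real_complex R) P.
  have PC0 : PC != 0.
    apply: contraNneq P0 => hP; apply/eqP/mpoly.mpolyP => m.
    have := congr1 (mpoly.mcoeff m) hP; rewrite mpoly.mcoeff_map_mpoly !mpoly.mcoeff0.
    exact: complexI.
  exists (poly_of_mpoly C n PC); first by rewrite -mpoly_of_poly_eq0 poly_of_mpolyK.
  exists e => // x /h hx.
  have -> : rowC x = (map_mx (real_complex R) x) 0 by apply/funext => i; rewrite mxE.
  rewrite -meval_mpoly_of_poly poly_of_mpolyK.
  have -> : (fun i => row_mx (map_mx (real_complex R) x) (g x)%:C%:M 0 i) =
      (fun i => (row_mx x (g x)%:M 0 i)%:C).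
    apply/funext => i; rewrite -(map_scalar_mx (real_complex R)) -map_row_mx mxE //.
  have -> : mpoly.meval (fun i => (row_mx x (g x)%:M 0 i)%:C) PC =
     (mpoly.meval (fun i => row_mx x (g x)%:M 0 i) P)%:C.
    apply: (@mpoly_rmorph_eq _ _ _ (mpoly.meval _ \o mpoly.map_mpoly (real_complex R))
      (real_complex R \o mpoly.meval _)) => [k|i] /=.
      by rewrite mpoly.map_mpolyC !mpoly.mevalC.
    by rewrite mpoly.map_mpolyX !mpoly.mevalXU.
  by rewrite hx.
rewrite -mpoly_of_poly_eq0 in P0; have [Q Q0 hQ] := real_part_mpoly P0.
exists Q => //; apply/nbhs_boxP; exists e => // x /h hx; apply: hQ.
rewrite -[RHS]hx -[rowC x](_ : (map_mx (real_complex R) x) 0 = _); last first.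
  by apply/funext => i; rewrite mxE.
rewrite -meval_mpoly_of_poly; congr (mpoly.meval _ _); apply/funext => i.
have -> : (g x)%:C%:M = map_mx (real_complex R) (g x)%:M :> 'M[C]_1 by rewrite map_scalar_mx.
by rewrite -map_row_mx [in RHS]mxE.
Qed.

(** Analyticity is a condition at each point of [U]. Only the polynomial has to be common to a
    neighbourhood, for which the interior of the set of its solutions in [U] is taken. *)
Lemma nashP (U : set 'rV[R]_n) (g : 'rV[R]_n -> R) : open U ->
  @nash (R : numFieldType) n U g <->
  forall a, U a -> analytic_at a (fun x => (g x)%:C) /\ algebraic_at a (fun x => (g x)%:C).
Proof.
move=> oU; split=> [hN a Ua|h x0 Ux0].
  have [U' [oU' U'a sub han [P P0 hP]]] := hN a Ua; split.
    by apply/analytic_atP; exact: han.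
  apply/algebraic_atP; exists P => //.
  by apply: filterS (open_nbhs_nbhs (conj oU' U'a)) => x /hP.
have [/analytic_atP _ /algebraic_atP [P P0 hP]] := h x0 Ux0.
pose S := U `&` [set x | mpoly.meval (fun i => row_mx x (g x)%:M 0 i) P = 0].
exists (interior S); split.
- exact: open_interior.
- by apply: filterI => //; exact: open_nbhs_nbhs.
- by move=> x /interior_subset [].
- by move=> a /interior_subset [/h [/analytic_atP]].
- by exists P => // x /interior_subset [].
Qed.

End RealGerms.
End Germs.

(** * Germs in one complex variable *)

Section ComplexGerms.
Variable R : realType.
Local Notation C := (R[i]).
Implicit Types (z w : C) (g : C -> C).

Definition holo_at z0 g : Prop := exists r B (h : ('I_1 -> C) -> C),
  [/\ 0 < r, ps r B h & forall z, normc (z - z0) <= r -> h (fun=> z - z0) = g z].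

Definition calgebraic_at z0 g : Prop := exists2 P : {poly mpoly.mpoly 1 C}, P != 0 &
  exists2 e : R, 0 < e & forall z, normc (z - z0) <= e -> pev (fun=> z) P (g z) = 0.

Lemma eq_holo_at z0 g g' : (exists2 e : R, 0 < e & forall z, normc (z - z0) <= e -> g z = g' z) ->
  holo_at z0 g -> holo_at z0 g'.
Proof.
move=> [e e0 he] [r [B [h [r0 hh hE]]]].
have m0 : 0 < Num.min e r by rewrite lt_min e0.
exists (Num.min e r), B, h; split=> //.
  by apply: ps_shrink hh; rewrite ?(ltW m0) // ge_min lexx orbT.
move=> x; rewrite le_min => /andP[h1 h2]; rewrite hE //; exact: he.
Qed.

Lemma eq_calgebraic_at z0 g g' :
  (exists2 e : R, 0 < e & forall z, normc (z - z0) <= e -> g z = g' z) ->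
  calgebraic_at z0 g -> calgebraic_at z0 g'.
Proof.
move=> [e e0 he] [P P0 [r r0 h]]; exists P => //.
have m0 : 0 < Num.min e r by rewrite lt_min e0.
exists (Num.min e r) => // x; rewrite le_min => /andP[h1 h2].
by rewrite -he //; exact: h.
Qed.

Lemma holo_at_add z0 g g' : holo_at z0 g -> holo_at z0 g' ->
  holo_at z0 (fun z => g z + g' z).
Proof.
move=> [r [B [h [r0 hh hE]]]] [r' [B' [h' [r'0 hh' hE']]]].
have m0 : 0 < Num.min r r' by rewrite lt_min r0.
exists (Num.min r r'), (B + B'), (fun y => h y + h' y); split=> //.
  apply: ps_add; [apply: ps_shrink hh|apply: ps_shrink hh']; rewrite ?(ltW m0) // ge_min lexx ?orbT //.
by move=> x; rewrite le_min => /andP[h1 h2]; rewrite hE ?hE'.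
Qed.

Lemma holo_at_scale z0 g c : holo_at z0 g -> holo_at z0 (fun z => c * g z).
Proof.
move=> [r [B [h [r0 hh hE]]]]; exists r, (normc c * B), (fun y => c * h y); split=> //.
  exact: ps_scale.
by move=> z hz; rewrite hE.
Qed.

Lemma calgebraic_at_add z0 g g' : calgebraic_at z0 g -> calgebraic_at z0 g' ->
  calgebraic_at z0 (fun z => g z + g' z).
Proof.
move=> [P P0 [r r0 h]] [Q Q0 [r' r'0 h']].
have m0 : 0 < Num.min r r' by rewrite lt_min r0.
have [N N0 hN] := pev_add P0 Q0; exists N => //; exists (Num.min r r') => // x.
by rewrite le_min => /andP[h1 h2]; apply: hN; [exact: h|exact: h'].
Qed.

Lemma calgebraic_at_scale z0 g c : calgebraic_at z0 g -> calgebraic_at z0 (fun z => c * g z).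
Proof.
move=> [P P0 [r r0 h]]; have [N N0 hN] := pev_scale c P0.
by exists N => //; exists r => // z hz; apply: hN; exact: h.
Qed.

Lemma normc_conjB z w : normc (conjc z - w) = normc (z - conjc w).
Proof. by rewrite -normc_conj rmorphB /= conjcK. Qed.

(** Schwarz reflection, by conjugating the coefficients. *)
Lemma holo_at_conj z0 g : holo_at z0 g ->
  holo_at (conjc z0) (fun z => conjc (g (conjc z))).
Proof.
move=> [r [B [h [r0 hh hE]]]].
exists r, B, (fun y => conjc (h (fun i => conjc (y i)))); split=> //; first exact: ps_conj.
move=> z hz; rewrite -hE; last by rewrite normc_conjB.
by congr (conjc (h _)); apply/funext => i; rewrite rmorphB /= conjcK.
Qed.

Lemma calgebraic_at_conj z0 g : calgebraic_at z0 g ->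
  calgebraic_at (conjc z0) (fun z => conjc (g (conjc z))).
Proof.
move=> [P P0 [r r0 h]]; have [N N0 hN] := pev_conj P0.
exists N => //; exists r => // z hz.
have /h/hN : normc (conjc z - z0) <= r by rewrite normc_conjB.
suff -> : (fun i : 'I_1 => conjc (conjc z)) = (fun=> z) by [].
by apply/funext => i; rewrite conjcK.
Qed.

Definition cnash_at z0 g : Prop := holo_at z0 g /\ calgebraic_at z0 g.

Lemma cnash_at_add z0 g g' : cnash_at z0 g -> cnash_at z0 g' -> cnash_at z0 (fun z => g z + g' z).
Proof. by move=> [? ?] [? ?]; split; [exact: holo_at_add|exact: calgebraic_at_add]. Qed.

Lemma cnash_at_scale z0 g c : cnash_at z0 g -> cnash_at z0 (fun z => c * g z).
Proof. by move=> [? ?]; split; [exact: holo_at_scale|exact: calgebraic_at_scale]. Qed.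

Lemma cnash_at_conj z0 g : cnash_at z0 g -> cnash_at (conjc z0) (fun z => conjc (g (conjc z))).
Proof. by move=> [? ?]; split; [exact: holo_at_conj|exact: calgebraic_at_conj]. Qed.

Lemma eq_cnash_at z0 g g' : (exists2 e : R, 0 < e & forall z, normc (z - z0) <= e -> g z = g' z) ->
  cnash_at z0 g -> cnash_at z0 g'.
Proof. by move=> h [? ?]; split; [exact: (eq_holo_at h)|exact: (eq_calgebraic_at h)]. Qed.

Lemma cnash_at_const z0 c : cnash_at z0 (fun=> c).
Proof.
split; first by exists 1, (normc c), (fun=> c); split=> //; exact: ps_const.
exists ('X - (mpoly.mpolyC 1 c)%:P); first by rewrite polyXsubC_eq0.
exists 1 => // z _; rewrite /pev rmorphB /= map_polyX map_polyC /= hornerD hornerN hornerX hornerC.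
by rewrite mpoly.mevalC subrr.
Qed.

Lemma cnash_at_sum (J : Type) (s : seq J) z0 (g : J -> C -> C) :
  (forall j, cnash_at z0 (g j)) -> cnash_at z0 (fun z => \sum_(j <- s) g j z).
Proof.
move=> h; elim: s => [|j s IH].
  by apply: eq_cnash_at (cnash_at_const z0 0); exists 1 => // z _; rewrite big_nil.
apply: eq_cnash_at (cnash_at_add (h j) IH).
by exists 1 => // z _; rewrite big_cons.
Qed.

(* R[i] has a topology only through its structure of numFieldType. *)
Definition CK : numFieldType := R[i].

Lemma nbhs_rowCP (a : 'rV[CK]_1) (P : 'rV[CK]_1 -> Prop) :
  (\forall x \near a, P x) <->
  exists2 e : R, 0 < e & forall x : 'rV[CK]_1, normc (x 0 0 - a 0 0 : R[i]) <= e -> P x.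
Proof.
rewrite nbhs_rowP; split=> -[e e0 h].
  have [d d0 ed] := posC_real e0; exists (d / 2); first by rewrite divr_gt0.
  move=> x hx; apply: h => i; rewrite (ord1 i) ed normC_normc ltcR.
  by apply: le_lt_trans hx _; rewrite ltr_pdivrMr // ltr_pMr // ltr1n.
exists e%:C; first by rewrite ltcR.
by move=> x hx; apply: h; have := hx 0; rewrite normC_normc ltcR => /ltW.
Qed.

Lemma holo_atP (a : 'rV[CK]_1) g :
  (exists c, \forall x \near a, @power_series_sum CK 1 c a x (g (x 0 0))) <->
  holo_at (a 0 0) g.
Proof.
split=> [[c /nbhs_rowCP [r r0 h]]|[r [B [h [r0 [c [hB hc]] hE]]]]].
  have hs z : normc (z - a 0 0) <= r -> has_sum (fun m => c m * mono (fun=> z - a 0 0) m) (g z).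
    move=> hz; have := h (const_mx z); rewrite mxE => /(_ hz) /partial_sum_cvgC.
    apply: eq_has_sum => m; congr (_ * _); apply: eq_bigr => i _.
    by rewrite (ord1 i) mxE.
  have hr : normc ((a 0 0 + r%:C) - a 0 0) <= r.
    by rewrite addrAC subrr add0r normc_real ger0_norm // ltW.
  have [|B [h' hh']] := @ps_of_point R 1 c r (g (a 0 0 + r%:C)) r0.
    apply: eq_has_sum (hs _ hr) => m; congr (_ * _); apply: eq_bigr => i _.
    by rewrite addrAC subrr add0r.
  exists r, B, h'; split=> //; first by exists c.
  move=> z hz; apply: has_sum_unique (hs z hz); apply: hh'.2 => i //.
exists c; apply/nbhs_rowCP; exists r => // x hx; apply/partial_sum_cvgC.
rewrite -(hE _ hx).
have hp : polydisc r (fun _ : 'I_1 => x 0 0 - a 0 0) by [].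
apply: eq_has_sum (hc _ hp) => m; congr (_ * _); apply: eq_bigr => i _.
by rewrite (ord1 i).
Qed.

Lemma calgebraic_atP (a : 'rV[CK]_1) g :
  (exists2 P : mpoly.mpoly (1 + 1) C, P != 0 & \forall x \near a,
     mpoly.meval (fun i => row_mx x (g (x 0 0))%:M 0 i) P = 0) <->
  calgebraic_at (a 0 0) g.
Proof.
have rowE (x : 'rV[CK]_1) : (fun i => x 0 i) = (fun _ : 'I_1 => x 0 0).
  by apply/funext => i; rewrite (ord1 i).
split=> [[P P0 /nbhs_rowCP [e e0 h]]|[P P0 [e e0 h]]].
  exists (poly_of_mpoly C 1 P); first by rewrite -mpoly_of_poly_eq0 poly_of_mpolyK.
  exists e => // z hz; have := h (const_mx z); rewrite mxE => /(_ hz).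
  rewrite -{1}(poly_of_mpolyK P) meval_mpoly_of_poly.
  suff -> : (const_mx z : 'rV[CK]_1) 0 = (fun=> z) by [].
  by apply/funext => i; rewrite mxE.
exists (mpoly_of_poly P); first by rewrite mpoly_of_poly_eq0.
apply/nbhs_rowCP; exists e => // x /h; rewrite meval_mpoly_of_poly => <-.
by suff -> : x 0 = (fun _ : 'I_1 => x 0 0) by []; exact: rowE.
Qed.

Definition disc_open (D : set C) : Prop :=
  forall z, D z -> exists2 e : R, 0 < e & forall w, normc (w - z) <= e -> D w.

Lemma open_disc_open (D : set C^o) : open D -> disc_open D.
Proof.
rewrite openE => oD z /oD /nbhs_ballP [e /= e0 h].
have [d d0 ed] := posC_real e0; exists (d / 2); first by rewrite divr_gt0.
move=> w hw; apply: h; rewrite /ball /= ed -opprB normrN normC_normc ltcR.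
by apply: le_lt_trans hw _; rewrite ltr_pdivrMr // ltr_pMr // ltr1n.
Qed.

Lemma nash1P (D : set C) g : disc_open D ->
  @nash1 CK D g <-> forall z, D z -> cnash_at z g.
Proof.
move=> oD; split=> [hN z Dz|h x0 Dx0].
  have Da : [set v : 'rV[CK]_1 | D (v 0 0)] (const_mx z) by rewrite /= mxE.
  have [U' [oU' U'a sub han [P P0 hP]]] := hN _ Da; split.
    by have := holo_atP (const_mx z) g; rewrite mxE => <-; exact: han.
  have := calgebraic_atP (const_mx z) g; rewrite mxE => <-; exists P => //.
  by apply: filterS (open_nbhs_nbhs (conj oU' U'a)) => x /hP.
have [/holo_atP _ /calgebraic_atP [P P0 hP]] := h _ Dx0.
pose S := [set v : 'rV[CK]_1 | D (v 0 0)] `&`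
  [set x | mpoly.meval (fun i => row_mx x (g (x 0 0))%:M 0 i) P = 0].
exists (interior S); split.
- exact: open_interior.
- apply: filterI => //; apply/nbhs_rowCP; have [e e0 he] := oD _ Dx0.
  by exists e => // x; exact: he.
- by move=> x /interior_subset [].
- by move=> a /interior_subset [/h [/holo_atP]].
- by exists P => // x /interior_subset [].
Qed.

(** Multi-indices in one variable are functions on ['I_1]; this lemma and [nat_ps] translate to
    natural exponents. *)
Lemma ps_nat r B (h : ('I_1 -> C) -> C) : ps r B h -> exists c : nat -> C,
  sum_bounded (fun k => c k * (r ^+ k)%:C) B /\
  forall w, normc w <= r -> has_sum (fun k => c k * w ^+ k) (h (fun=> w)).
Proof.
move=> [c [hB hc]]; pose p (k : nat) : {ffun 'I_1 -> nat} := [ffun=> k].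
have pinj : injective p by move=> k l /ffunP /(_ 0); rewrite !ffunE.
have psurj m : exists k, m = p k.
  by exists (m 0); apply/ffunP => i; rewrite ffunE (ord1 i).
exists (c \o p); split.
  apply: sum_bounded_dom (sum_bounded_reindex pinj hB) => k /=.
  by rewrite /mdegree big_ord1 ffunE.
move=> w hw; have hp : polydisc r (fun _ : 'I_1 => w) by [].
have := hc _ hp => /(@has_sum_reindex R _ _ p _ _ pinj) H.
have {}H := H _; apply: eq_has_sum (H _) => [k|m hm].
  by rewrite /mono big_ord1 ffunE.
by have [k mk] := psurj m; case: (hm k).
Qed.

Lemma nat_ps r B (c : nat -> C) (G : C -> C) : 0 < r ->
  sum_bounded (fun k => c k * (r ^+ k)%:C) B ->
  (forall w, normc w <= r -> has_sum (fun k => c k * w ^+ k) (G w)) ->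
  ps r B (fun y : 'I_1 -> C => G (y 0)).
Proof.
move=> r0 hB hG; apply: (@ps_generalized R 1 _ c (fun k => [ffun=> k])) => //.
  by apply: sum_bounded_dom hB => k; rewrite /mdegree big_ord1 ffunE.
move=> y hy; apply: eq_has_sum (hG _ (hy 0)) => k.
by rewrite /mono big_ord1 ffunE.
Qed.

End ComplexGerms.

(** * Slice functions and their components *)

Lemma mul_complexE (R : realType) (a b c d : R) :
  (a +i* b) * (c +i* d) = (a * c - b * d) +i* (a * d + b * c) :> R[i].
Proof. by []. Qed.

Lemma add_complexE (R : realType) (a b c d : R) :
  (a +i* b) + (c +i* d) = (a + c) +i* (b + d) :> R[i].
Proof. by []. Qed.

Lemma opp_complexE (R : realType) (a b : R) : - (a +i* b) = (- a) +i* (- b) :> R[i].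
Proof. by []. Qed.

Section SliceFunctions.
Variables (R : realType) (A : hypercomplex).
Local Notation C := (R[i]).
Local Notation AA := ('rV[R]_(dA A).+1).
Local Notation "x ** y" := (amul x y) (at level 40, left associativity).
Local Notation one := (aone R A).
Implicit Types (I : AA) (x y : AA).

Lemma phi_re I z : imag_unit I -> phi I z 0 0 = complex.Re z.
Proof. by move=> /imag_unitP [h _]; rewrite !mxE h eqxx mulr0 mulr1 addr0. Qed.

Lemma anorm2Z a x : anorm2 (a *: x) = a ^+ 2 * anorm2 x.
Proof. by rewrite /anorm2 mulr_sumr; apply: eq_bigr => i _; rewrite mxE exprMn. Qed.

(** The real part is the coordinate of 1, and the norm determines the imaginary part up to sign. *)
Lemma phi_eq I I' (z z' : C) : imag_unit I -> imag_unit I' ->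
  phi I z = phi I' z' -> z' = z \/ z' = conjc z.
Proof.
move=> hI hI' h; have hre : complex.Re z' = complex.Re z.
  by rewrite -(phi_re z hI) h (phi_re z' hI').
have him : complex.Im z *: I = complex.Im z' *: I'.
  by move: h; rewrite /phi hre => /addrI.
have := congr1 (@anorm2 R _) him; rewrite !anorm2Z.
have /imag_unitP [_ ->] := hI; have /imag_unitP [_ ->] := hI'; rewrite !mulr1 => /eqP.
rewrite eqf_sqr; case: z z' hre {h him} => a b [a' b'] /= -> /orP[/eqP ->|/eqP ->].
  by left.
by right; rewrite opprK.
Qed.

Lemma circularizationP (D : set C^o) I z : conj_invariant D -> imag_unit I ->
  circularization (A := A) D (phi I z) <-> D z.
Proof.
move=> cD hI; split=> [[z' [I' [Dz' hI' h]]]|Dz]; last by exists z, I.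
have [->|->//] := phi_eq hI' hI (esym h); first by [].
exact: cD.
Qed.

Section Coordinates.
Variables (I : AA) (J : 'I_(uA A).+1 -> AA).
Hypothesis hIJ : splitting_base I J.

Lemma CI_combD c c' : CI_comb I J (c + c') = CI_comb I J c + CI_comb I J c'.
Proof.
rewrite /CI_comb -big_split; apply: eq_bigr => k _ /=; rewrite -amulDl !mxE /phi.
congr (_ ** _); case: (c 0 k) (c' 0 k) => a b [a' b'] /=.
by rewrite !scalerDl addrACA.
Qed.

Lemma CI_combZ (a : R) c : CI_comb I J (a%:C *: c) = a *: CI_comb I J c.
Proof.
rewrite /CI_comb scaler_sumr; apply: eq_bigr => k _ /=; rewrite -amulZl !mxE /phi.
congr (_ ** _); case: (c 0 k) => b b' /=.
by rewrite !mul0r subr0 addr0 scalerDr !scalerA.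
Qed.

(** Complex linearity rests on I (I y) = - y. *)
Lemma CI_combi c : CI_comb I J ('i%C *: c) = I ** CI_comb I J c.
Proof.
have [hI _ _] := hIJ; rewrite /CI_comb amul_sumr; apply: eq_bigr => k _; rewrite mxE /phi.
case: (c 0 k) => b b' /=; rewrite !mul0r !mul1r sub0r add0r.
rewrite !amulDl !amulZl amul1l amulDr !amulZr amul_imag_unit //.
by rewrite scalerN scaleNr addrC.
Qed.

Lemma CI_coordK x : CI_comb I J (CI_coord I J x) = x.
Proof.
have [_ _ [_ surj]] := hIJ; have [c hc] := surj x.
by rewrite /CI_coord; case: xgetP => [c' _ /= <-//|/(_ c)/=]; rewrite hc.
Qed.

Lemma CI_combK c : CI_coord I J (CI_comb I J c) = c.
Proof.
have [_ _ [inj _]] := hIJ; apply/eqP; rewrite -subr_eq0; apply/eqP; apply: inj.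
have -> : CI_coord I J (CI_comb I J c) - c = CI_coord I J (CI_comb I J c) + (-1)%:C *: c.
  by rewrite rmorphN1 scaleN1r.
by rewrite CI_combD CI_combZ CI_coordK scaleN1r subrr.
Qed.

Lemma CI_coordD x y : CI_coord I J (x + y) = CI_coord I J x + CI_coord I J y.
Proof. by rewrite -[RHS]CI_combK CI_combD !CI_coordK. Qed.

Lemma CI_coordZ (a : R) x : CI_coord I J (a *: x) = a%:C *: CI_coord I J x.
Proof. by rewrite -[RHS]CI_combK CI_combZ !CI_coordK. Qed.

Lemma CI_coordN x : CI_coord I J (- x) = - CI_coord I J x.
Proof. by rewrite -scaleN1r CI_coordZ rmorphN1 scaleN1r. Qed.

Lemma CI_coordi x : CI_coord I J (I ** x) = 'i%C *: CI_coord I J x.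
Proof. by rewrite -[RHS]CI_combK CI_combi !CI_coordK. Qed.

Lemma CI_coord_sum (T : Type) (s : seq T) (x : T -> AA) :
  CI_coord I J (\sum_(t <- s) x t) = \sum_(t <- s) CI_coord I J (x t).
Proof.
elim: s => [|t s IH]; last by rewrite !big_cons CI_coordD IH.
by rewrite !big_nil -(scale0r 0) CI_coordZ rmorph0 scale0r.
Qed.

Lemma CI_real_expansion x : x = \sum_k (complex.Re (CI_coord I J x 0 k) *: J k +
   complex.Im (CI_coord I J x 0 k) *: (I ** J k)).
Proof.
rewrite -{1}(CI_coordK x) /CI_comb; apply: eq_bigr => k _.
by rewrite /phi amulDl !amulZl amul1l.
Qed.

End Coordinates.

Section Stem.
Variables (Omega : set AA) (f : AA -> AA) (D : set C^o) (F : C^o -> AA * AA).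
Hypothesis hF : induced_by Omega f D F.

Lemma stem_disc_open : disc_open D.
Proof. by have [[oD _ _] _ _] := hF; exact: open_disc_open. Qed.

Lemma slice_domainE I : imag_unit I -> slice_domain Omega I = D.
Proof.
have [[_ cD _] OD _] := hF => hI; apply/seteqP; split=> z; rewrite /slice_domain /= OD.
  by move/(circularizationP z cD hI).
by move=> Dz; apply/(circularizationP z cD hI).
Qed.

Definition stem_cnash I J := forall k z, D z ->
  cnash_at z (stem_comp1 I J F k) /\ cnash_at z (stem_comp2 I J F k).

Lemma slice_compE I J k z : splitting_base I J -> D z ->
  slice_comp f I J k z = stem_comp1 I J F k z + 'i%C * stem_comp2 I J F k z.
Proof.
move=> hIJ Dz; have [hI _ _] := hIJ; have [_ _ hf] := hF.
rewrite /slice_comp hf // CI_coordD // CI_coordi // !mxE /stem_comp1 /stem_comp2.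
case: (CI_coord I J (F z).1 0 k) (CI_coord I J (F z).2 0 k) => a b [c d].
rewrite !mul_complexE !add_complexE /=.
by congr (_ +i* _); ring.
Qed.

Lemma stem_comp1_conj I J k z : splitting_base I J -> D z ->
  conjc (stem_comp1 I J F k (conjc z)) = stem_comp1 I J F k z.
Proof.
move=> hIJ Dz; have [[_ _ cF] _ _] := hF; rewrite /stem_comp1 cF // /conjAC /=.
by rewrite CI_coordN // mxE; case: (CI_coord _ _ (F z).2 0 k) => a b /=; rewrite opprK.
Qed.

Lemma stem_comp2_conj I J k z : splitting_base I J -> D z ->
  conjc (stem_comp2 I J F k (conjc z)) = stem_comp2 I J F k z.
Proof.
move=> hIJ Dz; have [[_ _ cF] _ _] := hF; rewrite /stem_comp2 cF // /conjAC /=.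
by rewrite CI_coordN // mxE; case: (CI_coord _ _ (F z).2 0 k) => a b /=; rewrite opprK.
Qed.

Lemma stem_cnash_slice I J : splitting_base I J -> stem_cnash I J ->
  forall k z, D z -> cnash_at z (slice_comp f I J k).
Proof.
move=> hIJ hS k z Dz; have [h1 h2] := hS k z Dz.
have [e e0 he] := stem_disc_open Dz.
apply: eq_cnash_at (cnash_at_add h1 (cnash_at_scale 'i%C h2)).
by exists e => // w /he Dw; rewrite slice_compE.
Qed.

(** With G1 and G2 the stem components, the slice component at z is G1 + i G2, and by the symmetry
    of the stem its reflection is G1 - i G2. Both are Nash, and the system is solved for G1 and
    G2. *)
Lemma slice_stem_cnash I J : splitting_base I J ->
  (forall k z, D z -> cnash_at z (slice_comp f I J k)) -> stem_cnash I J.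
Proof.
move=> hIJ hS k z Dz; have [[_ cD _] _ _] := hF.
have h1 := hS k z Dz.
have h2 : cnash_at z (fun w => conjc (slice_comp f I J k (conjc w))).
  by have := cnash_at_conj (hS k _ (cD _ Dz)); rewrite conjcK.
have [e e0 he] := stem_disc_open Dz.
have key w : normc (w - z) <= e ->
    conjc (slice_comp f I J k (conjc w)) =
    stem_comp1 I J F k w - 'i%C * stem_comp2 I J F k w.
  move=> /he Dw; rewrite slice_compE //; last exact: cD.
  rewrite -(stem_comp1_conj k hIJ Dw) -(stem_comp2_conj k hIJ Dw).
  move: (stem_comp1 _ _ _ _ _) (stem_comp2 _ _ _ _ _) => [a b] [c d].
  rewrite !mul_complexE opp_complexE !add_complexE /= .
  by congr (_ +i* _); ring.
split.
  apply: eq_cnash_at (cnash_at_scale (2^-1) (cnash_at_add h1 h2)); exists e => // w hw.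
  by rewrite key // slice_compE //; [field|exact: he].
have h3 := cnash_at_add h1 (cnash_at_scale (-1) h2).
apply: eq_cnash_at (cnash_at_scale ((2 * 'i%C)^-1) h3); exists e => // w hw.
rewrite key // slice_compE //; last exact: he.
have i0 : ('i%C : C) != 0 by rewrite eq_complex /= oner_eq0 andbF.
by field.
Qed.

(** [p] stands for the real or the imaginary part. A change of splitting base is only real-linear,
    since I and I' act differently, so the two stem components get mixed with real coefficients. *)
Lemma stem_comp_change I J I' J' (p : C -> R) (l : 'I_(uA A).+1) z :
  {morph p : x y / x + y} -> (forall (a : R) c, p (a%:C * c) = a * p c) ->
  splitting_base I J -> splitting_base I' J' ->
  (p (CI_coord I' J' (F z).1 0 l) +i* p (CI_coord I' J' (F z).2 0 l)) =
  \sum_k ((p (CI_coord I' J' (J k) 0 l))%:C * stem_comp1 I J F k z +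
    (p (CI_coord I' J' (I ** J k) 0 l))%:C * stem_comp2 I J F k z).
Proof.
move=> pD pZ hIJ hIJ'.
have p0 : p 0 = 0 by have := pZ 0 0; rewrite mulr0 mul0r.
have psum (T : Type) (s : seq T) (G : T -> C) : p (\sum_(t <- s) G t) = \sum_(t <- s) p (G t).
  by elim: s => [|t s IH]; rewrite ?big_nil // !big_cons pD IH.
have key x : p (CI_coord I' J' x 0 l) =
   \sum_k (complex.Re (CI_coord I J x 0 k) * p (CI_coord I' J' (J k) 0 l) +
     complex.Im (CI_coord I J x 0 k) * p (CI_coord I' J' (I ** J k) 0 l)).
  rewrite {1}(CI_real_expansion hIJ x) CI_coord_sum // summxE psum.
  by apply: eq_bigr => k _; rewrite CI_coordD // !CI_coordZ // !mxE pD !pZ.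
rewrite !key.
have sumC (s : seq 'I_(uA A).+1) (G H : 'I_(uA A).+1 -> R) :
    (\sum_(k <- s) G k) +i* (\sum_(k <- s) H k) = \sum_(k <- s) (G k +i* H k).
  elim: s => [|k s IH]; [by rewrite !big_nil|by rewrite !big_cons -IH].
rewrite sumC; apply: eq_bigr => k _; rewrite /stem_comp1 /stem_comp2.
rewrite !mul_complexE !add_complexE.
by congr (_ +i* _); ring.
Qed.

Lemma stem_cnash_change I J I' J' : splitting_base I J -> splitting_base I' J' ->
  stem_cnash I J -> stem_cnash I' J'.
Proof.
move=> hIJ hIJ' hS l z Dz.
have hp (p : C -> R) : cnash_at z (fun w => \sum_k ((p (CI_coord I' J' (J k) 0 l))%:C * stem_comp1 I J F k w +
    (p (CI_coord I' J' (I ** J k) 0 l))%:C * stem_comp2 I J F k w)).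
  apply: cnash_at_sum => k; have [h1 h2] := hS k z Dz.
  by apply: cnash_at_add; apply: cnash_at_scale.
split.
  apply: eq_cnash_at (hp (@complex.Re R)); exists 1 => // w _; rewrite -stem_comp_change //.
    by move=> [a b] [c d].
  by move=> a [b c] /=; rewrite mul0r subr0.
apply: eq_cnash_at (hp (@complex.Im R)); exists 1 => // w _; rewrite -stem_comp_change //.
  by move=> [a b] [c d].
by move=> a [b c] /=; rewrite mul0r addr0.
Qed.

End Stem.

Lemma slice_nash_splitting (Omega : set AA) (f : AA -> AA) : slice_nash Omega f ->
  exists I J, splitting_base I J /\
    forall k, nash1 (slice_domain Omega I) (slice_comp f I J k).
Proof.
move=> [D [F [hF _ [I [J [hIJ hS]]]]]]; exists I, J; split=> // k.
have [hI _ _] := hIJ; rewrite (slice_domainE hF hI).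
have oD := stem_disc_open hF.
apply/(nash1P _ oD); apply: (stem_cnash_slice hF) => // l z Dz.
by have [/(nash1P _ oD) h1 /(nash1P _ oD) h2] := hS l; split; [exact: h1|exact: h2].
Qed.

Lemma splitting_change (Omega : set AA) (f : AA -> AA) : slice_function Omega f ->
  (exists I J, splitting_base I J /\
    forall k, nash1 (slice_domain Omega I) (slice_comp f I J k)) ->
  forall I J, splitting_base I J ->
    forall k, nash1 (slice_domain Omega I) (slice_comp f I J k).
Proof.
move=> [D [F hF]] [I [J [hIJ hN]]] I' J' hIJ' k.
have [hI _ _] := hIJ; have [hI' _ _] := hIJ'; rewrite (slice_domainE hF hI').
have oD := stem_disc_open hF; apply/(nash1P _ oD).
apply: (stem_cnash_slice hF) => //; apply: (stem_cnash_change hIJ hIJ').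
apply: (slice_stem_cnash hF) => // l; apply/(nash1P _ oD).
by rewrite -(slice_domainE hF hI).
Qed.

End SliceFunctions.

(** * Holomorphy of stem functions *)

Section ComplexDerivative.
Variable R : realType.
Local Notation C := (R[i]).
Implicit Types (z w t : C) (g : C -> C).

(** A quadratic remainder instead of a little-o: power series satisfy it, and explicit constants
    postpone limits until [derive_bound]. *)
Definition has_cderiv g z l : Prop := exists2 K : R, 0 <= K & exists2 e : R, 0 < e &
  forall t, normc t <= e -> normc (g (z + t) - g z - t * l) <= K * normc t ^+ 2.

(** The last clause, a Lipschitz bound for the derivative at [z0], is the source of the C^1 property
    of stem functions. *)
Lemma holo_at_deriv z0 g : holo_at z0 g -> exists (g' : C -> C) (rho K : R),
  [/\ 0 < rho, 0 <= K, (forall w, normc (w - z0) <= rho -> has_cderiv g w (g' w)) &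
      (forall w, normc (w - z0) <= rho -> normc (g' w - g' z0) <= K * normc (w - z0))].
Proof.
move=> [r [B [h [r0 [c hc] hE]]]].
have [h' [B' [hc' [K K0 hK]]]] := ps_deriv 0 r0 hc.
have r40 : 0 < r / 4 by rewrite divr_gt0.
have rr : r / 4 <= r by rewrite ler_pdivrMr // ler_peMr ?ler1n // ltW.
have hps : ps (r / 4) B' h' by exists (deriv_coef 0 c).
have [K' K'0 hK'] := ps_continuous0 r40 hps.
exists (fun w => h' (fun=> w - z0)), (r / 4 / 2), K'; split=> //.
- by rewrite divr_gt0.
- move=> w hw; exists K => //; exists (r / 4 / 2); first by rewrite divr_gt0.
  move=> t ht; have hwt : normc (w + t - z0) <= r / 4.
    rewrite addrAC [leRHS]splitr; apply: le_trans (ler_normcD _ _) _.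
    exact: lerD.
  have hw4 : normc (w - z0) <= r / 4.
    by apply: le_trans hw _; rewrite ler_pdivrMr // ler_peMr ?ler1n // ltW.
  have hs : shift (fun _ : 'I_1 => w - z0) 0 t = (fun=> w + t - z0).
    by apply/funext => i; rewrite (ord1 i) /shift eqxx addrAC.
  have := hK (fun=> w - z0) t; rewrite hs => H.
  have := H (fun=> hw4) (fun=> hwt); rewrite !hE //; first exact: le_trans hw4 rr.
  exact: le_trans hwt rr.
move=> w hw; have := hK' (normc (w - z0)) (fun=> w - z0) (normc_ge0 _).
have hw4 : normc (w - z0) <= r / 4.
  by apply: le_trans hw _; rewrite ler_pdivrMr // ler_peMr ?ler1n // ltW.
by move=> /(_ hw4 (fun=> lexx _)); rewrite subrr.
Qed.

Lemma has_cderiv_unique g z l l' : has_cderiv g z l -> has_cderiv g z l' -> l = l'.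
Proof.
move=> [K K0 [e e0 h]] [K' K'0 [e' e'0 h']].
apply/eqP; rewrite -subr_eq0; apply/eqP/normc0_eq0 => d d0.
have K1 : 0 < K + K' + 1 by rewrite ltr_wpDl // addr_ge0.
pose s := Num.min (Num.min e e') (d / (K + K' + 1)).
have s0 : 0 < s by rewrite !lt_min e0 e'0 divr_gt0.
have se : s <= e by rewrite !ge_min lexx.
have se' : s <= e' by rewrite !ge_min lexx !orbT.
have sd : s <= d / (K + K' + 1) by rewrite !ge_min lexx !orbT.
have ns : normc s%:C = s by rewrite normc_real ger0_norm // ltW.
have h1 := h s%:C; have h2 := h' s%:C; rewrite ns in h1 h2.
have := lerD (h1 se) (h2 se').
have := ler_normcD (- (g (z + s%:C) - g z - s%:C * l)) (g (z + s%:C) - g z - s%:C * l').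
rewrite normcN' => H H'; have {H H'} := le_trans H H'.
have -> : - (g (z + s%:C) - g z - s%:C * l) + (g (z + s%:C) - g z - s%:C * l') = s%:C * (l - l') by ring.
rewrite normcM ns -mulrDl expr2 mulrCA ler_pM2l // => /le_trans; apply.
rewrite ler_pdivlMr // mulrC in sd; apply: le_trans sd.
by rewrite ler_wpM2r ?(ltW s0) // lerDl.
Qed.

End ComplexDerivative.

Section DeriveBound.
Variables (R : realType) (V : normedModType R).

Lemma derive_bound (f : R -> V) (a : R) (l : V) (K e : R) : 0 <= K -> 0 < e ->
  (forall h : R, `|h| <= e -> `|f (a + h) - f a - h *: l| <= K * `|h| ^+ 2) ->
  derivable f a 1 /\ 'D_1 f a = l.
Proof.
move=> K0 e0 hf.
have cvgl : (fun h : R => h^-1 *: (f (h *: (1 : R) + a) - f a)) @ 0^' --> l.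
  apply/cvgrPdist_le => d d0.
  have K1 : 0 < K + 1 by rewrite ltr_wpDl.
  near=> h.
  have h0 : h != 0 by near: h; exact: nbhs_dnbhs_neq.
  have he : `|h| <= Num.min e (d / (K + 1)).
    near: h; apply: dnbhs0_le; by rewrite lt_min e0 divr_gt0.
  move: he; rewrite le_min => /andP[he hd].
  rewrite distrC -[l](scalerK h0) -scalerBr normrZ normfV.
  have hh : 0 < `|h| by rewrite normr_gt0.
  rewrite ler_pdivrMl //; have := hf h he.
  rewrite [h *: 1]mulr1 [h + a]addrC => /le_trans; apply.
  rewrite expr2 mulrCA ler_wpM2l // ?normr_ge0 //.
  move: hd; rewrite ler_pdivlMr // mulrC => hd; apply: le_trans hd.
  by rewrite ler_wpM2r // lerDl.
split; first by apply/cvg_ex; exists l.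
by apply/cvg_lim.
Unshelve. all: by end_near.
Qed.

End DeriveBound.

Section Holomorphy.
Variables (R : realType) (A : hypercomplex).
Local Notation C := (R[i]).
Local Notation AA := ('rV[R]_(dA A).+1).
Local Notation "x ** y" := (amul x y) (at level 40, left associativity).
Variables (I : AA) (J : 'I_(uA A).+1 -> AA).

(** Inverse of taking stem components: real parts of the components feed F_1, imaginary parts F_2.
    Being real-linear, it carries derivatives of the components over to F, with [assemble_norm]
    controlling the error. *)
Definition assemble (c1 c2 : 'I_(uA A).+1 -> C) : AA * AA :=
  \sum_k (complex.Re (c1 k) *: (J k, 0) + complex.Re (c2 k) *: (I ** J k, 0) +
    (complex.Im (c1 k) *: (0, J k) + complex.Im (c2 k) *: (0, I ** J k))).

Definition assemble_norm : R :=
  \sum_k (`|(J k, 0 : AA)| + `|(I ** J k, 0 : AA)| + (`|(0 : AA, J k)| + `|(0 : AA, I ** J k)|)).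

Lemma assembleD c1 c2 c1' c2' : assemble c1 c2 + assemble c1' c2' =
  assemble (fun k => c1 k + c1' k) (fun k => c2 k + c2' k).
Proof.
rewrite /assemble -big_split; apply: eq_bigr => k _ /=.
rewrite !raddfD !scalerDl /=.
by rewrite [LHS]addrACA; congr (_ + _); rewrite addrACA.
Qed.

Lemma assembleZ (a : R) c1 c2 : a *: assemble c1 c2 =
  assemble (fun k => a%:C * c1 k) (fun k => a%:C * c2 k).
Proof.
rewrite /assemble scaler_sumr; apply: eq_bigr => k _.
rewrite !scalerDr !scalerA.
by case: (c1 k) (c2 k) => u v [u' v']; rewrite /= !mul0r !subr0 !addr0.
Qed.

Lemma assembleN c1 c2 : - assemble c1 c2 = assemble (fun k => - c1 k) (fun k => - c2 k).
Proof.
rewrite -scaleN1r assembleZ; congr assemble; apply/funext => k;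
  by rewrite rmorphN1 mulN1r.
Qed.

Lemma assemble_le c1 c2 (B : R) : 0 <= B -> (forall k, normc (c1 k) <= B) ->
  (forall k, normc (c2 k) <= B) -> `|assemble c1 c2| <= B * assemble_norm.
Proof.
move=> B0 h1 h2; rewrite /assemble /assemble_norm mulr_sumr.
apply: le_trans (ler_norm_sum _ _ _) _; apply: ler_sum => k _.
have key (x : R) (v : AA * AA) : `|x| <= B -> `|x *: v| <= B * `|v|.
  by move=> hx; rewrite normrZ ler_wpM2r.
rewrite !mulrDr; apply: le_trans (ler_normD _ _) (lerD _ _);
  apply: le_trans (ler_normD _ _) (lerD _ _); apply: key.
- exact: le_trans (Re_le_normc _) (h1 k).
- exact: le_trans (Re_le_normc _) (h2 k).
- exact: le_trans (Im_le_normc _) (h1 k).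
- exact: le_trans (Im_le_normc _) (h2 k).
Qed.

(** On components iota is multiplication by i, so the second term carries i^2 = -1 and cancels the
    first. *)
Lemma assemble_CR c1 c2 :
  assemble c1 c2 + iotaAC (assemble (fun k => 'i%C * c1 k) (fun k => 'i%C * c2 k)) = 0.
Proof.
have pairE c c' : assemble c c' = (\sum_k (complex.Re (c k) *: J k + complex.Re (c' k) *: (I ** J k)),
   \sum_k (complex.Im (c k) *: J k + complex.Im (c' k) *: (I ** J k))).
  rewrite /assemble; elim/big_rec3: _ => [//|k x y z _ ->].
  congr (_, _) => /=; first by rewrite !scaler0 !addr0.
  by rewrite !scaler0 addr0 add0r.
rewrite !pairE /iotaAC /=; congr (_, _) => /=.
  rewrite -sumrN -big_split big1 // => k _ /=.
  by case: (c1 k) (c2 k) => u v [u' v'] /=; rewrite !mul0r !mul1r !add0r subrr.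
rewrite -big_split big1 // => k _ /=.
case: (c1 k) (c2 k) => u v [u' v'] /=; rewrite !mul0r !mul1r !sub0r.
by rewrite !scaleNr addrACA !subrr addr0.
Qed.

Variables (D : set C^o) (F : C^o -> AA * AA).
Hypotheses (hIJ : splitting_base I J) (oD : disc_open D).
Hypothesis hS : stem_cnash D F I J.

Lemma assemble_stem z : F z =
  assemble (fun k => stem_comp1 I J F k z) (fun k => stem_comp2 I J F k z).
Proof.
rewrite /assemble; apply: injective_projections => /=.
  rewrite (raddf_sum fst) {1}(CI_real_expansion hIJ (F z).1); apply: eq_bigr => k _ /=.
  by rewrite !scaler0 !addr0.
rewrite (raddf_sum snd) {1}(CI_real_expansion hIJ (F z).2); apply: eq_bigr => k _ /=.
by rewrite !scaler0 !add0r.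
Qed.

Lemma stem_deriv_exists : exists g1 g2 : 'I_(uA A).+1 -> C -> C,
  forall k z, D z -> has_cderiv (stem_comp1 I J F k) z (g1 k z) /\
     has_cderiv (stem_comp2 I J F k) z (g2 k z).
Proof.
(* Outside [D] the default (0, 0) makes the choice total. *)
have h z k : exists l : C * C, D z -> has_cderiv (stem_comp1 I J F k) z l.1 /\
     has_cderiv (stem_comp2 I J F k) z l.2.
  case: (pselect (D z)) => Dz; last by exists (0, 0).
  have [[/holo_at_deriv [a [r [K [r0 _ ha _]]]] _] [/holo_at_deriv [b [r' [K' [r'0 _ hb _]]]] _]] := hS k Dz.
  exists (a z, b z) => _ /=; split; [apply: ha|apply: hb]; rewrite subrr normc0 ltW //.
have h' (z : C) : exists f : 'I_(uA A).+1 -> C * C, forall k, D z ->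
     has_cderiv (stem_comp1 I J F k) z (f k).1 /\ has_cderiv (stem_comp2 I J F k) z (f k).2.
  by have [f hf] := choice (h z); exists f.
have [G hG] := choice h'.
exists (fun k z => (G z k).1), (fun k z => (G z k).2) => k z Dz.
by have := hG z k Dz.
Qed.

Lemma finite_min (T : finType) (e : T -> R) : (forall i, 0 < e i) ->
  exists2 d : R, 0 < d & forall i, d <= e i.
Proof.
move=> he; exists (\big[Num.min/1]_i e i).
  by elim/big_ind : _ => // x y hx hy; rewrite lt_min hx.
by move=> i; rewrite (bigD1 i) //= ge_min lexx.
Qed.

Lemma finite_max (T : finType) (e : T -> R) : (forall i, 0 <= e i) ->
  exists2 d : R, 0 <= d & forall i, e i <= d.
Proof.
move=> he; exists (\sum_i e i); first exact: sumr_ge0.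
by move=> i; rewrite (bigD1 i) //= lerDl sumr_ge0.
Qed.

Lemma stem_deriv_bound (g1 g2 : 'I_(uA A).+1 -> C -> C) z :
  (forall k z, D z -> has_cderiv (stem_comp1 I J F k) z (g1 k z) /\
     has_cderiv (stem_comp2 I J F k) z (g2 k z)) -> D z ->
  exists2 K : R, 0 <= K & exists2 e : R, 0 < e & forall t, normc t <= e ->
   `|F (z + t) - F z - assemble (fun k => t * g1 k z) (fun k => t * g2 k z)| <= K * normc t ^+ 2.
Proof.
move=> hg Dz.
have h k : exists Ke : R * R, [/\ 0 <= Ke.1, 0 < Ke.2 & forall t, normc t <= Ke.2 ->
    normc (stem_comp1 I J F k (z + t) - stem_comp1 I J F k z - t * g1 k z) <= Ke.1 * normc t ^+ 2 /\
    normc (stem_comp2 I J F k (z + t) - stem_comp2 I J F k z - t * g2 k z) <= Ke.1 * normc t ^+ 2].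
  have [[K K0 [e e0 h]] [K' K'0 [e' e'0 h']]] := hg k z Dz.
  exists (K + K', Num.min e e'); split=> /=; first exact: addr_ge0.
    by rewrite lt_min e0.
  move=> t; rewrite le_min => /andP[te te'].
  have t0 : 0 <= normc t ^+ 2 by rewrite exprn_ge0 ?normc_ge0.
  split; [apply: le_trans (h t te) _|apply: le_trans (h' t te') _];
    rewrite ler_wpM2r // ?lerDl ?lerDr //.
have [Ke hKe] := choice h.
have [e e0 he] : exists2 e : R, 0 < e & forall k, e <= (Ke k).2.
  by apply: finite_min => k; have [] := hKe k.
have [K K0 hK] : exists2 K : R, 0 <= K & forall k, (Ke k).1 <= K.
  by apply: finite_max => k; have [] := hKe k.
exists (K * assemble_norm).
  rewrite mulr_ge0 // /assemble_norm; apply: sumr_ge0 => k _.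
  by rewrite !addr_ge0.
exists e => // t te; rewrite !assemble_stem !assembleN !assembleD mulrAC.
have t0 : 0 <= normc t ^+ 2 by rewrite exprn_ge0 ?normc_ge0.
apply: assemble_le => [|k|k]; first exact: mulr_ge0.
  have [_ _ /(_ t (le_trans te (he k))) [h1 _]] := hKe k.
  by apply: le_trans h1 _; rewrite ler_wpM2r.
have [_ _ /(_ t (le_trans te (he k))) [_ h1]] := hKe k.
by apply: le_trans h1 _; rewrite ler_wpM2r.
Qed.

(** The partial derivatives of F are assembled from the complex derivatives of the components,
    multiplied by 1 and by i respectively. *)
Lemma stem_cnash_holomorphic : holomorphic_on D F.
Proof.
have [g1 [g2 hg]] := stem_deriv_exists.
have hre z : D z -> derivable (re_line F z) (complex.Re z) 1 /\
    d_re F z = assemble (g1 ^~ z) (g2 ^~ z).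
  move=> Dz; have [K K0 [e e0 h]] := stem_deriv_bound hg Dz.
  apply: (@derive_bound _ _ _ _ _ K e) => // t te.
  have := h t%:C; rewrite normc_real => /(_ te); rewrite /re_line -assembleZ.
  suff [-> ->] : (complex.Re z + t) +i* complex.Im z = z + t%:C /\
    complex.Re z +i* complex.Im z = z by [].
  by case: z {Dz h} => a b; split=> //=; rewrite add_complexE addr0.
have him z : D z -> derivable (im_line F z) (complex.Im z) 1 /\
    d_im F z = assemble (fun k => 'i%C * g1 k z) (fun k => 'i%C * g2 k z).
  move=> Dz; have [K K0 [e e0 h]] := stem_deriv_bound hg Dz.
  apply: (@derive_bound _ _ _ _ _ K e) => // t te.
  have i1 : normc ('i%C : C) = 1 by rewrite /normc /= expr0n add0r expr1n sqrtr1.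
  have := h (t%:C * 'i%C); rewrite normcM normc_real i1 mulr1 => /(_ te).
  rewrite /im_line assembleZ.
  have -> : (fun k => t%:C * ('i%C * g1 k z)) = (fun k => t%:C * 'i%C * g1 k z).
    by apply/funext => k; rewrite mulrA.
  have -> : (fun k => t%:C * ('i%C * g2 k z)) = (fun k => t%:C * 'i%C * g2 k z).
    by apply/funext => k; rewrite mulrA.
  suff [-> ->] : complex.Re z +i* (complex.Im z + t) = z + t%:C * 'i%C /\
    complex.Re z +i* complex.Im z = z by [].
  case: z {Dz h} => a b; split=> //=; rewrite mul_complexE add_complexE.
  by congr (_ +i* _); ring.
have cont z (k : 'I_(uA A).+1) : D z -> exists K e : R, [/\ 0 <= K, 0 < e &
   forall w, normc (w - z) <= e -> D w /\
     (normc (g1 k w - g1 k z) <= K * normc (w - z) /\ normc (g2 k w - g2 k z) <= K * normc (w - z))].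
  move=> Dz; have [e1 e10 he1] := oD Dz.
  have [[/holo_at_deriv [a [r [K [r0 K0 ha ha']]]] _] [/holo_at_deriv [b [r' [K' [r'0 K'0 hb hb']]]] _]] := hS k Dz.
  exists (K + K'), (Num.min e1 (Num.min r r')); split; first exact: addr_ge0.
    by rewrite !lt_min e10 r0.
  move=> w; rewrite !le_min => /and3P[we wr wr']; have Dw := he1 w we; split=> //.
  have z0 (s : R) : 0 < s -> normc (z - z) <= s by move=> s0; rewrite subrr normc0 ltW.
  (* [g1] comes from choice at each point; uniqueness of derivatives identifies it near [z] with the
     derivative of a single power series, which yields continuity. *)
  have aE v : normc (v - z) <= r -> D v -> g1 k v = a v.
    by move=> hv Dv; apply: has_cderiv_unique (hg k v Dv).1 (ha v hv).
  have bE v : normc (v - z) <= r' -> D v -> g2 k v = b v.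
    by move=> hv Dv; apply: has_cderiv_unique (hg k v Dv).2 (hb v hv).
  rewrite !aE ?z0 // !bE ?z0 //; split.
    by apply: le_trans (ha' w wr) _; rewrite ler_wpM2r ?normc_ge0 // lerDl.
  by apply: le_trans (hb' w wr') _; rewrite ler_wpM2r ?normc_ge0 // lerDr.
(* To be used with u = 1 for [d_re] and u = i for [d_im]. *)
have contL (u : C) (d : C^o -> AA * AA) (z : C^o) : normc u = 1 -> D z ->
    (forall w, D w -> d w = assemble (fun k => u * g1 k w) (fun k => u * g2 k w)) ->
    {for z, continuous d}.
  move=> u1 Dz hd.
  have h k : exists Ke : R * R, [/\ 0 <= Ke.1, 0 < Ke.2 & forall w, normc (w - z) <= Ke.2 -> D w /\
     (normc (g1 k w - g1 k z) <= Ke.1 * normc (w - z) /\ normc (g2 k w - g2 k z) <= Ke.1 * normc (w - z))].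
    by have [K [e h]] := cont z k Dz; exists (K, e).
  have [Ke hKe] := choice h.
  have [e e0 he] : exists2 e : R, 0 < e & forall k, e <= (Ke k).2.
    by apply: finite_min => k; have [] := hKe k.
  have [K K0 hK] : exists2 K : R, 0 <= K & forall k, (Ke k).1 <= K.
    by apply: finite_max => k; have [] := hKe k.
  have N0 : 0 <= assemble_norm.
    by rewrite /assemble_norm; apply: sumr_ge0 => k _; rewrite !addr_ge0.
  have K1 : 0 < K * assemble_norm + 1 by rewrite ltr_wpDl // mulr_ge0.
  apply/(@cvgrPdist_le _ _ _ _ (@nbhs_filter C^o z)) => eps eps0; apply/nbhs_ballP.
  exists (Num.min e (eps / (K * assemble_norm + 1)))%:C; first by rewrite /= ltcR lt_min e0 divr_gt0.
  move=> w; rewrite /ball /= -opprB normrN normC_normc ltcR lt_min => /andP[/ltW we /ltW weps].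
  have Dw : D w by have [_ _ /(_ w (le_trans we (he ord0))) []] := hKe ord0.
  rewrite distrC !hd // assembleN assembleD.
  have := @assemble_le (fun k => u * g1 k w - u * g1 k z) (fun k => u * g2 k w - u * g2 k z)
    (K * normc (w - z)).
  rewrite mulr_ge0 ?normc_ge0 // => /(_ isT) H; apply: le_trans (H _ _) _ => [k|k|].
  - rewrite -mulrBr normcM u1 mul1r; have [_ _ /(_ w (le_trans we (he k))) [_ [h1 _]]] := hKe k.
    by apply: le_trans h1 _; rewrite ler_wpM2r ?normc_ge0.
  - rewrite -mulrBr normcM u1 mul1r; have [_ _ /(_ w (le_trans we (he k))) [_ [_ h1]]] := hKe k.
    by apply: le_trans h1 _; rewrite ler_wpM2r ?normc_ge0.
  move: weps; rewrite ler_pdivlMr // => weps; apply: le_trans weps.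
  by rewrite mulrAC mulrC ler_wpM2l ?normc_ge0 // lerDl.
split=> [z Dz|z Dz]; last by rewrite (hre z Dz).2 (him z Dz).2 assemble_CR.
split; [exact: (hre z Dz).1|exact: (him z Dz).1| |].
- apply: (contL 1) => //; first exact: normc1.
  move=> w Dw; rewrite (hre w Dw).2; congr assemble; apply/funext => k; by rewrite mul1r.
- apply: (contL 'i%C) => //; last by move=> w Dw; rewrite (him w Dw).2.
  by rewrite /normc /= expr0n add0r expr1n sqrtr1.
Qed.

End Holomorphy.

(** * Real Nash functions from complex ones *)

Section AnalyticComposition.
Variables (R : realType) (n : nat).
Local Notation C := (R[i]).
Implicit Types (a x : 'rV[R]_n) (g u : 'rV[R]_n -> C).

Lemma diffC0 a : diffC a a = (fun=> 0).
Proof. by apply/funext => i; rewrite /diffC subrr. Qed.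

Lemma box_refl a (e : R) : 0 <= e -> box a e a.
Proof. by move=> e0 i; rewrite subrr normr0. Qed.

(** Preparation for compositions: remove the constant term, then shrink the radius until [ps_small]
    brings the bound below [d]. *)
Lemma analytic_at_small a u (d : R) : 0 < d -> analytic_at a u -> exists r h,
  [/\ 0 < r, ps r d h & forall x, box a r x -> h (diffC a x) = u x - u a].
Proof.
move=> d0 [r [B [h [r0 hh hE]]]].
pose h1 y := h y + - h (fun=> 0).
have hh1 : ps r (B + normc (- h (fun=> 0))) h1 by apply: ps_add => //; exact: ps_const.
have h10 : h1 (fun=> 0) = 0 by rewrite /h1 subrr.
set B1 := B + _ in hh1; have B10 : 0 <= B1 by exact: ps_ge0 hh1.
have B11 : 0 < B1 + 1 by rewrite ltr_wpDl.
pose r' := r * Num.min 1 (d / (B1 + 1)).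
have m0 : 0 < Num.min 1 (d / (B1 + 1)) by rewrite lt_min ltr01 divr_gt0.
have r'0 : 0 < r' by rewrite mulr_gt0.
have r'r : r' <= r by rewrite ler_piMr ?(ltW r0) // ge_min lexx.
exists r', h1; split=> //.
  apply: ps_le (ps_small r0 (ltW r'0) r'r h10 hh1).
  rewrite /r' [r * _]mulrC mulfK ?lt0r_neq0 //.
  apply: (@le_trans _ _ (B1 * (d / (B1 + 1)))).
    by rewrite ler_wpM2l // ge_min lexx orbT.
  by rewrite mulrA ler_pdivrMr // mulrC ler_wpM2l ?(ltW d0) // lerDl.
move=> x hx; rewrite /h1 hE; last exact: box_le hx.
by rewrite -(diffC0 a) hE //; apply: box_refl; exact: ltW.
Qed.

Lemma analytic_at_comp_nat a u (s B : R) (c : nat -> C) (G : C -> C) : 0 < s ->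
  sum_bounded (fun k => c k * (s ^+ k)%:C) B ->
  (forall w, normc w <= s -> has_sum (fun k => c k * w ^+ k) (G w)) ->
  analytic_at a u -> analytic_at a (fun x => G (u x - u a)).
Proof.
move=> s0 hB hG /(analytic_at_small s0) [r [h [r0 hh hE]]].
exists r, B, (fun y => G (h y)); split=> //.
  exact: (ps_comp_nat r0 hB hG hh).
by move=> x hx; rewrite hE.
Qed.

Lemma analytic_at_comp a u z0 (G : C -> C) : holo_at z0 G -> analytic_at a u -> u a = z0 ->
  analytic_at a (fun x => G (u x)).
Proof.
move=> [r [B [h [r0 hh hE]]]] hu ua.
have [c [hB hc]] := ps_nat hh.
have [r1 [h1 [r10 hh1 hE1]]] := analytic_at_small r0 hu.
have hcomp := analytic_at_comp_nat r0 hB hc hu.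
apply: eq_analytic_at hcomp; exists r1 => // x hx.
rewrite ua hE // -ua -hE1 //; exact: ps_norm hh1 (polydisc_diffC hx).
Qed.

Lemma analytic_at_scale a c u : analytic_at a u -> analytic_at a (fun x => c * u x).
Proof. by move=> hu; apply: analytic_at_mul hu; exact: analytic_at_const. Qed.

(** 1/u is 1/u(a) times the geometric series at u/u(a) - 1, whose modulus is kept at most 1/2. *)
Lemma analytic_at_inv a u : analytic_at a u -> u a != 0 -> analytic_at a (fun x => (u x)^-1).
Proof.
move=> hu ua; have [G [hG1 hG2]] := geometric_series R.
have hv := analytic_at_scale (u a)^-1 hu.
have h20 : 0 < 2^-1 :> R by rewrite invr_gt0.
have [r1 [h1 [r10 hh1 hE1]]] := analytic_at_small h20 hv.
have hB : exists B, sum_bounded (fun k => (-1) ^+ k * ((2^-1 : R) ^+ k)%:C : C) B.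
  have := hG1 (2^-1 : R)%:C; rewrite normc_real ger0_norm ?(ltW h20) // => /(_ (lexx _)).
  move=> /has_sum_sum_bounded [B hB]; exists B.
  by apply: sum_bounded_dom hB => k; rewrite rmorphXn.
have [B {}hB] := hB.
have hcomp := analytic_at_scale (u a)^-1 (analytic_at_comp_nat h20 hB hG1 hv).
apply: eq_analytic_at hcomp; exists r1 => // x hx; rewrite mulVf //.
have hn : normc ((u a)^-1 * u x - 1) <= 2^-1.
  by rewrite -(mulVf ua) -hE1 //; exact: ps_norm hh1 (polydisc_diffC hx).
have := hG2 _ hn; rewrite [1 + _]addrC subrK => h.
have ux : u x != 0.
  by apply: contraNneq (oner_neq0 C) => ux0; rewrite -h ux0 !mulr0.
apply: (mulIf ux); rewrite mulVf // -mulrA [G _ * _]mulrC.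
by rewrite mulrA [(u a)^-1 * u x * _]mulrC.
Qed.

(** Factor the root as sqrt (g a) times the series at g/g(a) - 1. The radius 1/4 is the range in
    which [sqrt_series] identifies the series with the real root. *)
Lemma analytic_at_sqrt a (g : 'rV[R]_n -> R) : analytic_at a (fun x => (g x)%:C) -> 0 < g a ->
  analytic_at a (fun x => (Num.sqrt (g x))%:C).
Proof.
move=> hg ga; have [G [hG1 hG2 hG3]] := sqrt_series R.
have gaC : (g a)%:C != 0 :> C by rewrite fmorph_eq0 gt_eqF.
have hv := analytic_at_scale ((g a)%:C)^-1 hg.
have h20 : 0 < 2^-1 :> R by rewrite invr_gt0.
have h40 : 0 < 4^-1 :> R by rewrite invr_gt0.
have [r1 [h1 [r10 hh1 hE1]]] := analytic_at_small h40 hv.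
have hcomp := analytic_at_scale (Num.sqrt (g a))%:C
   (analytic_at_comp_nat h20 (@sum_bounded_binom_half R) hG1 hv).
apply: eq_analytic_at hcomp; exists r1 => // x hx.
have hn : normc (((g a)%:C)^-1 * (g x)%:C - ((g a)%:C)^-1 * (g a)%:C) <= 4^-1.
  by rewrite -hE1 //; exact: ps_norm hh1 (polydisc_diffC hx).
have E : ((g a)%:C)^-1 * (g x)%:C - ((g a)%:C)^-1 * (g a)%:C = ((g a)^-1 * g x - 1)%:C.
  by rewrite mulVf // rmorphB rmorphM fmorphV rmorph1.
rewrite E in hn *; rewrite normc_real in hn; rewrite hG3 // -rmorphM; congr (_%:C).
rewrite addrC subrK -sqrtrM ?(ltW ga) // mulrA mulfV ?gt_eqF // mul1r //.
Qed.

Lemma analytic_at_Re a u : analytic_at a u -> analytic_at a (fun x => (complex.Re (u x))%:C).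
Proof.
move=> hu; apply: eq_analytic_at (analytic_at_scale (2^-1) (analytic_at_add hu (analytic_at_conj hu))).
by exists 1 => // x _; rewrite ReJ_add mulrC.
Qed.

Lemma analytic_at_Im a u : analytic_at a u -> analytic_at a (fun x => (complex.Im (u x))%:C).
Proof.
move=> hu; have hd := analytic_at_add (analytic_at_conj hu) (analytic_at_scale (-1) hu).
apply: eq_analytic_at (analytic_at_scale (2^-1 * 'i%C) hd).
by exists 1 => // x _; rewrite ImJ_sub mulN1r [(_ - _) / 2]mulrC [RHS]mulrAC.
Qed.

Lemma algebraic_at_scale a c u : algebraic_at a u -> algebraic_at a (fun x => c * u x).
Proof. by move=> hu; apply: algebraic_at_mul hu; exact: algebraic_at_const. Qed.

Lemma algebraic_at_Re a u : algebraic_at a u -> algebraic_at a (fun x => (complex.Re (u x))%:C).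
Proof.
move=> hu; apply: eq_algebraic_at (algebraic_at_scale (2^-1) (algebraic_at_add hu (algebraic_at_conj hu))).
by exists 1 => // x _; rewrite ReJ_add mulrC.
Qed.

Lemma algebraic_at_Im a u : algebraic_at a u -> algebraic_at a (fun x => (complex.Im (u x))%:C).
Proof.
move=> hu; have hd := algebraic_at_add (algebraic_at_conj hu) (algebraic_at_scale (-1) hu).
apply: eq_algebraic_at (algebraic_at_scale (2^-1 * 'i%C) hd).
by exists 1 => // x _; rewrite ImJ_sub mulN1r [(_ - _) / 2]mulrC [RHS]mulrAC.
Qed.

End AnalyticComposition.

(** * Functions of Re x and of the norm of Im x *)

Section Cylindrical.
Variables (R : realType) (n : nat).
Local Notation C := (R[i]).
Implicit Types (a x : 'rV[R]_n.+1).

Definition imsq x : R := \sum_(i < n.+1 | i != 0) x 0 i ^+ 2.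
Definition imnorm x : R := Num.sqrt (imsq x).
Definition zof x : C := x 0 0 +i* imnorm x.

Lemma imsq_ge0 x : 0 <= imsq x.
Proof. by apply: sumr_ge0 => i _; exact: sqr_ge0. Qed.

Lemma imnorm_sqr x : imnorm x ^+ 2 = imsq x.
Proof. by rewrite sqr_sqrtr // imsq_ge0. Qed.

Lemma imsq_eq0 x i : imsq x = 0 -> i != 0 -> x 0 i = 0.
Proof.
move=> /eqP; rewrite psumr_eq0; last by move=> j _; exact: sqr_ge0.
by move=> /allP /(_ i) + i0; rewrite mem_index_enum i0 sqrf_eq0 => /(_ isT) /eqP.
Qed.

Lemma imnorm_continuous a : {for a, continuous imnorm}.
Proof.
apply: (@continuous_comp _ _ _ imsq (@Num.sqrt R)); last exact: sqrt_continuous.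
have term (i : 'I_n.+1) : {for a, continuous (fun x : 'rV[R]_n.+1 => x 0 i ^+ 2)}.
  apply: (@continuous_comp _ _ _ (fun x : 'rV[R]_n.+1 => x 0 i) (fun t : R => t ^+ 2)).
    exact: coord_continuous.
  exact: exprn_continuous.
have key (s : seq 'I_n.+1) :
    {for a, continuous (fun x : 'rV[R]_n.+1 => \sum_(i <- s | i != 0) x 0 i ^+ 2)}.
  elim: s => [|i s IH].
    have -> : (fun x : 'rV[R]_n.+1 => \sum_(i <- [::] | i != 0) x 0 i ^+ 2) = (fun=> 0).
      by apply/funext => x; rewrite big_nil.
    exact: cst_continuous.
  have -> : (fun x : 'rV[R]_n.+1 => \sum_(i <- i :: s | i != 0) x 0 i ^+ 2) =
     (fun x => (if i != 0 then x 0 i ^+ 2 else 0) + \sum_(i <- s | i != 0) x 0 i ^+ 2).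
    by apply/funext => x; rewrite big_cons; case: ifP => // _; rewrite add0r.
  apply: continuousD => //; case: (i != 0); [exact: term|exact: cst_continuous].
exact: key.
Qed.

Lemma zof_near a (e : R) : 0 < e -> exists2 d : R, 0 < d &
  forall x, box a d x -> normc (zof x - zof a) <= e.
Proof.
move=> e0; have e20 : 0 < e / 2 by rewrite divr_gt0.
have /cvgrPdist_le /(_ _ e20) /nbhs_boxP [d d0 hd] := @imnorm_continuous a.
exists (Num.min d (e / 2)); first by rewrite lt_min d0.
move=> x hx; apply: le_trans (normc_le_ReIm _) _; rewrite [leRHS]splitr lerD //=.
  by apply: le_trans (hx 0) _; rewrite ge_min lexx orbT.
by rewrite distrC; apply: hd; apply: box_le hx; rewrite ge_min lexx.
Qed.

Definition imsq_mpoly : mpoly.mpoly n.+1 C := \sum_(i < n.+1 | i != 0) mpolyvar C i ^+ 2.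

Lemma meval_imsq y : mpoly.meval y imsq_mpoly = \sum_(i < n.+1 | i != 0) y i ^+ 2.
Proof. by rewrite rmorph_sum; apply: eq_bigr => i _; rewrite rmorphXn /= mpoly.mevalXU. Qed.

Lemma meval_imsq_real x : mpoly.meval (rowC x) imsq_mpoly = (imsq x)%:C.
Proof. by rewrite meval_imsq rmorph_sum; apply: eq_bigr => i _; rewrite rmorphXn. Qed.

(** Substituting x_0 + i b for the complex variable gives a polynomial in b, and [pev_quadratic]
    eliminates b = |Im x| through b^2 = [imsq x]. Of [zof] only continuity enters, so real points
    are included. *)
Lemma algebraic_at_zof a (G : C -> C) : calgebraic_at (zof a) G ->
  algebraic_at a (fun x => G (zof x)).
Proof.
move=> [P P0 [e e0 hP]].
pose th : {rmorphism mpoly.mpoly 1 C -> {poly {poly mpoly.mpoly n.+1 C}}} :=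
  mpoly.mmap (polyC \o polyC \o @mpoly.mpolyC n.+1 C)
  (fun=> (mpolyvar C (0 : 'I_n.+1))%:P%:P + (mpoly.mpolyC n.+1 'i%C)%:P%:P * 'X).
pose H := (map_poly th P).['X%:P].
have HE y b t : (map_poly (fun Q => pev y Q t) H).[b] = pev (fun=> y 0 + 'i%C * b) P t.
  have [ev [evC evX evH]] : exists ev : {rmorphism {poly {poly mpoly.mpoly n.+1 C}} -> C},
      [/\ forall Q, ev Q%:P = pev y Q t, ev 'X = b &
          forall W, (map_poly (fun Q => pev y Q t) W).[b] = ev W].
    exists (horner_eval b \o map_poly (pev_rmorph y t) : {rmorphism _ -> _}); split=> [Q||W] /=.
    - by rewrite map_polyC /horner_eval hornerC.
    - by rewrite map_polyX /horner_eval hornerX.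
    - by rewrite (eq_map_poly (pevE y ^~ t)).
  rewrite evH /H -horner_map -map_poly_comp /pev [X in _.[X]]evC pevX.
  congr _.[_]; apply: eq_map_poly.
  apply: (@mpoly_rmorph_eq _ _ _ (ev \o th) (mpoly.meval _)) => [c|i].
    apply: (@etrans _ _ (ev (mpoly.mpolyC n.+1 c)%:P%:P)).
      by congr (ev _); exact: mpoly.mmapC.
    by rewrite evC pevC mpoly.mevalC; exact/esym/mpoly.mevalC.
  have thX : th (mpolyvar C i) = (mpolyvar C (0 : 'I_n.+1))%:P%:P +
      (mpoly.mpolyC n.+1 'i%C)%:P%:P * 'X.
    by rewrite /th /= mpoly.mmapX mpoly.mmap1U.
  apply: (@etrans _ _ (ev (th (mpolyvar C i)))); first by [].
  apply: (@etrans _ _ (y 0 + 'i%C * b)); last exact/esym/mpoly.mevalXU.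
  have e1 : ev (mpolyvar C (0 : 'I_n.+1))%:P%:P = y 0.
    exact: (etrans (evC _) (etrans (pevC _ _ _) (mpoly.mevalXU _ _))).
  have e2 : ev (mpoly.mpolyC n.+1 'i%C)%:P%:P = 'i%C.
    exact: (etrans (evC _) (etrans (pevC _ _ _) (mpoly.mevalC _ _))).
  rewrite thX; apply: etrans (rmorphD ev _ _) _; apply: congr2 e1 _.
  by apply: etrans (rmorphM ev _ _) _; exact: congr2 e2 evX.
have [x0 [t0 hx0]] := pev_real_nonzero P0.
(* With b and all imaginary coordinates equal to 0, [H] reduces to [P] at a point where [P] does not
   vanish. *)
pose y0 (i : 'I_n.+1) : C := if i == 0 then (x0 0)%:C else 0.
have h0 : 0 ^+ 2 = mpoly.meval y0 imsq_mpoly.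
  by rewrite meval_imsq expr0n big1 // => i /negbTE i0; rewrite /y0 i0 expr0n.
have hne : (map_poly (fun Q => pev y0 Q t0) H).[0] != 0.
  rewrite HE mulr0 addr0 /y0 eqxx.
  suff -> : (fun _ : 'I_1 => (x0 0)%:C) = (fun i => (x0 i)%:C) by [].
  by apply/funext => i; rewrite (ord1 i).
have [|N N0 hN] := pev_quadratic h0 hne; first by rewrite oppr0.
have [d d0 hd] := zof_near a e0.
exists N => //; exists d => // x hx.
apply: (hN _ (imnorm x)%:C); first by rewrite meval_imsq_real -imnorm_sqr rmorphXn.
rewrite HE; have := hP _ (hd x hx).
suff -> : (fun _ : 'I_1 => zof x) = (fun _ : 'I_1 => rowC x 0 + 'i%C * (imnorm x)%:C) by [].
by apply/funext => i; rewrite /rowC /zof [LHS]complexE.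
Qed.

Lemma algebraic_at_direction a i : i != 0 ->
  algebraic_at a (fun x => (x 0 i / imnorm x)%:C).
Proof.
move=> i0.
pose P : {poly mpoly.mpoly n.+1 C} := imsq_mpoly%:P * 'X^2 - (mpolyvar C i ^+ 2)%:P.
have PE y t : pev y P t = mpoly.meval y imsq_mpoly * t ^+ 2 - y i ^+ 2.
  rewrite pevE /P rmorphB rmorphM rmorphXn -!pevE !pevC pevX.
  by rewrite rmorphXn /= mpoly.mevalXU.
exists P.
  pose y (j : 'I_n.+1) : C := if j == i then 1 else 0.
  have hs : mpoly.meval y imsq_mpoly = 1.
    rewrite meval_imsq (bigD1 i) //= big1 /y ?eqxx ?expr1n ?addr0 // => j /andP[_ /negbTE ->].
    by rewrite expr0n.
  have : pev y P 0 != 0.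
    by rewrite PE hs expr0n mulr0 sub0r oppr_eq0 /y eqxx expr1n oner_neq0.
  by apply: contraNneq => ->; rewrite /pev map_poly0 horner0.
exists 1 => // x _; rewrite PE meval_imsq_real /rowC -!rmorphXn -rmorphM -rmorphB.
(* The equation is |Im x|^2 t^2 = x_i^2; where Im x = 0 both sides are 0. *)
rewrite exprMn exprVn imnorm_sqr; have [s0|s0] := eqVneq (imsq x) 0.
  by rewrite s0 mul0r (imsq_eq0 s0 i0) expr0n subr0.
by rewrite mulrCA mulfV // mulr1 subrr.
Qed.

Lemma analytic_at_imsq a : analytic_at a (fun x => (imsq x)%:C).
Proof.
rewrite /imsq; have -> : (fun x : 'rV[R]_n.+1 => (\sum_(i < n.+1 | i != 0) x 0 i ^+ 2)%:C) =
   (fun x => \sum_(i <- index_enum 'I_n.+1) (if i != 0 then ((x 0 i)%:C * (x 0 i)%:C) else 0)).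
  apply/funext => x; rewrite rmorph_sum big_mkcond; apply: eq_bigr => i _.
  by case: ifP => // _; rewrite rmorphXn expr2.
apply: analytic_at_sum => i; case: (i != 0); last exact: analytic_at_const.
by apply: analytic_at_mul; exact: analytic_at_coord.
Qed.

Lemma analytic_at_imnorm a : 0 < imsq a -> analytic_at a (fun x => (imnorm x)%:C).
Proof. by move=> h; apply: analytic_at_sqrt => //; exact: analytic_at_imsq. Qed.

Lemma analytic_at_zof a (G : C -> C) : 0 < imsq a -> holo_at (zof a) G ->
  analytic_at a (fun x => G (zof x)).
Proof.
move=> ha hG; apply: analytic_at_comp hG _ _ => //.
have -> : zof = fun x => (x 0 0)%:C + 'i%C * (imnorm x)%:C.
  by apply/funext => x; rewrite [LHS]complexE.
apply: analytic_at_add; first exact: analytic_at_coord.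
by apply: analytic_at_scale; exact: analytic_at_imnorm.
Qed.

Lemma analytic_at_direction a i : 0 < imsq a -> analytic_at a (fun x => (x 0 i / imnorm x)%:C).
Proof.
move=> ha; have hn : (imnorm a)%:C != 0 :> C.
  by rewrite fmorph_eq0 gt_eqF // sqrtr_gt0.
apply: eq_analytic_at (analytic_at_mul (analytic_at_coord a i) (analytic_at_inv (analytic_at_imnorm ha) hn)).
by exists 1 => // x _; rewrite -fmorphV -rmorphM.
Qed.

(* (al + i be)^k = p_k + i be q_k with p_k and q_k polynomials in al and be^2. *)
Fixpoint cyl_pow (al s : C) (k : nat) : C * C :=
  if k is j.+1 then
    let: (p, q) := cyl_pow al s j in (al * p - s * q, p + al * q)
  else (1, 0).

Lemma cyl_powE al s b k : b ^+ 2 = - s ->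
  (al + b) ^+ k = (cyl_pow al s k).1 + b * (cyl_pow al s k).2.
Proof.
move=> hb; have {hb} -> : s = - b ^+ 2 by rewrite hb opprK.
elim: k => [|k IH]; first by rewrite expr0 mulr0 addr0.
rewrite exprS IH /=; case: (cyl_pow _ _ k) => p q /=; ring.
Qed.

Lemma cyl_pow_real (al s : R) k : exists p q : R, cyl_pow al%:C s%:C k = (p%:C, q%:C).
Proof.
elim: k => [|k [p [q /= ->]]]; first by exists 1, 0.
by exists (al * p - s * q), (p + al * q); rewrite rmorphB rmorphD !rmorphM.
Qed.

Let al (y : 'I_n.+1 -> C) : C := y 0.
Let sg (y : 'I_n.+1 -> C) : C := \sum_(i < n.+1 | i != 0) y i ^+ 2.

Lemma ps_sg (r : R) : 0 < r -> ps r (n.+1%:R * r ^+ 2) sg.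
Proof.
move=> r0; have h (i : 'I_n.+1) : ps r (r ^+ 2) (fun y : 'I_n.+1 -> C => if i != 0 then y i ^+ 2 else 0).
  case: (i != 0); first by apply: ps_exp => //; exact: ps_var.
  by apply: ps_le (ps_const n.+1 0 r0); rewrite normc0 exprn_ge0 // ltW.
have := ps_bigsum (index_enum 'I_n.+1) r0 h.
rewrite sumr_const card_ord -[_ *+ n.+1]mulr_natl; apply: eq_ps => y _.
by rewrite /sg [RHS]big_mkcond.
Qed.

(** Geometric growth: one step of the recursion costs a factor (n + 2) r for p and 2 r for q, both
    at most (n + 3) r. *)
Lemma ps_cyl_pow (r : R) k : 0 < r ->
  ps r ((n.+3%:R * r) ^+ k) (fun y => (cyl_pow (al y) (sg y) k).1) /\
  ps r ((n.+3%:R * r) ^+ k / r) (fun y => (cyl_pow (al y) (sg y) k).2).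
Proof.
move=> r0; have L0 : 0 <= n.+3%:R * r by rewrite mulr_ge0 ?(ltW r0).
elim: k => [|k [hp hq]].
  split; first by rewrite expr0 -(normc1 R); exact: ps_const.
  apply: ps_le (ps_const n.+1 0 r0); rewrite normc0 divr_ge0 ?exprn_ge0 ?(ltW r0) //.
have hal : ps r r al by exact: ps_var.
set L := n.+3%:R * r in L0 hp hq *.
have Lk0 : 0 <= L ^+ k by rewrite exprn_ge0.
split.
  apply: (@ps_le _ _ _ (r * L ^+ k + normc (- 1 : C) * (n.+1%:R * r ^+ 2 * (L ^+ k / r)))).
    rewrite normcN' normc1 mul1r.
    have -> : r * L ^+ k + n.+1%:R * r ^+ 2 * (L ^+ k / r) = (n.+2%:R * r) * L ^+ k.
      by rewrite -[n.+2%:R]natr1; field; rewrite gt_eqF.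
    by rewrite exprS ler_wpM2r // ler_wpM2r ?(ltW r0) // ler_nat.
  apply: eq_ps (ps_add (ps_mul r0 hal hp) (ps_scale (-1) (ps_mul r0 (ps_sg r0) hq))) => y _.
  by rewrite /=; case: (cyl_pow _ _ k) => p q /=; rewrite mulN1r.
apply: (@ps_le _ _ _ (L ^+ k + r * (L ^+ k / r))).
  have -> : L ^+ k + r * (L ^+ k / r) = 2 * L ^+ k by field; rewrite gt_eqF.
  rewrite exprS mulrAC ler_wpM2r // /L mulfK ?gt_eqF // ler_nat //.
apply: eq_ps (ps_add hp (ps_mul r0 hal hq)) => y _.
by rewrite /=; case: (cyl_pow _ _ k) => p q.
Qed.

Lemma analytic_at_cyl a (G : C -> C) : imsq a = 0 -> holo_at (zof a) G ->
  (exists2 e : R, 0 < e & forall z, normc (z - zof a) <= e -> conjc (G (conjc z)) = G z) ->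
  exists p q : 'rV[R]_n.+1 -> R, exists2 e : R, 0 < e &
   [/\ analytic_at a (fun x => (p x)%:C), analytic_at a (fun x => (q x)%:C) &
       forall x, box a e x -> G (zof x) = (p x) +i* (imnorm x * q x)].
Proof.
move=> a0 [rho [B [h [rho0 hh hE]]]] [e e0 he].
have za : zof a = (a 0 0)%:C by rewrite /zof /imnorm a0 sqrtr0.
have [c [hB hc]] := ps_nat hh.
pose rc := Num.min rho e; have rc0 : 0 < rc by rewrite lt_min rho0.
(* By the reflection symmetry of [G], the series with coefficients [c k - conjc (c k)] sums to 0 on
   a disc, so its coefficients vanish. *)
have creal k : conjc (c k) = c k.
  pose d k := c k - conjc (c k).
  have hd w : normc w <= rc -> has_sum (fun k => d k * w ^+ k) 0.
    rewrite le_min => /andP[w1 w2].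
    have h1 := hc _ w1; have hw : normc (conjc w) <= rho by rewrite normc_conj.
    have h2 := has_sum_conj (hc _ hw).
    have E : h (fun=> w) = conjc (h (fun=> conjc w)).
      have e1 : normc ((w + zof a) - zof a) <= rho by rewrite addrK.
      have e2 : normc ((conjc w + zof a) - zof a) <= rho by rewrite addrK.
      have := hE _ e1; have := hE _ e2; rewrite !addrK => -> ->.
      rewrite -he ?addrK //; congr (conjc (G _)).
      by rewrite za; case: (w) => u v; apply/eqP; rewrite eq_complex /= !addr0 eqxx /= eqxx.
    have := has_sumB h1 h2; rewrite E subrr; apply: eq_has_sum => j.
    by rewrite /d mulrBl; congr (_ - _); rewrite rmorphM rmorphXn /= conjcK.
  have hdB : exists B', sum_bounded (fun k => d k * (rc ^+ k)%:C) B'.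
    have := hd rc%:C; rewrite normc_real ger0_norm ?(ltW rc0) // => /(_ (lexx _)).
    move=> /has_sum_sum_bounded [B' hB']; exists B'.
    by apply: sum_bounded_dom hB' => j; rewrite rmorphXn.
  have [B' {}hB'] := hdB.
  pose d1 (m : {ffun 'I_1 -> nat}) := d (m 0).
  have hps : ps_coef d1 rc B' (fun _ => 0).
    pose p (k : nat) : {ffun 'I_1 -> nat} := [ffun=> k].
    have pinj : injective p by move=> i j /ffunP /(_ 0); rewrite !ffunE.
    pose pi (m : {ffun 'I_1 -> nat}) := m 0.
    have piK m : p (pi m) = m by apply/ffunP => i; rewrite ffunE (ord1 i).
    have piinj : injective pi by move=> m m' /(congr1 p); rewrite !piK.
    split; first by apply: sum_bounded_dom (sum_bounded_reindex piinj hB') => m; rewrite /mdegree big_ord1.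
    move=> y hy; have := hd _ (hy 0) => H.
    have psurj k0 : (forall m, k0 <> pi m) -> d k0 * y 0 ^+ k0 = 0.
      by move=> /(_ (p k0)); rewrite /pi ffunE.
    have := (has_sum_reindex (f := fun k => d k * y 0 ^+ k) 0 piinj psurj).2 H.
    by apply: eq_has_sum => m; rewrite /mono big_ord1.
  have := ps_real_eq0 rc0 rc0 hps (fun _ _ => erefl) [ffun=> k].
  by rewrite /d1 ffunE /d => /eqP; rewrite subr_eq0 => /eqP.
have cE k : c k = (complex.Re (c k))%:C.
  by case: (c k) (creal k) => u v [] /eqP; rewrite eqNr => /eqP ->.
(* Chosen so that the growth rate in [ps_cyl_pow] equals rho, where the series of [G] is absolutely
   summable. *)
pose r := rho / n.+3%:R; have r0 : 0 < r by rewrite divr_gt0.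
have Lr : n.+3%:R * r = rho by rewrite mulrC divfK // pnatr_eq0.
have hcp k := ps_scale (c k) (ps_cyl_pow k r0).1.
have hcq k := ps_scale (c k) (ps_cyl_pow k r0).2.
have bp : sum_bounded (fun k => (normc (c k) * (n.+3%:R * r) ^+ k)%:C) B.
  apply: sum_bounded_dom hB => k; rewrite Lr normcM !normc_real normrM.
  by rewrite (ger0_norm (normc_ge0 _)).
have bq : sum_bounded (fun k => (normc (c k) * ((n.+3%:R * r) ^+ k / r))%:C) (normc (r^-1)%:C * B).
  apply: sum_bounded_dom (sum_boundedZ (r^-1)%:C bp) => k.
  by rewrite normcM !normc_real -normrM mulrA (mulrC _ r^-1).
have exsum (T : nat -> ('I_n.+1 -> C) -> C) (b : nat -> R) B' :
    (forall k, ps r (b k) (T k)) -> sum_bounded (fun k => (b k)%:C) B' ->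
    exists g, ps r B' g /\ forall y, polydisc r y -> has_sum (fun k => T k y) (g y).
  move=> hT hb; have hy y : exists l, polydisc r y -> has_sum (fun k => T k y) l.
    case: (pselect (polydisc r y)) => hy; last by exists 0.
    have [|l hl] := @sum_bounded_has_sum R _ (fun k => T k y) B'; last by exists l.
    apply: sum_bounded_dom hb => k; apply: le_trans (ps_norm (hT k) hy) _.
    by rewrite normc_real ler_norm.
  have [g hg] := choice hy; exists g; split=> //.
  exact: (ps_series r0 hT hb hg).
have [P [hP hPs]] := exsum _ _ _ hcp bp.
have [Q [hQ hQs]] := exsum _ _ _ hcq bq.
have [d d0 hd] := zof_near a rho0.
(* The imaginary coordinates of [a] are 0, so the displacement from [a] has the same [imsq] as
   [x]. *)
have sgE x : sg (diffC a x) = (imsq x)%:C.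
  rewrite /sg rmorph_sum; apply: eq_bigr => i i0.
  by rewrite /diffC (imsq_eq0 a0 i0) subr0 rmorphXn.
exists (fun x => complex.Re (P (diffC a x))), (fun x => complex.Re (Q (diffC a x))).
exists (Num.min d r); first by rewrite lt_min d0.
(* Coefficients and cylindrical powers are real, so taking the real part in the witnesses changes
   nothing near [a]. *)
have realP x : box a r x -> (complex.Re (P (diffC a x)))%:C = P (diffC a x).
  move=> hx; have := hPs _ (polydisc_diffC hx) => h1.
  have := has_sum_conj h1 => h2.
  have : conjc (P (diffC a x)) = P (diffC a x).
    apply: has_sum_unique h2 _; apply: eq_has_sum h1 => k.
    have [u [v]] := cyl_pow_real (x 0 0 - a 0 0) (imsq x) k.
    by rewrite /al sgE => ->; rewrite /= cE -rmorphM conjc_real.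
  by case: (P _) => u v [] /eqP; rewrite eqNr => /eqP ->.
have realQ x : box a r x -> (complex.Re (Q (diffC a x)))%:C = Q (diffC a x).
  move=> hx; have := hQs _ (polydisc_diffC hx) => h1.
  have := has_sum_conj h1 => h2.
  have : conjc (Q (diffC a x)) = Q (diffC a x).
    apply: has_sum_unique h2 _; apply: eq_has_sum h1 => k.
    have [u [v]] := cyl_pow_real (x 0 0 - a 0 0) (imsq x) k.
    by rewrite /al sgE => ->; rewrite /= cE -rmorphM conjc_real.
  by case: (Q _) => u v [] /eqP; rewrite eqNr => /eqP ->.
split.
- by exists r, B, P; split=> // x hx; rewrite realP.
- by exists r, (normc (r^-1)%:C * B), Q; split=> // x hx; rewrite realQ.
move=> x hx; have hxd : box a d x by apply: box_le hx; rewrite ge_min lexx.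
have hxr : box a r x by apply: box_le hx; rewrite ge_min lexx orbT.
have h1 := hc _ (hd x hxd); rewrite hE ?hd // in h1.
have h2 := has_sumD (hPs _ (polydisc_diffC hxr)) (has_sumZ ('i%C * (imnorm x)%:C) (hQs _ (polydisc_diffC hxr))).
have -> : complex.Re (P (diffC a x)) +i* (imnorm x * complex.Re (Q (diffC a x))) =
   P (diffC a x) + 'i%C * (imnorm x)%:C * Q (diffC a x).
  by rewrite -realP // -realQ // [LHS]complexE /= -mulrA -rmorphM.
apply: has_sum_unique h1 _; apply: eq_has_sum h2 => k.
have -> : zof x - zof a = al (diffC a x) + 'i%C * (imnorm x)%:C.
  by rewrite za /zof [X in X - _]complexE /al /diffC rmorphB /= addrAC.
rewrite (@cyl_powE _ (sg (diffC a x))); first by ring.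
by rewrite exprMn sqr_i sgE -rmorphXn imnorm_sqr mulN1r.
Qed.

End Cylindrical.

Section RealNashGerms.
Variables (R : realType) (n : nat).
Local Notation C := (R[i]).
Implicit Types (a x : 'rV[R]_n) (g : 'rV[R]_n -> C).

Definition rnash_at a g : Prop := analytic_at a g /\ algebraic_at a g.

Lemma rnash_at_add a g g' : rnash_at a g -> rnash_at a g' -> rnash_at a (fun x => g x + g' x).
Proof. by move=> [? ?] [? ?]; split; [exact: analytic_at_add|exact: algebraic_at_add]. Qed.

Lemma rnash_at_scale a c g : rnash_at a g -> rnash_at a (fun x => c * g x).
Proof. by move=> [? ?]; split; [exact: analytic_at_scale|exact: algebraic_at_scale]. Qed.

Lemma rnash_at_const a c : rnash_at a (fun=> c).
Proof. by split; [exact: analytic_at_const|exact: algebraic_at_const]. Qed.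

Lemma rnash_at_sum (T : Type) (s : seq T) a (g : T -> 'rV[R]_n -> C) :
  (forall j, rnash_at a (g j)) -> rnash_at a (fun x => \sum_(j <- s) g j x).
Proof.
by move=> h; split; [apply: analytic_at_sum|apply: algebraic_at_sum] => j; have [] := h j.
Qed.

Lemma eq_rnash_at a g g' : (exists2 e : R, 0 < e & forall x, box a e x -> g x = g' x) ->
  rnash_at a g -> rnash_at a g'.
Proof. by move=> h [? ?]; split; [exact: (eq_analytic_at h)|exact: (eq_algebraic_at h)]. Qed.

End RealNashGerms.

(** * From stem components to real components *)

Section SliceToReal.
Variables (R : realType) (A : hypercomplex).
Local Notation C := (R[i]).
Local Notation AA := ('rV[R]_(dA A).+1).
Local Notation "x ** y" := (amul x y) (at level 40, left associativity).
Local Notation one := (aone R A).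
Implicit Types (I x a : AA).

Lemma anorm2_imsq x : anorm2 x = x 0 0 ^+ 2 + imsq x.
Proof. by rewrite /anorm2 /imsq (bigD1 0). Qed.

Lemma zof_phi I z : imag_unit I -> zof (phi I z) = complex.Re z +i* `|complex.Im z|.
Proof.
move=> hI; have /imag_unitP [I0 I1] := hI.
rewrite /zof phi_re // /imnorm; congr (_ +i* _).
have -> : imsq (phi I z) = complex.Im z ^+ 2.
  rewrite /imsq; transitivity (\sum_(i < (dA A).+1 | i != 0) complex.Im z ^+ 2 * I 0 i ^+ 2).
    apply: eq_bigr => i /negbTE i0; rewrite !mxE eqxx i0 mulr0 add0r exprMn //.
  rewrite -mulr_sumr -/(imsq I); move: I1; rewrite anorm2_imsq I0 expr0n add0r => ->.
  by rewrite mulr1.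
by rewrite sqrtr_sqr.
Qed.

Lemma circularization_zof (D : set C^o) x : conj_invariant D ->
  circularization (A := A) D x -> D (zof x).
Proof.
move=> cD [z [I [Dz hI ->]]]; rewrite zof_phi //.
case: z Dz => u v Dz /=; case: (leP 0 v) => v0; first by rewrite ger0_norm.
by rewrite ltr0_norm //; have := cD _ Dz.
Qed.

(** Normalize the imaginary part of [x]; where it vanishes any imaginary unit will do. *)
Lemma phi_zof x : exists2 I, imag_unit I & x = phi I (zof x).
Proof.
have [s0|s0] := eqVneq (imsq x) 0.
  have [hI _ _] := @std_splitting_base R A; exists (std_I R A) => //.
  rewrite /phi /zof /imnorm s0 sqrtr0 /= scale0r addr0; apply/rowP => i; rewrite !mxE eqxx.
  have [->|i0] := eqVneq i 0; first by rewrite mulr1.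
  by rewrite (imsq_eq0 s0 i0) mulr0.
have spos : 0 < imsq x by rewrite lt_neqAle eq_sym s0 imsq_ge0.
have b0 : imnorm x != 0 by rewrite gt_eqF // sqrtr_gt0.
exists ((imnorm x)^-1 *: (x - x 0 0 *: one)).
  apply/imag_unitP; split; first by rewrite !mxE !eqxx mulr1 subrr mulr0.
  rewrite anorm2Z exprVn imnorm_sqr anorm2_imsq !mxE !eqxx mulr1 subrr expr0n add0r.
  have -> : imsq (x - x 0 0 *: one) = imsq x.
    by apply: eq_bigr => i /negbTE i0; rewrite !mxE eqxx i0 mulr0 subr0.
  by rewrite mulVf.
by rewrite /phi /zof /= scalerA mulfV // scale1r addrC subrK.
Qed.

Section Components.
Variables (Omega : set AA) (f : AA -> AA) (D : set C^o) (F : C^o -> AA * AA).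
Hypotheses (hF : induced_by Omega f D F) (oO : open Omega).
Variables (I : AA) (J : 'I_(uA A).+1 -> AA).
Hypotheses (hIJ : splitting_base I J) (hS : stem_cnash D F I J).

Let e (i : 'I_(dA A).+1) : AA := delta_mx 0 i.

(** The imaginary unit of [x] is the sum of the (x_i / |Im x|) e_i, and the product is linear in its
    left factor. At a real point the symmetry of the stem gives F_2 = 0. *)
Lemma slice_real_formula x : Omega x ->
  f x = (F (zof x)).1 + \sum_(i < (dA A).+1 | i != 0) (x 0 i / imnorm x) *: (e i ** (F (zof x)).2).
Proof.
have [[oD cD cF] OD hf] := hF; rewrite OD => Ox.
have Dz := circularization_zof cD Ox; have [I' hI' xE] := phi_zof x.
rewrite {1}xE hf //; congr (_ + _).
have [s0|s0] := eqVneq (imsq x) 0.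
  have zr : conjc (zof x) = zof x by rewrite /zof /imnorm s0 sqrtr0 /= oppr0.
  have F20 : (F (zof x)).2 = 0.
    have := congr1 snd (cF _ Dz); rewrite zr /= => /eqP; rewrite -subr_eq0 opprK -mulr2n.
    by rewrite -scaler_nat scaler_eq0 pnatr_eq0 /= => /eqP.
  rewrite F20 amul0r big1 // => i _; by rewrite amul0r scaler0.
have spos : 0 < imsq x by rewrite lt_neqAle eq_sym s0 imsq_ge0.
have b0 : imnorm x != 0 by rewrite gt_eqF // sqrtr_gt0.
have /imag_unitP [I0 _] := hI'.
have I'E : I' = \sum_(i < (dA A).+1 | i != 0) (x 0 i / imnorm x) *: e i.
  rewrite (row_sum_delta I') (bigD1 0) //= I0 scale0r add0r; apply: eq_bigr => i i0.
  have xi : x 0 i = imnorm x * I' 0 i by rewrite {1}xE !mxE eqxx (negbTE i0) mulr0 add0r.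
  by rewrite xi mulrAC mulfV // mul1r.
rewrite {1}I'E -big_filter amul_suml big_filter.
by apply: eq_bigr => i _; rewrite amulZl.
Qed.


Definition std_tuple : (dA A).+1.-tuple AA := [tuple e i | i < (dA A).+1].

Lemma std_tupleE i : tnth std_tuple i = e i.
Proof. by rewrite tnth_mktuple. Qed.

Lemma real_comb_std x : real_comb std_tuple x = x.
Proof. by rewrite /real_comb [RHS]row_sum_delta; apply: eq_bigr => i _; rewrite std_tupleE. Qed.

Lemma std_tuple_basis : basis_of fullv std_tuple.
Proof.
rewrite basisEdim size_tuple dimvf /dim /= mul1n leqnn andbT.
apply/subvP => v _; rewrite -(real_comb_std v); apply: memv_suml => i _.
by apply: memvZ; apply: memv_span; exact: mem_tnth.
Qed.

Lemma coord_std x l : coord std_tuple l x = x 0 l.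
Proof.
rewrite -{1}(real_comb_std x) /real_comb.
under eq_bigr do rewrite (tnth_nth 0).
by rewrite coord_sum_free //; exact: basis_free std_tuple_basis.
Qed.

Lemma Omega_D x : Omega x -> D (zof x).
Proof. by have [[_ cD _] OD _] := hF; rewrite OD; exact: circularization_zof. Qed.

(** Where Im a != 0 both factors are analytic. At a real point [analytic_at_cyl] writes the
    imaginary part as |Im x| q, and the product with x_i / |Im x| becomes x_i q. *)
Lemma cyl_rnash a (G : C -> C) : Omega a -> cnash_at (zof a) G ->
  (forall z, D z -> conjc (G (conjc z)) = G z) ->
  rnash_at a (fun x => (complex.Re (G (zof x)))%:C) /\
  forall i, i != 0 -> rnash_at a (fun x => (x 0 i / imnorm x)%:C * (complex.Im (G (zof x)))%:C).
Proof.
move=> Oa [hG aG] cG; have Da := Omega_D Oa.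
have algG := algebraic_at_zof aG.
have [e0 e00 he0] := stem_disc_open hF Da.
have [s0|s0] := eqVneq (imsq a) 0; last first.
  have spos : 0 < imsq a by rewrite lt_neqAle eq_sym s0 imsq_ge0.
  have anG := analytic_at_zof spos hG.
  split; first by split; [exact: analytic_at_Re|exact: algebraic_at_Re].
  move=> i i0; split.
    by apply: analytic_at_mul (analytic_at_Im anG); exact: analytic_at_direction.
  by apply: algebraic_at_mul (algebraic_at_Im algG); exact: algebraic_at_direction.
have [|p [q [d d0 [hp hq hpq]]]] := analytic_at_cyl s0 hG.
  by exists e0 => // z /he0; exact: cG.
split.
  split; last exact: algebraic_at_Re.
  by apply: eq_analytic_at hp; exists d => // x /hpq ->.
move=> i i0; split; last first.
  by apply: algebraic_at_mul (algebraic_at_Im algG); exact: algebraic_at_direction.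
apply: eq_analytic_at (analytic_at_mul (analytic_at_coord a i) hq); exists d => // x /hpq ->.
rewrite /= -!rmorphM; congr (_%:C); have [s1|s1] := eqVneq (imnorm x) 0.
  have sx : imsq x = 0 by rewrite -imnorm_sqr s1 expr0n.
  by rewrite (imsq_eq0 sx i0) !mul0r.
by rewrite mulrA divfK.
Qed.

Lemma slice_real_nash a l : Omega a -> rnash_at a (fun x => (f x 0 l)%:C).
Proof.
move=> Oa; have Da := Omega_D Oa.
have h1 k := cyl_rnash Oa (hS k Da).1 (fun z Dz => stem_comp1_conj hF k hIJ Dz).
have h2 k := cyl_rnash Oa (hS k Da).2 (fun z Dz => stem_comp2_conj hF k hIJ Dz).
pose T1 x := \sum_k ((J k 0 l)%:C * (complex.Re (stem_comp1 I J F k (zof x)))%:C +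
   ((I ** J k) 0 l)%:C * (complex.Re (stem_comp2 I J F k (zof x)))%:C).
pose T2 i x := \sum_k
   (((e i ** J k) 0 l)%:C * ((x 0 i / imnorm x)%:C * (complex.Im (stem_comp1 I J F k (zof x)))%:C) +
    ((e i ** (I ** J k)) 0 l)%:C * ((x 0 i / imnorm x)%:C * (complex.Im (stem_comp2 I J F k (zof x)))%:C)).
have hT1 : rnash_at a T1.
  apply: rnash_at_sum => k; apply: rnash_at_add; apply: rnash_at_scale.
    by have [] := h1 k.
  by have [] := h2 k.
have hT2 i : i != 0 -> rnash_at a (T2 i).
  move=> i0; apply: rnash_at_sum => k; apply: rnash_at_add; apply: rnash_at_scale.
    by have [_] := h1 k; exact.
  by have [_] := h2 k; exact.
have hT : rnash_at a (fun x => T1 x + \sum_(i <- index_enum 'I_(dA A).+1) (if i != 0 then T2 i x else 0)).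
  apply: rnash_at_add hT1 _; apply: rnash_at_sum => i.
  by case: (boolP (i != 0)) => [/hT2 //|_]; exact: rnash_at_const.
apply: eq_rnash_at hT.
have /nbhs_boxP [d d0 hd] : \forall x \near a, Omega x by exact: open_nbhs_nbhs.
exists d => // x /hd Ox; rewrite slice_real_formula // !mxE rmorphD; congr (_ + _).
  rewrite /T1 {1}(CI_real_expansion hIJ (F (zof x)).1) summxE rmorph_sum; apply: eq_bigr => k _.
  by rewrite !mxE rmorphD !rmorphM /=; congr (_ + _); rewrite mulrC.
rewrite summxE rmorph_sum [RHS]big_mkcond; apply: eq_bigr => i _; case: ifP => // i0.
rewrite /T2 {1}(CI_real_expansion hIJ (F (zof x)).2) amul_sumr mxE summxE mulr_sumr rmorph_sum.
apply: eq_bigr => k _; rewrite amulDr !amulZr !mxE mulrDr rmorphD !rmorphM /=.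
have comm3 (u v w : C) : u * (v * w) = v * (w * u) by rewrite mulrCA (mulrC u).
by rewrite 2!(comm3 _ (_ * _)).

Qed.

Lemma std_real_nash l : nash (real_domain Omega std_tuple) (real_comp f std_tuple l).
Proof.
have -> : real_domain Omega std_tuple = Omega.
  by apply/seteqP; split=> x; rewrite /real_domain /= real_comb_std.
apply/nashP => // a Oa; have := slice_real_nash l Oa.
suff -> : (fun x => (f x 0 l)%:C) = (fun x => (real_comp f std_tuple l x)%:C) by [].
by apply/funext => x; rewrite /real_comp real_comb_std coord_std.
Qed.

Lemma holomorphic_F : holomorphic_on D F.
Proof. exact: (stem_cnash_holomorphic hIJ (stem_disc_open hF) hS). Qed.

End Components.
Lemma splitting_to_real (Omega : set AA) (f : AA -> AA) : open Omega -> slice_function Omega f ->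
  (forall I J, splitting_base I J ->
    forall k, nash1 (slice_domain Omega I) (slice_comp f I J k)) ->
  slice_regular Omega f /\
    exists2 B : (dA A).+1.-tuple AA, basis_of fullv B &
      forall l, nash (real_domain Omega B) (real_comp f B l).
Proof.
move=> oO [D [F hF]] h; have hIJ := @std_splitting_base R A; have [hI _ _] := hIJ.
have hS : stem_cnash D F (std_I R A) (@std_J R A).
  apply: (slice_stem_cnash hF hIJ) => k; apply/(nash1P _ (stem_disc_open hF)).
  by rewrite -(slice_domainE hF hI); exact: h.
split; first by exists D, F; split=> //; exact: (holomorphic_F hF hIJ hS).
by exists std_tuple; [exact: std_tuple_basis|move=> l; exact: (std_real_nash hF oO hIJ hS)].
Qed.

End SliceToReal.

(** * Change of real base *)

Section LinearSubstitution.
Variables (R : realType) (n p : nat) (M : 'M[R]_(n, p)).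
Local Notation C := (R[i]).

Let u (y : 'I_n -> C) (j : 'I_p) : C := \sum_i (M i j)%:C * y i.

Lemma rowC_mulmx (x : 'rV[R]_n) : rowC (x *m M) = u (rowC x).
Proof.
apply/funext => j; rewrite /rowC /u mxE rmorph_sum; apply: eq_bigr => i _.
by rewrite rmorphM mulrC.
Qed.

Lemma diffC_mulmx (a x : 'rV[R]_n) : diffC (a *m M) (x *m M) = u (diffC a x).
Proof.
apply/funext => j; rewrite /diffC /u !mxE -sumrB rmorph_sum; apply: eq_bigr => i _.
by rewrite -rmorphM -mulrBl mulrC.
Qed.

(** A crude bound for the operator norm of x -> x M in the maximum norm. *)
Let N : R := \sum_j \sum_i `|M i j|.

Lemma box_mulmx (a x : 'rV[R]_n) (t : R) : 0 <= t -> box a t x -> box (a *m M) (t * N) (x *m M).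
Proof.
move=> t0 hx j; rewrite !mxE -sumrB; apply: le_trans (ler_norm_sum _ _ _) _.
apply: (@le_trans _ _ (\sum_i t * `|M i j|)).
  by apply: ler_sum => i _; rewrite -mulrBl normrM ler_wpM2r.
rewrite -mulr_sumr ler_wpM2l // /N (bigD1 j) //= lerDl sumr_ge0 // => k _.
by rewrite sumr_ge0.
Qed.

Lemma ps_mulmx (t : R) j : 0 < t -> ps t (t * N) (fun y => u y j).
Proof.
move=> t0; apply: (@ps_le _ _ _ (\sum_i normc (M i j)%:C * t)); last first.
  by apply: ps_bigsum => // i; apply: ps_scale; exact: ps_var.
rewrite -mulr_suml mulrC ler_wpM2l ?(ltW t0) // /N (bigD1 j) //= ler_wpDr //.
  by apply: sumr_ge0 => k _; rewrite sumr_ge0.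
by apply: ler_sum => i _; rewrite expr0n addr0 sqrtr_sqr.
Qed.

Lemma small_mulmx (r : R) : 0 < r -> exists2 t : R, 0 < t & t * N <= r.
Proof.
move=> r0; have N0 : 0 <= N by apply: sumr_ge0 => j _; rewrite sumr_ge0.
have N1 : 0 < N + 1 by rewrite ltr_wpDl.
exists (r / (N + 1)); first by rewrite divr_gt0.
by rewrite mulrAC ler_pdivrMr // ler_wpM2l ?(ltW r0) // lerDl.
Qed.

Lemma nbhs_mulmx (a : 'rV[R]_n) (U : set 'rV[R]_p) :
  (\forall y \near a *m M, U y) -> \forall x \near a, U (x *m M).
Proof.
move=> /nbhs_boxP [r r0 h]; have [t t0 ht] := small_mulmx r0.
apply/nbhs_boxP; exists t => // x /(box_mulmx (ltW t0)) hx; apply: h.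
exact: box_le hx.
Qed.

Lemma analytic_at_mulmx (a : 'rV[R]_n) g : analytic_at (a *m M) g ->
  analytic_at a (fun x => g (x *m M)).
Proof.
move=> [r [B [h [r0 [c hc] hE]]]]; have [t t0 ht] := small_mulmx r0.
exists t, B, (fun y => h (fun j => u y j)); split=> //.
  exact: (ps_comp t0 hc (fun j => ps_mulmx j t0) ht).
move=> x hx; rewrite -diffC_mulmx hE //.
exact: box_le (box_mulmx (ltW t0) hx).
Qed.

(** The polynomial must survive the substitution: the left inverse [M'] makes x -> x M surjective,
    so that a point where [P] does not vanish is attained. *)
Lemma algebraic_at_mulmx (a : 'rV[R]_n) g (M' : 'M[R]_(p, n)) : M' *m M = 1%:M ->
  algebraic_at (a *m M) g -> algebraic_at a (fun x => g (x *m M)).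
Proof.
move=> hM [P P0 [e e0 hP]].
pose th : {rmorphism mpoly.mpoly p C -> mpoly.mpoly n C} :=
  mpoly.mmap (@mpoly.mpolyC n C)
    (fun j => \sum_i mpoly.mpolyC n (M i j)%:C * mpolyvar C i).
have thE y : mpoly.meval y \o th =1 mpoly.meval (u y).
  apply: (@mpoly_rmorph_eq _ _ _ (mpoly.meval y \o th) (mpoly.meval (u y))) => [c|j].
    by rewrite /= mpoly.mmapC !mpoly.mevalC.
  rewrite /= mpoly.mmapX mpoly.mmap1U mpoly.mevalXU raddf_sum; apply: eq_bigr => i _ /=.
  by rewrite mpoly.mevalM mpoly.mevalC mpoly.mevalXU.
have pevE y t : pev y (map_poly th P) t = pev (u y) P t.
  by rewrite /pev -map_poly_comp; congr _.[_]; apply: eq_map_poly; exact: thE.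
exists (map_poly th P).
  have [x [t hx]] := pev_real_nonzero P0; apply: contraNneq hx => h.
  pose y : 'rV[R]_n := (\row_j x j) *m M'.
  have -> : (fun j => (x j)%:C) = u (rowC y).
    by rewrite -rowC_mulmx /y -mulmxA hM mulmx1; apply/funext => j; rewrite /rowC mxE.
  by rewrite -pevE h /pev map_poly0 horner0.
have [t t0 ht] := small_mulmx e0; exists t => // x hx.
rewrite pevE -rowC_mulmx; apply: hP; exact: box_le (box_mulmx (ltW t0) hx).
Qed.

End LinearSubstitution.

Section BasisChange.
Variables (R : realType) (A : hypercomplex).
Local Notation AA := ('rV[R]_(dA A).+1).
Implicit Types B : (dA A).+1.-tuple AA.

Lemma real_comb_mulmx B x : real_comb B x = x *m \matrix_j tnth B j.
Proof. by rewrite mulmx_sum_row; apply: eq_bigr => j _; rewrite rowK. Qed.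

Lemma real_domain_open (Omega : set AA) B : open Omega -> open (real_domain Omega B).
Proof.
rewrite !openE => oO x Ox.
rewrite /interior /real_domain; under eq_fun do rewrite real_comb_mulmx.
by apply: nbhs_mulmx; apply: oO; rewrite -real_comb_mulmx.
Qed.

(** Row i holds the [B]-coordinates of the i-th vector of [B'], since coordinate vectors are rows
    multiplied on the right. *)
Definition basis_matrix B B' : 'M[R]_((dA A).+1, (dA A).+1) := \matrix_(i, j) coord B j (tnth B' i).

Lemma tnth_coord B v : basis_of fullv B -> v = \sum_j coord B j v *: tnth B j.
Proof.
move=> hB; rewrite {1}(coord_basis hB (memvf v)); apply: eq_bigr => j _.
by rewrite (tnth_nth 0).
Qed.

Lemma coord_tnth B i j : basis_of fullv B -> coord B j (tnth B i) = (i == j)%:R.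
Proof. by move=> hB; rewrite (tnth_nth 0) coord_free // (basis_free hB). Qed.

Lemma coord_change B B' l v : basis_of fullv B ->
  coord B' l v = \sum_j coord B j v * coord B' l (tnth B j).
Proof.
move=> hB; rewrite {1}(tnth_coord v hB) linear_sum; apply: eq_bigr => j _.
by rewrite linearZ.
Qed.

Lemma basis_matrixK B B' : basis_of fullv B -> basis_of fullv B' ->
  basis_matrix B B' *m basis_matrix B' B = 1%:M.
Proof.
move=> hB hB'; apply/matrixP => i k; rewrite !mxE -(coord_tnth _ _ hB') (coord_change _ _ _ hB).
by apply: eq_bigr => j _; rewrite !mxE.
Qed.

Lemma real_comb_change B B' x : basis_of fullv B ->
  real_comb B (x *m basis_matrix B B') = real_comb B' x.
Proof.
move=> hB; rewrite /real_comb.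
transitivity (\sum_i \sum_j (x 0 i * coord B j (tnth B' i)) *: tnth B j).
  rewrite exchange_big; apply: eq_bigr => j _; rewrite mxE scaler_suml.
  by apply: eq_bigr => i _; rewrite mxE.
apply: eq_bigr => i _; rewrite {2}(tnth_coord (tnth B' i) hB) scaler_sumr.
by apply: eq_bigr => j _; rewrite scalerA.
Qed.

Lemma real_basis_change (Omega : set AA) (f : AA -> AA) B B' : open Omega ->
  basis_of fullv B -> basis_of fullv B' ->
  (forall l, nash (real_domain Omega B) (real_comp f B l)) ->
  forall l, nash (real_domain Omega B') (real_comp f B' l).
Proof.
move=> oO hB hB' h l; apply/nashP; first exact: real_domain_open.
move=> a Oa; pose M := basis_matrix B B'.
have Ob : real_domain Omega B (a *m M) by rewrite /real_domain /= real_comb_change.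
have hj j : rnash_at a (fun x => (real_comp f B j (x *m M))%:C).
  have [h1 h2] := (nashP _ (real_domain_open (B := B) oO)).1 (h j) _ Ob.
  split; first exact: (analytic_at_mulmx h1).
  exact: (algebraic_at_mulmx (basis_matrixK hB' hB) h2).
have := rnash_at_sum (index_enum _) (fun j => rnash_at_scale (coord B' l (tnth B j))%:C (hj j)).
apply: eq_rnash_at; exists 1 => // x _.
rewrite /real_comp real_comb_change // (coord_change _ _ _ hB) rmorph_sum.
by apply: eq_bigr => j _; rewrite rmorphM mulrC.
Qed.

End BasisChange.

(** * From real to complex Nash functions *)

Section MorePowerSeries.
Variables (R : realType) (n : nat).
Local Notation C := (R[i]).

Lemma ps_meval r (p : mpoly.mpoly n C) : 0 < r ->
  exists B : R, ps r B (fun y => mpoly.meval y p).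
Proof.
move=> r0.
have h m : ps r (normc (mpoly.mcoeff m p) * \prod_(i < n) r ^+ m i)
    (fun y => mpoly.mcoeff m p * \prod_(i < n) y i ^+ m i).
  by apply: ps_scale; apply: ps_prod => // i; apply: ps_exp => //; exact: ps_var.
eexists; apply: eq_ps (ps_bigsum (mpoly.msupp p) r0 h) => y _.
by rewrite mpoly.mevalE.
Qed.

(** Turns an equation along a power series into a power series, to which the identity theorem
    [ps_real_eq0] applies. *)
Lemma ps_pev r B g (P : {poly mpoly.mpoly n C}) : 0 < r -> ps r B g ->
  exists B' : R, ps r B' (fun y => pev y P (g y)).
Proof.
move=> r0 hg; elim/poly_ind: P => [|P c [B1 h1]].
  exists (normc (0 : C)); apply: eq_ps (ps_const n 0 r0) => y _.
  by rewrite /pev map_poly0 horner0.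
have [B2 h2] := ps_meval c r0.
exists (B1 * B + B2); apply: eq_ps (ps_add (ps_mul r0 h1 hg) h2) => y _.
by rewrite !pevE rmorphD rmorphM -!pevE pevX pevC.
Qed.

Implicit Types (a : 'rV[R]_n) (g : 'rV[R]_n -> C).

Lemma analytic_at_translate a g : analytic_at a g -> analytic_at 0 (fun x => g (a + x)).
Proof.
move=> [r [B [h [r0 hh hE]]]]; exists r, B, h; split=> // x hx.
have dE : diffC a (a + x) = diffC 0 x.
  by apply/funext => i; rewrite /diffC !mxE subr0 addrAC subrr add0r.
by rewrite -dE hE // => i; have := hx i; rewrite !mxE subr0 addrAC subrr add0r.
Qed.

Lemma analytic_at_horner3 a u v s (q : {poly {poly {poly C}}}) :
  analytic_at a u -> analytic_at a v -> analytic_at a (fun x => q.[(v x)%:P%:P].[(u x)%:P].[s]).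
Proof.
move=> hu hv.
have h2 (p : {poly {poly C}}) : analytic_at a (fun x => p.[(u x)%:P].[s]).
  elim/poly_ind: p => [|p c IH].
    by apply: eq_analytic_at (analytic_at_const a 0); exists 1 => // x _; rewrite !horner0.
  apply: eq_analytic_at (analytic_at_add (analytic_at_mul IH hu) (analytic_at_const a c.[s])).
  by exists 1 => // x _; rewrite !(hornerMXaddC, hornerD, hornerM, hornerC).
elim/poly_ind: q => [|q c IH].
  by apply: eq_analytic_at (analytic_at_const a 0); exists 1 => // x _; rewrite !horner0.
apply: eq_analytic_at (analytic_at_add (analytic_at_mul IH hv) (h2 c)).
by exists 1 => // x _; rewrite !(hornerMXaddC, hornerD, hornerM, hornerC).
Qed.

End MorePowerSeries.

(** * Restriction to a line and extension from a real segment *)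

Section Lines.
Variables (R : realType).
Local Notation C := (R[i]).

Lemma analytic_at_punctured (g : 'rV[R]_1 -> C) (d : R) : 0 < d -> analytic_at 0 g ->
  (forall x, box 0 d x -> x 0 0 != 0 -> g x = 0) -> g 0 = 0.
Proof.
move=> d0 [r [B [h [r0 hh hE]]]] h0; have [K K0 hK] := ps_continuous0 r0 hh.
have g0E : h (fun=> 0) = g 0 by rewrite -(diffC0 (0 : 'rV[R]_1)) hE //; exact: box_refl (ltW r0).
apply: normc0_eq0 => e e0.
have K1 : 0 < K + 1 by rewrite ltr_wpDl.
pose t := Num.min (Num.min r d) (e / (K + 1)).
have t0 : 0 < t by rewrite !lt_min r0 d0 divr_gt0.
pose x : 'rV[R]_1 := const_mx t.
have bx : box 0 t x by move=> i; rewrite !mxE subr0 ger0_norm // ltW.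
have tr : t <= r by rewrite !ge_min lexx.
have td : t <= d by rewrite !ge_min lexx orbT.
have te : t <= e / (K + 1) by rewrite ge_min lexx orbT.
have := hK t (diffC 0 x) (ltW t0) tr (polydisc_diffC bx).
have gx : g x = 0 by apply: h0; [exact: box_le bx|rewrite mxE gt_eqF].
rewrite hE ?gx ?g0E; last exact: box_le bx.
rewrite sub0r normcN' => hle; apply: le_trans hle _.
move: te; rewrite ler_pdivlMr // => te; apply: le_trans te.
by rewrite mulrC ler_wpM2l ?(ltW t0) // lerDl.
Qed.

Definition mpoly1_of_poly : {rmorphism {poly C} -> mpoly.mpoly 1 C} :=
  horner_eval (mpolyvar C (0 : 'I_1)) \o map_poly (@mpoly.mpolyC 1 C).

Lemma meval_mpoly1 (p : {poly C}) s : mpoly.meval (fun=> s) (mpoly1_of_poly p) = p.[s].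
Proof.
elim/poly_ind: p => [|p c IH]; first by rewrite rmorph0 mpoly.meval0 horner0.
rewrite rmorphD rmorphM mpoly.mevalD mpoly.mevalM IH hornerMXaddC; congr (_ * _ + _).
  by rewrite /= map_polyX /horner_eval hornerX mpoly.mevalXU.
by rewrite /= map_polyC /horner_eval hornerC mpoly.mevalC.
Qed.

Lemma pev_mpoly1 (Q : {poly {poly C}}) s t :
  pev (fun=> s) (map_poly mpoly1_of_poly Q) t = Q.[t%:P].[s].
Proof.
elim/poly_ind: Q => [|Q c IH]; first by rewrite rmorph0 /pev map_poly0 !horner0.
rewrite rmorphD rmorphM pevE rmorphD rmorphM -!pevE IH /= map_polyX pevX map_polyC pevC.
by rewrite meval_mpoly1 hornerMXaddC hornerD hornerM hornerC.
Qed.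

Lemma mpoly1_eq0 (Q : {poly {poly C}}) : map_poly mpoly1_of_poly Q = 0 -> Q = 0.
Proof.
move=> h; apply/polyP => k; rewrite coef0; apply/eqP; apply: contraT => hk.
have [s hs] := poly_nat_nonroot hk.
have := congr1 (fun p : {poly _} => mpoly.meval (fun=> s%:R) p`_k) h.
by rewrite coef_map meval_mpoly1 coef0 mpoly.meval0 => E; move: hs; rewrite E eqxx.
Qed.

(* If the annihilating polynomial vanishes identically along the line, it is
   divisible by a power of a transversal real parameter tau: divide by it and let
   tau tend to 0. *)
Lemma algebraic_at_line n (a : 'rV[R]_n) (i0 : 'I_n) g (d : R) : 0 < d ->
  (forall s, `|s| <= d -> analytic_at (a + s *: delta_mx 0 i0) g) -> algebraic_at a g ->
  algebraic_at (0 : 'rV[R]_1) (fun x => g (a + x 0 0 *: delta_mx 0 i0)).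
Proof.
move=> d0 hg [P P0 [e e0 hP]].
have [w [k [q [q0 hq]]]] := @pev_line R n P (rowC a) i0 P0 (fun=> erefl).
exists (map_poly mpoly1_of_poly q.[0]); first by apply: contraNneq q0 => /mpoly1_eq0 ->.
have e20 : 0 < e / 2 by rewrite divr_gt0.
have m0 : 0 < Num.min d (e / 2) by rewrite lt_min d0.
exists (Num.min d (e / 2)) => // x0 hx0; set s := x0 0 0.
have : `|s| <= Num.min d (e / 2) by have := hx0 0; rewrite mxE subr0.
rewrite le_min => /andP[sd se].
have -> : rowC x0 = (fun=> s%:C) by apply/funext => i; rewrite /rowC (ord1 i).
rewrite pev_mpoly1; set b := a + s *: delta_mx 0 i0.
pose W : 'M[R]_(1, n) := \row_i w i.
pose T (x : 'rV[R]_1) := q.[(x 0 0)%:C%:P%:P].[(g (b + x *m W))%:P].[s%:C].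
have hT : analytic_at 0 T.
  apply: analytic_at_horner3; last exact: analytic_at_coord.
  apply: (@analytic_at_mulmx R 1 n W 0 (fun y => g (b + y))); rewrite mul0mx.
  by apply: analytic_at_translate; exact: hg.
(* Half of [e] is reserved for the transversal displacement, the other half for the shift along the
   line. *)
have [t t0 ht] := small_mulmx W e20.
have T0 : T 0 = 0.
  apply: (analytic_at_punctured t0 hT) => x hx x0'.
  pose xb := b + x *m W.
  have hb : box a e xb.
    move=> i; have h1 := box_mulmx W (ltW t0) hx i.
    have h2 : `|(x *m W) 0 i| <= e / 2.
      by apply: le_trans ht; move: h1; rewrite mul0mx [X in _ - X]mxE subr0.
    have -> : xb 0 i - a 0 i = s * (delta_mx 0 i0 : 'rV[R]_n) 0 i + (x *m W) 0 i.
      by rewrite /xb /b !mxE; ring.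
    apply: le_trans (ler_normD _ _) _; rewrite [leRHS]splitr lerD // normrM.
    apply: le_trans se; rewrite -[leRHS]mulr1 ler_wpM2l // mxE eqxx /=.
    by case: (i == i0); rewrite ?normr1 ?normr0.
  have xE : rowC xb = (fun i => rowC a i + (i == i0)%:R * s%:C + (x 0 0)%:C * (w i)%:C).
    apply/funext => i; rewrite /rowC /xb /b !mxE eqxx /= big_ord1 mxE !rmorphD rmorphM.
    by congr (_ + _ + _); rewrite ?rmorphM // mulrC rmorph_nat.
  have := hP _ hb; rewrite xE hq => /eqP; rewrite mulf_eq0 expf_eq0 fmorph_eq0.
  by rewrite (negbTE x0') andbF /= => /eqP.
by move: T0; rewrite /T mul0mx addr0 mxE.
Qed.

(* The annihilating equation is a power series in z - z0 vanishing at real points. *)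
Lemma holo_at_algebraic (z0 : C) G : holo_at z0 G ->
  algebraic_at (0 : 'rV[R]_1) (fun x => G (z0 + (x 0 0)%:C)) -> calgebraic_at z0 G.
Proof.
move=> [r [B [h [r0 hh hE]]]] [P P0 [e e0 hP]].
have [B' [c hc]] := ps_pev P r0 hh.
have m0 : 0 < Num.min r e by rewrite lt_min r0.
have c0 : forall m, c m = 0.
  apply: (ps_real_eq0 r0 m0 hc) => y hy.
  have : `|y 0| <= Num.min r e by exact: hy.
  rewrite le_min => /andP[yr ye].
  have -> : (fun i => (y i)%:C) = (fun _ : 'I_1 => (z0 + (y 0)%:C) - z0).
    by apply/funext => i; rewrite (ord1 i) addrAC subrr add0r.
  rewrite hE; last by rewrite addrAC subrr add0r normc_real.
  have -> : (fun _ : 'I_1 => (z0 + (y 0)%:C) - z0) = rowC (const_mx (y 0)).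
    by apply/funext => i; rewrite /rowC mxE addrAC subrr add0r.
  have := hP (const_mx (y 0)); rewrite mxE; apply => i; by rewrite !mxE subr0.
(* [P] is an equation in the displacement from [z0]; substituting X - z0 makes it an equation in
   z. *)
pose th : {rmorphism mpoly.mpoly 1 C -> mpoly.mpoly 1 C} :=
  mpoly.mmap (@mpoly.mpolyC 1 C) (fun=> mpolyvar C (0 : 'I_1) - mpoly.mpolyC 1 z0).
have thE z : mpoly.meval (fun=> z) \o th =1 mpoly.meval (fun=> z - z0).
  apply: (@mpoly_rmorph_eq _ _ _ (mpoly.meval (fun=> z) \o th) (mpoly.meval (fun=> z - z0))) => [k|j].
    by rewrite /= mpoly.mmapC !mpoly.mevalC.
  by rewrite /= mpoly.mmapX mpoly.mmap1U mpoly.mevalB !mpoly.mevalXU mpoly.mevalC.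
have pevE z t : pev (fun=> z) (map_poly th P) t = pev (fun=> z - z0) P t.
  by rewrite /pev -map_poly_comp; congr _.[_]; apply: eq_map_poly; exact: thE.
exists (map_poly th P).
  have [x [t hx]] := pev_real_nonzero P0; apply: contraNneq hx => h0.
  have -> : (fun i => (x i)%:C) = (fun=> ((x 0)%:C + z0) - z0).
    by apply/funext => i; rewrite (ord1 i) addrK.
  by rewrite -pevE h0 /pev map_poly0 horner0.
exists r => // z hz; rewrite pevE -(hE z hz).
by apply: (ps_coef_eq0 hc c0) => i.
Qed.

End Lines.

(** * The Cauchy-Riemann equation for power series in two real variables *)

Section CauchyRiemann.
Variable R : realType.
Local Notation C := (R[i]).

(** A first-order remainder, weaker than in [has_cderiv], because stem functions are merely assumed
    C^1 here. *)
Definition has_rderiv (G : C -> C) (z u l : C) : Prop := forall e : R, 0 < e ->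
  exists2 d : R, 0 < d & forall t : R, `|t| <= d ->
    normc (G (z + t%:C * u) - G z - t%:C * l) <= e * `|t|.

Definition mk2 (j k : nat) : {ffun 'I_2 -> nat} := [ffun i => if i == 0 then j else k].

Lemma mk2E (m : {ffun 'I_2 -> nat}) : m = mk2 (m 0) (m 1).
Proof.
apply/ffunP => i; rewrite ffunE; case: eqP => [->//|/eqP i0].
by congr (m _); apply: val_inj; case: i i0 => [[|[|]]].
Qed.

Lemma mono_mk2 (y : 'I_2 -> C) j k : mono y (mk2 j k) = y 0 ^+ j * y 1 ^+ k.
Proof.
rewrite /mono big_ord_recl big_ord1 !ffunE eqxx; have -> : lift ord0 ord0 = 1 :> 'I_2 by apply: val_inj.
by [].
Qed.

Lemma mdegree_mk2 j k : mdegree (mk2 j k) = (j + k)%N.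
Proof. by rewrite /mdegree big_ord_recl big_ord1 !ffunE. Qed.

(** Each use of the equation trades one degree in the second variable for one in the first, with the
    factor i (j + 1) / (k + 1); these factors multiply up to the binomial coefficient. *)
Lemma CR_coef (c : {ffun 'I_2 -> nat} -> C) :
  (forall m, deriv_coef 0 c m + 'i%C * deriv_coef 1 c m = 0) ->
  forall j k, c (mk2 j k) = 'i%C ^+ k * 'C(j + k, k)%:R * c (mk2 (j + k) 0).
Proof.
move=> h j k; elim: k j => [|k IH] j; first by rewrite bin0 addn0 expr0 !mul1r.
have m0 : madd (mk2 j k) (mvar 0) = mk2 j.+1 k.
  by apply/ffunP => i; rewrite !ffunE; case: (i == 0); rewrite ?addn1 ?addn0.
have m1 : madd (mk2 j k) (mvar 1) = mk2 j k.+1.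
  apply/ffunP => i; rewrite !ffunE; case: i => [[|[|//]] hi] /=.
    by rewrite addn0.
  by rewrite addn1.
have := h (mk2 j k); rewrite /deriv_coef m0 m1 !ffunE /= IH => E.
have k0 : (k.+1%:R : C) != 0 by rewrite pnatr_eq0.
apply: (mulfI k0).
have {}E : k.+1%:R * c (mk2 j k.+1) =
    'i%C * (j.+1%:R * ('i%C ^+ k * 'C(j.+1 + k, k)%:R * c (mk2 (j.+1 + k) 0))).
  have i2 : 'i%C * 'i%C = -1 :> C by rewrite -expr2 sqr_i.
  have := congr1 (fun z => 'i%C * z) E; rewrite mulrDr mulr0 [X in _ + X]mulrA i2 mulN1r.
  by move/eqP; rewrite subr_eq0 => /eqP.
have -> : (j + k.+1 = j.+1 + k)%N by rewrite addnS addSn.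
have B : k.+1%:R * 'C(j.+1 + k, k.+1)%:R = j.+1%:R * 'C(j.+1 + k, k)%:R :> C.
  by rewrite -!natrM mul_bin_left addnK.
rewrite E exprS; transitivity ('i%C * 'i%C ^+ k * (j.+1%:R * 'C(j.+1 + k, k)%:R) * c (mk2 (j.+1 + k) 0)).
  by ring.
by rewrite -B; ring.
Qed.

(** Grouped by total degree N, the terms form the binomial expansion of (y_0 + i y_1)^N. *)
Lemma CR_series c (r B : R) g : 0 < r -> ps_coef c r B g ->
  (forall m, deriv_coef 0 c m + 'i%C * deriv_coef 1 c m = 0) ->
  sum_bounded (fun N : nat => c (mk2 N 0) * (r ^+ N)%:C) B /\
  forall y, polydisc r y -> has_sum (fun N => c (mk2 N 0) * (y 0 + 'i%C * y 1) ^+ N) (g y).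
Proof.
move=> r0 [hB hg] hc; split.
  have inj : injective (mk2 ^~ 0%N) by move=> j k /ffunP /(_ 0); rewrite !ffunE.
  by apply: sum_bounded_dom (sum_bounded_reindex inj hB) => N; rewrite mdegree_mk2 addn0.
move=> y hy; pose p (m : {ffun 'I_2 -> nat}) : nat := (m 0%R + m 1%R)%N.
apply: (has_sum_fibers (p := p) _ (sum_bounded_mono (p := id) hB hy) (hg y hy)) => N.
pose q (k : 'I_N.+1) := mk2 (N - k) k.
have qinj : injective q by move=> k l /ffunP /(_ 1); rewrite !ffunE /= => /val_inj.
apply/(has_sum_reindex (h := q)) => // [m hm|].
  case: eqP => // pm; have mN : (m 1%R < N.+1)%N by rewrite -pm ltnS leq_addl.
  by case: (hm (Ordinal mN)); rewrite {1}(mk2E m) /q /= -pm addnK.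
have := @has_sum_finType R 'I_N.+1 (fun k => c (mk2 N 0) * (y 0 ^+ (N - k) * ('i%C * y 1) ^+ k *+ 'C(N, k))).
rewrite -mulr_sumr -exprDn; apply: eq_has_sum => k.
have kN : (k <= N)%N by rewrite -ltnS.
rewrite /p !ffunE /=.
case: eqP => [_|[]]; last exact: subnK.
rewrite /q mono_mk2 (CR_coef hc (N - k)) (subnK kN) exprMn -[_ *+ 'C(N, k)]mulr_natr.
by ring.
Qed.

(* The coefficients c_{jk} of a power series in two real variables satisfying the
   Cauchy-Riemann equation are i^k C(j+k, k) c_{j+k,0}. *)
Lemma CR_holo (z0 : C) (G : C -> C) (d : R) : 0 < d ->
  analytic_at (\row_(j < 2) if j == 0 then complex.Re z0 else complex.Im z0)
    (fun x => G (x 0 0 +i* x 0 1)) ->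
  (forall z, normc (z - z0) <= d ->
     exists l, has_rderiv G z 1 ('i%C * l) /\ has_rderiv G z 'i%C (- l)) ->
  holo_at z0 G.
Proof.
move=> d0 [r [B [h [r0 [c hc] hE]]]] hCR.
pose zc (y : 'I_2 -> R) : C := z0 + ((y 0)%:C + 'i%C * (y 1)%:C).
have hR (y : 'I_2 -> R) : (forall i, `|y i| <= r) -> h (fun i => (y i)%:C) = G (zc y).
  move=> hy; pose a : 'rV[R]_2 := \row_j if j == 0 then complex.Re z0 else complex.Im z0.
  pose x : 'rV[R]_2 := a + \row_i y i.
  have dE i : x 0 i - a 0 i = y i by rewrite !mxE addrAC subrr add0r.
  have -> : (fun i => (y i)%:C) = diffC a x by apply/funext => i; rewrite /diffC dE.
  rewrite hE; last by move=> i; rewrite dE.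
  congr G; rewrite !mxE eqxx /= /zc; case: (z0) => u v /=.
  by rewrite !mul_complexE !add_complexE; congr (_ +i* _); ring.
have [h0 [B0 [hc0 [K0 K00 hK0]]]] := ps_deriv 0 r0 hc.
have [h1 [B1 [hc1 [K1 K10 hK1]]]] := ps_deriv 1 r0 hc.
have r40 : 0 < r / 4 by rewrite divr_gt0.
have r4r : r / 4 <= r by rewrite ler_pdivrMr // ler_peMr ?(ltW r0) // ler1n.
(* Points of size at most [s], moved by at most r/8, stay in the polydisc of radius r/4 where
   [ps_deriv] applies, and [zc y] stays within [d] of [z0]. *)
pose s := Num.min (r / 8) (d / 2).
have s0 : 0 < s by rewrite lt_min !divr_gt0.
(* The derivative of the series and the directional derivative of [G] agree, as both approximate the
   same increment to first order. *)
have key (i : 'I_2) (u l : C) (h' : ('I_2 -> C) -> C) (K : R) (y : 'I_2 -> R) :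
    (forall i, `|y i| <= s) -> 0 <= K ->
    (forall (y : 'I_2 -> R) (t : R), zc (fun j => if j == i then y j + t else y j) = zc y + t%:C * u) ->
    (forall y t, polydisc (r / 4) y -> polydisc (r / 4) (shift y i t) ->
      normc (h (shift y i t) - h y - t * h' y) <= K * normc t ^+ 2) ->
    has_rderiv G (zc y) u l -> h' (fun i => (y i)%:C) = l.
  move=> hy KK hzc hK hl; apply/eqP; rewrite -subr_eq0; apply/eqP/normc0_eq0 => e e0.
  have e20 : 0 < e / 2 by rewrite divr_gt0.
  have [dl dl0 hdl] := hl _ e20.
  have K1' : 0 < K + 1 by rewrite ltr_wpDl.
  pose t := Num.min (Num.min dl (r / 8)) (e / 2 / (K + 1)).
  have t0 : 0 < t by rewrite !lt_min dl0 !divr_gt0.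
  have tdl : t <= dl by rewrite !ge_min lexx.
  have tr : t <= r / 8 by rewrite !ge_min lexx orbT.
  have te : K * t <= e / 2.
    have : t <= e / 2 / (K + 1) by rewrite !ge_min lexx orbT.
    rewrite ler_pdivlMr // => te; apply: le_trans te.
    by rewrite mulrC ler_wpM2l ?(ltW t0) // lerDl.
  have r8 : r / 8 + r / 8 = r / 4 by field.
  have hs i' : `|y i'| <= r / 8 by apply: le_trans (hy i') _; rewrite ge_min lexx.
  have r84 : r / 8 <= r / 4 by rewrite -r8 lerDl divr_ge0 // ltW.
  pose yC i := (y i)%:C : C.
  have shE : shift yC i t%:C = (fun j => ((if j == i then y j + t else y j))%:C).
    by apply/funext => j; rewrite /shift; case: ifP => // _; rewrite rmorphD.
  have hs' j : `|if j == i then y j + t else y j| <= r / 4.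
    case: ifP => _; last exact: le_trans (hs j) r84.
    by apply: le_trans (ler_normD _ _) _; rewrite -r8 lerD // ger0_norm // ltW.
  have p1 : polydisc (r / 4) yC by move=> j; rewrite normc_real; exact: le_trans (hs j) r84.
  have p2 : polydisc (r / 4) (shift yC i t%:C) by move=> j; rewrite shE normc_real.
  have H1 := hK yC t%:C p1 p2.
  rewrite shE hR in H1; last by move=> j; exact: le_trans (hs' j) r4r.
  rewrite hR in H1; last by move=> j; apply: le_trans (hs j) (le_trans r84 r4r).
  rewrite hzc in H1.
  have H2 : normc (G (zc y + t%:C * u) - G (zc y) - t%:C * l) <= e / 2 * t.
    by have := hdl t; rewrite ger0_norm ?(ltW t0) //; apply.
  have H3 : t * normc (h' yC - l) <= t * e.
    have -> : t * normc (h' yC - l) = normc ((G (zc y + t%:C * u) - G (zc y) - t%:C * l) -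
        (G (zc y + t%:C * u) - G (zc y) - t%:C * h' yC)).
      rewrite -[t in LHS](@ger0_norm R) ?(ltW t0) // -normc_real -normcM.
      by congr normc; ring.
    apply: le_trans (ler_normcD _ _) _; rewrite normcN'.
    apply: le_trans (lerD H2 H1) _; rewrite normc_real ger0_norm ?(ltW t0) //.
    rewrite expr2 mulrA -mulrDl mulrC ler_wpM2l ?(ltW t0) // [leRHS]splitr lerD //.
  by move: H3; rewrite ler_pM2l.
(* The Cauchy-Riemann expression of the series vanishes at small real points, hence so do its
   coefficients. *)
have cr m : deriv_coef 0 c m + 'i%C * deriv_coef 1 c m = 0.
  have hs : ps_coef (fun m => deriv_coef 0 c m + 'i%C * deriv_coef 1 c m) (r / 4)
      (B0 + normc ('i%C : C) * B1) (fun y => h0 y + 'i%C * h1 y).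
    split.
      apply: sum_bounded_dom (sum_boundedD hc0.1 (sum_boundedZ 'i%C hc1.1)) => m'.
      by rewrite mulrDl mulrA.
    move=> y hy; apply: eq_has_sum (has_sumD (hc0.2 y hy) (has_sumZ 'i%C (hc1.2 y hy))) => m'.
    by rewrite mulrDl mulrA.
  apply: (ps_real_eq0 r40 s0 hs) => y hy.
  have [|l [hl1 hl2]] := hCR (zc y).
    rewrite /zc addrAC subrr add0r; apply: le_trans (ler_normcD _ _) _.
    have i1 : normc ('i%C : C) = 1 by rewrite /= expr0n expr1n add0r sqrtr1.
    rewrite normcM i1 mul1r !normc_real [leRHS]splitr lerD //; apply: le_trans (hy _) _;
      by rewrite ge_min lexx orbT.
  rewrite (key 0 1 ('i%C * l) h0 K0 y hy K00 _ hK0 hl1); last first.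
    by move=> y' t; rewrite /zc /= mulr1 rmorphD; ring.
  rewrite (key 1 'i%C (- l) h1 K1 y hy K10 _ hK1 hl2); last first.
    by move=> y' t; rewrite /zc /= rmorphD; ring.
  by rewrite mulrN subrr.
have [hB hS] := CR_series r0 hc cr.
exists r, B, (fun y : 'I_1 -> C => G (z0 + y 0)); split=> //; last first.
  by move=> z _; rewrite addrC subrK.
apply: (nat_ps (G := fun w => G (z0 + w)) r0 hB) => w hw.
pose y (j : 'I_2) : R := if j == 0 then complex.Re w else complex.Im w.
have hy j : `|y j| <= r.
  rewrite /y; case: ifP => _; apply: le_trans hw; [exact: Re_le_normc|exact: Im_le_normc].
have wE : (y 0)%:C + 'i%C * (y 1)%:C = w by rewrite /y /= -complexE.
have hp : polydisc r (fun j => (y j)%:C) by move=> j; rewrite normc_real.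
by have := hS _ hp; rewrite hR // /zc wE.
Qed.

End CauchyRiemann.

(** * From real components to the stem function *)

Section RealToSlice.
Variables (R : realType) (A : hypercomplex).
Local Notation C := (R[i]).
Local Notation AA := ('rV[R]_(dA A).+1).
Local Notation "x ** y" := (amul x y) (at level 40, left associativity).
Local Notation one := (aone R A).

Lemma derivable_bound (V : normedModType R) (g : R -> V) (a e : R) : derivable g a 1 -> 0 < e ->
  exists2 d : R, 0 < d & forall t, `|t| <= d -> `|g (a + t) - g a - t *: 'D_1 g a| <= e * `|t|.
Proof.
move=> hg e0; move: (hg) => /cvgrPdist_le /(_ _ e0) [d /= d0 hd].
exists (d / 2); first by rewrite divr_gt0.
move=> t td; have [->|t0] := eqVneq t 0; first by rewrite addr0 subrr scale0r subrr !normr0 mulr0.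
have := hd t; rewrite /= sub0r normrN => H.
have {}H := H (le_lt_trans td _) t0.
have -> : g (a + t) - g a - t *: 'D_1 g a = t *: (t^-1 *: (g (a + t) - g a) - 'D_1 g a).
  by rewrite scalerBr scalerA mulfV // scale1r.
rewrite normrZ mulrC ler_wpM2r // distrC.
have := H _; rewrite [t *: 1]mulr1 [t + a]addrC; apply.
by rewrite ltr_pdivrMr // ltr_pMr // ltr1n.
Qed.

Definition coordC (l : 'I_(dA A).+1) (w : AA * AA) : C := w.1 0 l +i* w.2 0 l.

Lemma coordCB l w w' : coordC l (w - w') = coordC l w - coordC l w'.
Proof. by rewrite /coordC /= !mxE. Qed.

Lemma coordCZ l (t : R) w : coordC l (t *: w) = t%:C * coordC l w.
Proof. by rewrite /coordC /= !mxE mul_complexE !mul0r subr0 addr0. Qed.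

Lemma coordC_iota l w : coordC l (iotaAC w) = 'i%C * coordC l w.
Proof. by rewrite /coordC /iotaAC /= !mxE mul_complexE !mul0r !mul1r sub0r add0r. Qed.

Lemma coordC_le l w : normc (coordC l w) <= 2 * `|w|.
Proof.
apply: le_trans (normc_le_ReIm _) _; rewrite /= mulr_natl mulr2n.
have hx (x : AA) : `|x 0 l| <= `|x|.
  rewrite /Num.norm /= mx_normE.
  exact: (le_bigmax _ (fun ij : 'I_1 * 'I_(dA A).+1 => `|x ij.1 ij.2|%:nng) (0, l)).
rewrite prod_normE; apply: lerD; apply: le_trans (hx _) _; by rewrite le_max lexx ?orbT.
Qed.

Variables (Omega : set AA) (f : AA -> AA) (D : set C^o) (F : C^o -> AA * AA).
Hypotheses (hF : induced_by Omega f D F) (hol : holomorphic_on D F).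

Lemma coordC_CR l z : D z -> exists w,
  has_rderiv (fun z => coordC l (F z)) z 1 ('i%C * w) /\
  has_rderiv (fun z => coordC l (F z)) z 'i%C (- w).
Proof.
move=> Dz; have [h1 h2 _ _] := hol.1 _ Dz; have h3 := hol.2 _ Dz.
have key (g : R -> AA * AA) (a : R) (u w : C) : derivable g a 1 ->
    (forall t, g (a + t) = F (z + t%:C * u)) -> coordC l ('D_1 g a) = w ->
    has_rderiv (fun z => coordC l (F z)) z u w.
  move=> hg gE <- e e0; have e20 : 0 < e / 2 by rewrite divr_gt0.
  have [d d0 hd] := derivable_bound hg e20; exists d => // t /hd H.
  have g0 : F z = g a by rewrite -[a]addr0 gE rmorph0 mul0r addr0.
  rewrite -gE g0 -coordCZ -!coordCB.
  apply: le_trans (coordC_le _ _) _; apply: le_trans (ler_wpM2l _ H) _ => //.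
  by rewrite mulrA mulrCA mulfV ?mulr1 // pnatr_eq0.
(* The Cauchy-Riemann equation reads d_re = - iota d_im, and [coordC] turns iota into multiplication
   by i. *)
exists (- coordC l (d_im F z)); split.
  apply: key h1 _ _ => [t|].
    by rewrite /re_line mulr1; congr F; case: z {Dz h2 h3} => a b; rewrite add_complexE addr0.
  have -> : 'D_1 (re_line F z) (complex.Re z) = 0 - iotaAC (d_im F z).
    by apply/eqP; rewrite sub0r -addr_eq0; apply/eqP.
  have c0 : coordC l 0 = 0 by rewrite /coordC /= !mxE.
  by rewrite coordCB c0 sub0r coordC_iota mulrN.
apply: key h2 _ _ => [t|]; last by rewrite opprK.
rewrite /im_line; congr F; case: z {Dz h1 h3} => a b.
by rewrite mul_complexE add_complexE /= !mul0r !mulr0 !mulr1 subrr !addr0.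
Qed.

Let e (i : 'I_(dA A).+1) : AA := delta_mx 0 i.

(** From F_2 = - I (I F_2), where I F_2 is half the difference of the two values of [f]; the
    remaining factor i is that of F_1 + i F_2. *)
Definition line_coef (I : AA) (l i : 'I_(dA A).+1) : C := - 2^-1 * 'i%C * ((I ** e i) 0 l)%:C.

(* F_1 and F_2 are recovered from the values of f at the two points phi I z and
   phi I (conjc z). *)
Definition coord_of (I : AA) (l : 'I_(dA A).+1) (u u' : 'I_(dA A).+1 -> C) : C :=
  2^-1 * (u l + u' l) + \sum_(i <- index_enum 'I_(dA A).+1) line_coef I l i * (u i + -1 * u' i).

Lemma coordC_slice I l z : imag_unit I -> D z -> coordC l (F z) =
  coord_of I l (fun i => (f (phi I z) 0 i)%:C) (fun i => (f (phi I (conjc z)) 0 i)%:C).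
Proof.
move=> hI Dz; have [[_ cD cF] _ hf] := hF.
rewrite !hf //; last exact: cD.
rewrite cF // /conjAC /= amulNr.
set w1 := (F z).1; set w2 := (F z).2; set v := I ** w2.
have vE : (I ** v) = - w2 by exact: amul_imag_unit.
have vl : (- w2) 0 l = \sum_i v 0 i * (I ** e i) 0 l.
  rewrite -vE; transitivity ((I ** \sum_i v 0 i *: e i) 0 l); first by congr ((I ** _) 0 l); exact: row_sum_delta.
  rewrite amul_sumr summxE; apply: eq_bigr => i _.
  by rewrite amulZr mxE.
have -> : coordC l (F z) = (w1 0 l)%:C + 'i%C * (w2 0 l)%:C by rewrite [LHS]complexE.
rewrite /coord_of; congr (_ + _).
  rewrite !mxE -rmorphD; have -> : w1 0 l + v 0 l + (w1 0 l - v 0 l) = 2 * w1 0 l by ring.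
  by rewrite rmorphM rmorph_nat mulKf // pnatr_eq0.
have -> : w2 0 l = - \sum_i v 0 i * (I ** e i) 0 l by rewrite -vl mxE opprK.
rewrite rmorphN rmorph_sum mulrN mulr_sumr -sumrN; apply: eq_bigr => i _.
rewrite !mxE /line_coef !(rmorphM, rmorphB, rmorphD) /=; by field.
Qed.

Hypothesis oO : open Omega.
Hypothesis hN : forall l a, Omega a -> rnash_at a (fun x => (f x 0 l)%:C).

Lemma coord_of_analytic n (a : 'rV[R]_n) I l (u u' : 'I_(dA A).+1 -> 'rV[R]_n -> C) :
  (forall i, analytic_at a (u i)) -> (forall i, analytic_at a (u' i)) ->
  analytic_at a (fun x => coord_of I l (u ^~ x) (u' ^~ x)).
Proof.
move=> hu hu'; apply: analytic_at_add.
  by apply: analytic_at_scale; exact: analytic_at_add.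
apply: analytic_at_sum => i; apply: analytic_at_scale; apply: analytic_at_add => //.
exact: analytic_at_scale.
Qed.

Lemma coord_of_algebraic n (a : 'rV[R]_n) I l (u u' : 'I_(dA A).+1 -> 'rV[R]_n -> C) :
  (forall i, algebraic_at a (u i)) -> (forall i, algebraic_at a (u' i)) ->
  algebraic_at a (fun x => coord_of I l (u ^~ x) (u' ^~ x)).
Proof.
move=> hu hu'; apply: algebraic_at_add.
  by apply: algebraic_at_scale; exact: algebraic_at_add.
apply: algebraic_at_sum => i; apply: algebraic_at_scale; apply: algebraic_at_add => //.
exact: algebraic_at_scale.
Qed.

Lemma Omega_phi I z : imag_unit I -> D z -> Omega (phi I z).
Proof. by move=> hI Dz; have [_ -> _] := hF; exists z, I. Qed.

(** The slice is embedded linearly by the matrix with rows 1 and I, and the conjugate point by the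
    one with rows 1 and -I; analyticity passes through both. *)
Lemma coordC_analytic l z0 : D z0 ->
  analytic_at (\row_(j < 2) if j == 0 then complex.Re z0 else complex.Im z0)
    (fun x => coordC l (F (x 0 0 +i* x 0 1))).
Proof.
move=> Dz0; have [hI _ _] := @std_splitting_base R A; set I := std_I R A in hI.
have [[_ cD _] _ _] := hF.
set a : 'rV[R]_2 := \row_j _.
pose M (v : AA) : 'M[R]_(2, (dA A).+1) := \matrix_(j < 2) if j == 0 then one else v.
have ME v (x : 'rV[R]_2) : x *m M v = x 0 0 *: one + x 0 1 *: v.
  rewrite mulmx_sum_row big_ord_recl big_ord1 !rowK /=.
  by have -> : lift ord0 ord0 = 1 :> 'I_2 by apply: val_inj.
have ph (x : 'rV[R]_2) : phi I (x 0 0 +i* x 0 1) = x *m M I by rewrite ME.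
have ph' (x : 'rV[R]_2) : phi I (conjc (x 0 0 +i* x 0 1)) = x *m M (- I).
  by rewrite ME /phi /= scaleNr scalerN.
have za : a 0 0 +i* a 0 1 = z0 by rewrite !mxE /=; case: (z0).
have h1 i : analytic_at a (fun x => (f (x *m M I) 0 i)%:C).
  apply: (@analytic_at_mulmx R _ _ (M I) a (fun y => (f y 0 i)%:C)).
  by rewrite -ph za; exact: (hN i (Omega_phi hI Dz0)).1.
have h2 i : analytic_at a (fun x => (f (x *m M (- I)) 0 i)%:C).
  apply: (@analytic_at_mulmx R _ _ (M (- I)) a (fun y => (f y 0 i)%:C)).
  by rewrite -ph' za; exact: (hN i (Omega_phi hI (cD _ Dz0))).1.
apply: eq_analytic_at (coord_of_analytic I l h1 h2).
have [d d0 hd] := stem_disc_open hF Dz0.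
exists (d / 2); first by rewrite divr_gt0.
move=> x hx; rewrite (coordC_slice l hI) -?ph -?ph' //.
apply: hd; rewrite -za opp_complexE add_complexE.
apply: le_trans (normc_le_ReIm _) _; rewrite [leRHS]splitr; apply: lerD; exact: hx.
Qed.

(** Translating z by a real s translates [phi I z] and [phi I (conjc z)] by the same multiple of 1,
    so [algebraic_at_line] is applied in the direction e_0 at both points. *)
Lemma coordC_cnash l z0 : D z0 -> cnash_at z0 (fun z => coordC l (F z)).
Proof.
move=> Dz0; have [hI _ _] := @std_splitting_base R A; set I := std_I R A in hI.
have [[_ cD _] _ _] := hF.
have [d d0 hd] := stem_disc_open hF Dz0.
have hh : holo_at z0 (fun z => coordC l (F z)).
  by apply: (CR_holo d0 (coordC_analytic l Dz0)) => z /hd; exact: coordC_CR.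
split=> //; apply: holo_at_algebraic hh _.
have Ds s : `|s| <= d -> D (z0 + s%:C).
  by move=> hs; apply: hd; rewrite addrAC subrr add0r normc_real.
have ph z s : phi I (z + s%:C) = phi I z + s *: delta_mx 0 0.
  by case: z => u v; rewrite add_complexE /phi /= addr0 scalerDl addrAC.
have cj s : conjc (z0 + s%:C) = conjc z0 + s%:C by rewrite rmorphD /= oppr0.
have h1 i : algebraic_at (0 : 'rV[R]_1) (fun x => (f (phi I z0 + x 0 0 *: delta_mx 0 0) 0 i)%:C).
  apply: (algebraic_at_line (g := fun y => (f y 0 i)%:C) d0) => [s /Ds Dz|].
    by rewrite -ph; exact: (hN i (Omega_phi hI Dz)).1.
  exact: (hN i (Omega_phi hI Dz0)).2.
have h2 i : algebraic_at (0 : 'rV[R]_1) (fun x => (f (phi I (conjc z0) + x 0 0 *: delta_mx 0 0) 0 i)%:C).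
  apply: (algebraic_at_line (g := fun y => (f y 0 i)%:C) d0) => [s /Ds Dz|].
    by rewrite -ph -cj; exact: (hN i (Omega_phi hI (cD _ Dz))).1.
  exact: (hN i (Omega_phi hI (cD _ Dz0))).2.
apply: eq_algebraic_at (coord_of_algebraic I l h1 h2); exists d => // x hx.
rewrite (coordC_slice l hI); first by rewrite cj !ph.
by apply: Ds; have := hx 0; rewrite mxE subr0.
Qed.

(** Each stem component is a real combination of the functions [coordC]; [p] stands for the real or
    the imaginary part. *)
Lemma real_stem_cnash I (J : 'I_(uA A).+1 -> AA) : splitting_base I J -> stem_cnash D F I J.
Proof.
move=> hIJ k z Dz.
have sumC (s : seq 'I_(dA A).+1) (G H : 'I_(dA A).+1 -> R) :
    (\sum_(i <- s) G i) +i* (\sum_(i <- s) H i) = \sum_(i <- s) (G i +i* H i).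
  elim: s => [|i s IH]; [by rewrite !big_nil|by rewrite !big_cons -IH].
have key (p : C -> R) : {morph p : x y / x + y} -> (forall (a : R) c, p (a%:C * c) = a * p c) ->
    cnash_at z (fun w => (p (CI_coord I J (F w).1 0 k) +i* p (CI_coord I J (F w).2 0 k))).
  move=> pD pZ; have p0 : p 0 = 0 by have := pZ 0 0; rewrite mulr0 mul0r.
  have psum (T : Type) (s : seq T) (G : T -> C) : p (\sum_(t <- s) G t) = \sum_(t <- s) p (G t).
    by elim: s => [|t s IH]; rewrite ?big_nil // !big_cons pD IH.
  have pE v : p (CI_coord I J v 0 k) = \sum_i p (CI_coord I J (e i) 0 k) * v 0 i.
    rewrite [in LHS](row_sum_delta v) CI_coord_sum // summxE psum; apply: eq_bigr => i _.
    by rewrite CI_coordZ // mxE pZ mulrC.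
  have := cnash_at_sum (index_enum _)
    (fun i => cnash_at_scale (p (CI_coord I J (e i) 0 k))%:C (coordC_cnash i Dz)).
  apply: eq_cnash_at; exists 1 => // w _; rewrite !pE sumC; apply: eq_bigr => i _.
  by rewrite /coordC mul_complexE !mul0r subr0 addr0.
split; apply: key => //; try by move=> [a b] [c d].
  by move=> a [b c] /=; rewrite mul0r subr0.
by move=> a [b c] /=; rewrite mul0r addr0.
Qed.

End RealToSlice.

Lemma real_to_slice_nash (R : realType) (A : hypercomplex) (Omega : set 'rV[R]_(dA A).+1)
    (f : 'rV[R]_(dA A).+1 -> 'rV[R]_(dA A).+1) : open Omega -> slice_regular Omega f ->
  (forall B : (dA A).+1.-tuple 'rV[R]_(dA A).+1, basis_of fullv B ->
     forall l, nash (real_domain Omega B) (real_comp f B l)) -> slice_nash Omega f.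
Proof.
move=> oO [D [F [hF hol]]] h.
have hN l a : Omega a -> rnash_at a (fun x => (f x 0 l)%:C).
  have := h _ (std_tuple_basis R A) l.
  have -> : real_domain Omega (std_tuple R A) = Omega.
    by apply/seteqP; split=> x; rewrite /real_domain /= real_comb_std.
  move/(nashP _ oO) => h1 Oa; have := h1 _ Oa.
  suff -> : (fun x => (f x 0 l)%:C) = (fun x => (real_comp f (std_tuple R A) l x)%:C) by [].
  by apply/funext => x; rewrite /real_comp real_comb_std coord_std.
exists D, F; split=> //; exists (std_I R A), (@std_J R A); split; first exact: std_splitting_base.
have hS := real_stem_cnash hF hol hN (@std_splitting_base R A).
have oD := stem_disc_open hF.
by move=> k; split; apply/(nash1P _ oD) => z Dz; have [] := hS k z Dz.
Qed.

Theorem theorem1p4 (R : realType) (A : hypercomplex)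
    (Omega : set 'rV[R]_(dA A).+1)
    (f : 'rV[R]_(dA A).+1 -> 'rV[R]_(dA A).+1) :
  Omega !=set0 -> open Omega -> circular Omega -> slice_function Omega f ->
  [<-> slice_nash Omega f;
       exists I J, splitting_base I J /\
         forall k, nash1 (slice_domain Omega I) (slice_comp f I J k);
       forall I J, splitting_base I J ->
         forall k, nash1 (slice_domain Omega I) (slice_comp f I J k);
       slice_regular Omega f /\
         exists2 B : (dA A).+1.-tuple 'rV[R]_(dA A).+1, basis_of fullv B &
           forall l, nash (real_domain Omega B) (real_comp f B l);
       slice_regular Omega f /\
         forall B : (dA A).+1.-tuple 'rV[R]_(dA A).+1, basis_of fullv B ->
           forall l, nash (real_domain Omega B) (real_comp f B l)].
Proof.
move=> _ oO _ hf; tfae.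
- exact: slice_nash_splitting.
- exact: splitting_change.
- exact: splitting_to_real.
- move=> [hr [B hB hN]]; split=> // B' hB'; exact: (real_basis_change oO hB hB' hN).
- by move=> [hr hN]; exact: real_to_slice_nash.
Qed.
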